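(* Let $(D,\alpha)$ be an admissible pair and let $m$ be the maximal multiplicity of an arrow of $D$ directed towards the node $\alpha$. The Koszul module $\mathcal{W}(D,\alpha)$ is nilpotent if and only if $m=1$.
   Context: **Kac-Moody Lie algebras.** A generalized Cartan matrix is a matrix $A=(a_{i,j})_{1\le i,j\le n}$ with $a_{i,i}=2$, $a_{i,j}\in\mathbb{Z}_{\le 0}$ for $i\ne j$, and $a_{i,j}=0\Rightarrow a_{j,i}=0$. Its generalized Dynkin diagram $D$ has nodes $\alpha_1,\dots,\alpha_n$ and, for $i\neq j$, an arrow from $\alpha_i$ to $\alpha_j$ of multiplicity $-a_{j,i}$ (no arrow is drawn if $a_{j,i}=0$). A realization of $A$ is a complex vector space $\mathfrak{h}$ of dimension $n+\mathrm{corank}(A)$ with linearly independent subsets $\{\alpha_1^\vee,\dots,\alpha_n^\vee\}\subset\mathfrak{h}$ and $\{\alpha_1,\dots,\alpha_n\}\subset\mathfrak{h}^*$ (the simple roots) such that $\alpha_j(\alpha_i^\vee)=a_{i,j}$; it is unique up to isomorphism. Let $\widetilde{\mathfrak{g}}(A)$ be the complex Lie algebra generated by $\mathfrak{h}$ and $e_i,f_i$ ($1\le i\le n$) with relations $[\mathfrak{h},\mathfrak{h}]=0$, $[e_i,f_j]=\delta_{i,j}\alpha_i^\vee$, $[h,e_i]=\alpha_i(h)e_i$, $[h,f_i]=-\alpha_i(h)f_i$ for $h\in\mathfrak{h}$. The Kac-Moody Lie algebra is $\mathfrak{g}(D)=\mathfrak{g}(A)=\widetilde{\mathfrak{g}}(A)/\mathfrak{r}$,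 where $\mathfrak{r}$ is the unique maximal ideal with $\mathfrak{r}\cap\mathfrak{h}=\{0\}$. A (sub)diagram is of finite type if its Kac-Moody Lie algebra is finite-dimensional. **Grading.** For $\delta\in\mathfrak{h}^*$ let $\mathfrak{g}_\delta=\{x\in\mathfrak{g}: [h,x]=\delta(h)x\ \forall h\in\mathfrak{h}\}$, with $\mathfrak{g}=\mathfrak{g}(D)$. Then $\mathfrak{g}=\bigoplus_{\delta}\mathfrak{g}_\delta$ over $\delta$ in the root lattice $\bigoplus_j\mathbb{Z}\alpha_j$, and the summand for $\delta=0$ is $\mathfrak h$. Given a node (simple root) $\alpha$, the associated $\mathbb{Z}$-grading $\mathfrak{g}=\bigoplus_{i\in\mathbb{Z}}\mathfrak{g}_i$ has $\mathfrak{g}_i$ equal to the sum of all $\mathfrak{g}_\delta$ such that the coefficient of $\alpha$ in $\delta$ is $i$. **Admissible pairs.** For a generalized Dynkin diagram $D$ and a node $\alpha$, the pair $(D,\alpha)$ is admissible if each connected component of the diagram obtained from $D$ by removing $\alpha$ is of finite type. In this case $\mathfrak{g}_0$ and $\mathfrak{g}_1$ are finite-dimensional. **Koszul modules.** For a finite-dimensional complex vector space $V$, let $S=\mathrm{Sym}(V)$, and let $\delta_3:S\otimes\bigwedge^3V\to S\otimes\bigwedge^2V$ be the Koszul differential, $\delta_3(v_1\wedge v_2\wedge v_3)=v_1\otimes(v_2\wedge v_3)-v_2\otimes(v_1\wedge v_3)+v_3\otimes(v_1\wedge v_2)$. For a linear subspace $\iota:K\hookrightarrow\bigwedge^2V$,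 the Koszul module $\mathcal{W}(V,K)$ is the $S$-module $\mathrm{coker}\big(S\otimes(\bigwedge^3V\oplus K)\xrightarrow{\delta_3\oplus(\mathrm{id}\otimes\iota)}S\otimes\bigwedge^2V\big)$, graded with $\bigwedge^2V$ and $K$ in degree $0$ and $\bigwedge^3V$ in degree $1$. It is called nilpotent if it has finite length, i.e. $\mathcal{W}(V,K)_q=0$ for $q\gg0$. **Koszul module of an admissible pair.** $\mathcal{W}(D,\alpha):=\mathcal{W}\big(\mathfrak{g}_1,\ker([\cdot,\cdot]:\bigwedge^2\mathfrak{g}_1\to\mathfrak{g}_2)\big)$, where the grading is the one associated with $\alpha$. *)

(* Defs.v *)
From HB Require Import structures.
From mathcomp Require Import all_boot all_order all_algebra generic_quotient.
From mathcomp Require Import boolp reals.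
From mathcomp Require Import complex.

Set Implicit Arguments.
Unset Strict Implicit.
Unset Printing Implicit Defensive.

Import GRing.Theory.
Local Open Scope ring_scope.
Local Open Scope quotient_scope.

Record submodule (R : pzRingType) (M : lmodType R) := Submodule {
  submod_pred :> {pred M};
  submodP : submod_closed submod_pred }.

Section Submodule.
Context {R : pzRingType} {M : lmodType R} (N : submodule M).

Lemma submod0 : 0 \in N. Proof. by case: (submodP N). Qed.
Lemma submodDZ c x y : x \in N -> y \in N -> c *: x + y \in N.
Proof. by case: (submodP N) => _; apply. Qed.
Lemma submodD x y : x \in N -> y \in N -> x + y \in N.
Proof. by move=> Nx Ny; rewrite -[x]scale1r submodDZ. Qed.
Lemma submodZ c x : x \in N -> c *: x \in N.
Proof. by move=> Nx; rewrite -[_ *: _]addr0 submodDZ // submod0. Qed.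
Lemma submodN x : x \in N -> - x \in N.
Proof. by move=> Nx; rewrite -scaleN1r submodZ. Qed.
Lemma submodB x y : x \in N -> y \in N -> x - y \in N.
Proof. by move=> Nx Ny; rewrite submodD // submodN. Qed.
Lemma submod_sum n (v : 'I_n -> M) :
  (forall i, v i \in N) -> \sum_(i < n) v i \in N.
Proof. by move=> Nv; elim/big_ind: _ => //; [exact: submod0|exact: submodD]. Qed.

Record submod_type := SubmodType {
  submod_val :> M; _ : submod_val \in N }.

HB.instance Definition _ := [isSub for submod_val].
HB.instance Definition _ := [Choice of submod_type by <:].
Fact submod_semi : subsemimod_closed N.
Proof. exact: GRing.submod_closed_semi (submodP N). Qed.
HB.instance Definition _ :=
  GRing.SubChoice_isSubLmodule.Build R M (submod_pred N) submod_type submod_semi.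

Fact submod_val_linear : linear submod_val. Proof. exact: (linearP val). Qed.
HB.instance Definition _ :=
  GRing.isLinear.Build R submod_type M *:%R submod_val submod_val_linear.

Definition submod_eqb (x y : M) : bool := x - y \in N.
Lemma submod_eqb_equiv : equiv_class_of submod_eqb.
Proof.
split=> [x|x y|y x z]; rewrite /submod_eqb.
- by rewrite subrr submod0.
- by apply/idP/idP=> /submodN; rewrite opprB.
- by move=> Nxy Nyz; rewrite -[x](addrNK y) -addrA submodD.
Qed.
Canonical submod_equivRel := EquivRelPack submod_eqb_equiv.
Canonical submod_encModRel := defaultEncModRel submod_eqb.

Definition quot_mod := {eq_quot submod_eqb}.
HB.instance Definition _ := Choice.on quot_mod.
HB.instance Definition _ := EqQuotient.on quot_mod.

Definition qproj (x : M) : quot_mod := \pi x.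

Lemma qprojP x y : qproj x = qproj y <-> x - y \in N.
Proof.
split=> [/eqmodP //|h].
by apply/eqmodP.
Qed.

Lemma qreprK (q : quot_mod) : qproj (repr q) = q. Proof. exact: reprK. Qed.

Lemma qproj_repr x : repr (qproj x) - x \in N.
Proof. by apply/qprojP; rewrite qreprK. Qed.

Definition qadd (p q : quot_mod) : quot_mod := qproj (repr p + repr q).
Definition qopp (p : quot_mod) : quot_mod := qproj (- repr p).
Definition qscale (c : R) (p : quot_mod) : quot_mod := qproj (c *: repr p).

Lemma qaddE x y : qadd (qproj x) (qproj y) = qproj (x + y).
Proof. by apply/qprojP; rewrite opprD addrACA; apply: submodD; exact: qproj_repr. Qed.
Lemma qoppE x : qopp (qproj x) = qproj (- x).
Proof. by apply/qprojP; rewrite -opprD; apply: submodN; exact: qproj_repr. Qed.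
Lemma qscaleE c x : qscale c (qproj x) = qproj (c *: x).
Proof. by apply/qprojP; rewrite -scalerBr; apply: submodZ; exact: qproj_repr. Qed.

Fact qaddA : associative qadd.
Proof.
move=> x y z; rewrite -[x]qreprK -[y]qreprK -[z]qreprK.
by rewrite !qaddE addrA.
Qed.
Fact qaddC : commutative qadd.
Proof. by move=> x y; rewrite -[x]qreprK -[y]qreprK !qaddE addrC. Qed.
Fact qadd0 : left_id (qproj 0) qadd.
Proof. by move=> x; rewrite -[x]qreprK qaddE add0r. Qed.
Fact qaddN : left_inverse (qproj 0) qopp qadd.
Proof. by move=> x; rewrite -[x]qreprK qoppE qaddE addNr. Qed.
HB.instance Definition _ := GRing.isZmodule.Build quot_mod qaddA qaddC qadd0 qaddN.

Lemma qprojD x y : qproj (x + y) = qproj x + qproj y.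
Proof. exact/esym/qaddE. Qed.

Fact qscaleA a b x : qscale a (qscale b x) = qscale (a * b) x.
Proof. by rewrite -[x]qreprK !qscaleE scalerA. Qed.
Fact qscale1 : left_id 1 qscale.
Proof. by move=> x; rewrite -[x]qreprK qscaleE scale1r. Qed.
Fact qscaleDr : right_distributive qscale +%R.
Proof.
move=> c x y; rewrite -[x]qreprK -[y]qreprK -qprojD !qscaleE.
by rewrite -qprojD scalerDr.
Qed.
Fact qscaleDl x : {morph qscale^~ x : a b / a + b}.
Proof. by move=> a b; rewrite -[x]qreprK !qscaleE -qprojD scalerDl. Qed.
HB.instance Definition _ :=
  GRing.Zmodule_isLmodule.Build R quot_mod qscaleA qscale1 qscaleDr qscaleDl.

Fact qproj_linear : linear qproj.
Proof.
by move=> c x y; rewrite qprojD -qscaleE.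
Qed.
HB.instance Definition _ := GRing.isLinear.Build R M quot_mod *:%R qproj qproj_linear.

End Submodule.

Section Span.
Context {R : pzRingType} {M : lmodType R} (P : M -> Prop).

Definition span_pred : {pred M} := fun x => `[< exists (n : nat)
  (c : 'I_n -> R) (v : 'I_n -> M),
  (forall i, P (v i)) /\ x = \sum_(i < n) c i *: v i >].

Fact span_closed : submod_closed span_pred.
Proof.
split=> [|a x y]; first by apply/asboolP; exists 0, (fun=> 0), (fun=> 0); split;
  [case | rewrite big_ord0].
move=> /asboolP[n [c [v [Pv ->]]]] /asboolP[p [d [w [Pw ->]]]]; apply/asboolP.
exists (n + p)%N, (fun i => match split i with inl j => a * c j | inr j => d j end),
  (fun i => match split i with inl j => v j | inr j => w j end).
split=> [i|]; first by case: split.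
rewrite big_split_ord scaler_sumr /=; congr (_ + _); apply: eq_bigr => i _.
  by rewrite (unsplitK (inl i)) scalerA.
by rewrite (unsplitK (inr i)).
Qed.

Definition span : submodule M := Submodule span_closed.

End Span.

Section KerCoker.
Context {R : pzRingType} {M N : lmodType R} (f : {linear M -> N}).

Fact ker_closed : submod_closed (fun x => f x == 0).
Proof.
split=> [|c x y]; first by rewrite unfold_in linear0.
by rewrite !unfold_in linearP => /eqP-> /eqP->; rewrite scaler0 addr0.
Qed.
Definition ker_mod : submodule M := Submodule ker_closed.

Fact im_closed : submod_closed (fun y => `[< exists x, f x = y >]).
Proof.
split=> [|c y z]; first by apply/asboolP; exists 0; rewrite linear0.
move=> /asboolP[x <-] /asboolP[x' <-]; apply/asboolP.
by exists (c *: x + x'); rewrite linearP.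
Qed.
Definition im_mod : submodule N := Submodule im_closed.

Definition coker := quot_mod im_mod.
HB.instance Definition _ := GRing.Lmodule.on coker.

End KerCoker.

Definition fin_dim (F : fieldType) (M : lmodType F) : Prop :=
  exists (n : nat) (b : 'I_n -> M),
    forall x, exists c : 'I_n -> F, x = \sum_(i < n) c i *: b i.

(* Modules, commutative algebras and Lie algebras given by generators and
   relations are quotients of a type of formal expressions by the congruence
   generated by the axioms of the structure and the given relations. *)
Inductive mod_term (R X : Type) : Type :=
| MGen of X
| MZero
| MAdd of mod_term R X & mod_term R X
| MOpp of mod_term R X
| MScale of R & mod_term R X.
Arguments MGen {R X}.
Arguments MZero {R X}.

HB.instance Definition _ R X := gen_eqMixin (mod_term R X).
HB.instance Definition _ R X := gen_choiceMixin (mod_term R X).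

Inductive mod_eq (R : pzRingType) (X : Type)
    (rel : mod_term R X -> mod_term R X -> Prop) :
    mod_term R X -> mod_term R X -> Prop :=
| mod_rel t u : rel t u -> mod_eq rel t u
| mod_refl t : mod_eq rel t t
| mod_sym t u : mod_eq rel t u -> mod_eq rel u t
| mod_trans t u w : mod_eq rel t u -> mod_eq rel u w -> mod_eq rel t w
| mod_congD t t' u u' : mod_eq rel t t' -> mod_eq rel u u' ->
    mod_eq rel (MAdd t u) (MAdd t' u')
| mod_congN t t' : mod_eq rel t t' -> mod_eq rel (MOpp t) (MOpp t')
| mod_congZ c t t' : mod_eq rel t t' -> mod_eq rel (MScale c t) (MScale c t')
| mod_addA t u w : mod_eq rel (MAdd t (MAdd u w)) (MAdd (MAdd t u) w)
| mod_addC t u : mod_eq rel (MAdd t u) (MAdd u t)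
| mod_add0 t : mod_eq rel (MAdd MZero t) t
| mod_addN t : mod_eq rel (MAdd (MOpp t) t) MZero
| mod_scaleA a b t : mod_eq rel (MScale a (MScale b t)) (MScale (a * b) t)
| mod_scale1 t : mod_eq rel (MScale 1 t) t
| mod_scaleDr a t u : mod_eq rel (MScale a (MAdd t u)) (MAdd (MScale a t) (MScale a u))
| mod_scaleDl a b t : mod_eq rel (MScale (a + b) t) (MAdd (MScale a t) (MScale b t)).

Section PresentedModule.
Context {R : pzRingType} {X : Type} (rel : mod_term R X -> mod_term R X -> Prop).

Definition mod_eqb t u : bool := `[< mod_eq rel t u >].
Lemma mod_eqb_equiv : equiv_class_of mod_eqb.
Proof.
split=> [t|t u|u t w]; first exact/asboolP/mod_refl.
  by apply/asboolP/asboolP; exact: mod_sym.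
by move=> /asboolP tu /asboolP uw; apply/asboolP/(mod_trans tu uw).
Qed.
Canonical mod_equivRel := EquivRelPack mod_eqb_equiv.
Canonical mod_encModRel := defaultEncModRel mod_eqb.

Definition pres_mod := {eq_quot mod_eqb}.
HB.instance Definition _ := Choice.on pres_mod.
HB.instance Definition _ := EqQuotient.on pres_mod.

Definition pm_class (t : mod_term R X) : pres_mod := \pi t.
Definition pm_gen (x : X) : pres_mod := pm_class (MGen x).

Lemma pm_classP t u : pm_class t = pm_class u <-> mod_eq rel t u.
Proof. by split=> [/eqmodP/asboolP //|h]; apply/eqmodP/asboolP. Qed.
Lemma pm_reprK q : pm_class (repr q) = q. Proof. exact: reprK. Qed.
Lemma pm_class_repr t : mod_eq rel (repr (pm_class t)) t.
Proof. by apply/pm_classP; rewrite pm_reprK. Qed.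

Definition pm_add (p q : pres_mod) : pres_mod := pm_class (MAdd (repr p) (repr q)).
Definition pm_opp (p : pres_mod) : pres_mod := pm_class (MOpp (repr p)).
Definition pm_scale (c : R) (p : pres_mod) : pres_mod := pm_class (MScale c (repr p)).

Lemma pm_addE t u : pm_add (pm_class t) (pm_class u) = pm_class (MAdd t u).
Proof. by apply/pm_classP/mod_congD; exact: pm_class_repr. Qed.
Lemma pm_oppE t : pm_opp (pm_class t) = pm_class (MOpp t).
Proof. by apply/pm_classP/mod_congN; exact: pm_class_repr. Qed.
Lemma pm_scaleE c t : pm_scale c (pm_class t) = pm_class (MScale c t).
Proof. by apply/pm_classP/mod_congZ; exact: pm_class_repr. Qed.

Fact pm_addA : associative pm_add.
Proof.
move=> x y z; rewrite -[x]pm_reprK -[y]pm_reprK -[z]pm_reprK !pm_addE.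
exact/pm_classP/mod_addA.
Qed.
Fact pm_addC : commutative pm_add.
Proof.
move=> x y; rewrite -[x]pm_reprK -[y]pm_reprK !pm_addE.
exact/pm_classP/mod_addC.
Qed.
Fact pm_add0 : left_id (pm_class MZero) pm_add.
Proof. by move=> x; rewrite -[x]pm_reprK pm_addE; exact/pm_classP/mod_add0. Qed.
Fact pm_addN : left_inverse (pm_class MZero) pm_opp pm_add.
Proof.
by move=> x; rewrite -[x]pm_reprK pm_oppE pm_addE; exact/pm_classP/mod_addN.
Qed.
HB.instance Definition _ :=
  GRing.isZmodule.Build pres_mod pm_addA pm_addC pm_add0 pm_addN.

Fact pm_scaleA a b x : pm_scale a (pm_scale b x) = pm_scale (a * b) x.
Proof. by rewrite -[x]pm_reprK !pm_scaleE; exact/pm_classP/mod_scaleA. Qed.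
Fact pm_scale1 : left_id 1 pm_scale.
Proof. by move=> x; rewrite -[x]pm_reprK pm_scaleE; exact/pm_classP/mod_scale1. Qed.
Fact pm_scaleDr : right_distributive pm_scale +%R.
Proof.
move=> c x y; rewrite -[x]pm_reprK -[y]pm_reprK [X in pm_scale c X]pm_addE.
rewrite !pm_scaleE [RHS]pm_addE; exact/pm_classP/mod_scaleDr.
Qed.
Fact pm_scaleDl x : {morph pm_scale^~ x : a b / a + b}.
Proof.
move=> a b; rewrite -[x]pm_reprK !pm_scaleE [RHS]pm_addE.
exact/pm_classP/mod_scaleDl.
Qed.
HB.instance Definition _ :=
  GRing.Zmodule_isLmodule.Build R pres_mod pm_scaleA pm_scale1 pm_scaleDr pm_scaleDl.

Lemma pm_classD t u : pm_class (MAdd t u) = pm_class t + pm_class u.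
Proof. exact/esym/pm_addE. Qed.
Lemma pm_classN t : pm_class (MOpp t) = - pm_class t.
Proof. exact/esym/pm_oppE. Qed.
Lemma pm_classZ c t : pm_class (MScale c t) = c *: pm_class t.
Proof. exact/esym/pm_scaleE. Qed.

Section Lift.
Context {M : lmodType R} (f : X -> M).

Fixpoint mod_eval (t : mod_term R X) : M :=
  match t with
  | MGen x => f x
  | MZero => 0
  | MAdd t u => mod_eval t + mod_eval u
  | MOpp t => - mod_eval t
  | MScale c t => c *: mod_eval t
  end.

Context (f_rel : forall t u, rel t u -> mod_eval t = mod_eval u).

Lemma mod_eval_eq t u : mod_eq rel t u -> mod_eval t = mod_eval u.
Proof.
elim=> /=; rewrite -?/mod_eval; intros;
  rewrite ?addrA ?add0r ?addNr ?scalerA ?scale1r ?scalerDr ?scalerDl //;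
  try congruence; by [exact: f_rel | rewrite addrC].
Qed.

(* The well-definedness proof is an argument so that the lift is canonically
   linear. *)
Definition pm_lift of (forall t u, rel t u -> mod_eval t = mod_eval u) :
  pres_mod -> M := fun q => mod_eval (repr q).

Lemma pm_lift_class t : pm_lift f_rel (pm_class t) = mod_eval t.
Proof. exact/mod_eval_eq/pm_class_repr. Qed.

Fact pm_lift_linear : linear (pm_lift f_rel).
Proof.
move=> c x y; rewrite -[x]pm_reprK -[y]pm_reprK -pm_classZ -pm_classD.
by rewrite !pm_lift_class.
Qed.
HB.instance Definition _ :=
  GRing.isLinear.Build R pres_mod M *:%R (pm_lift f_rel) pm_lift_linear.

End Lift.
End PresentedModule.

(* The symmetric algebra of [V] is the commutative [F]-algebra generated by [V],
   with relations expressing that [V -> sym V] is [F]-linear. *)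
Inductive sym_term (F V : Type) : Type :=
| SVar of V
| SConst of F
| SAdd of sym_term F V & sym_term F V
| SOpp of sym_term F V
| SMul of sym_term F V & sym_term F V.
Arguments SVar {F V}.
Arguments SConst {F V}.

HB.instance Definition _ F V := gen_eqMixin (sym_term F V).
HB.instance Definition _ F V := gen_choiceMixin (sym_term F V).

Inductive sym_eq (F : fieldType) (V : lmodType F) :
    sym_term F V -> sym_term F V -> Prop :=
| sym_refl t : sym_eq t t
| sym_sym t u : sym_eq t u -> sym_eq u t
| sym_trans t u w : sym_eq t u -> sym_eq u w -> sym_eq t w
| sym_congD t t' u u' : sym_eq t t' -> sym_eq u u' -> sym_eq (SAdd t u) (SAdd t' u')
| sym_congN t t' : sym_eq t t' -> sym_eq (SOpp t) (SOpp t')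
| sym_congM t t' u u' : sym_eq t t' -> sym_eq u u' -> sym_eq (SMul t u) (SMul t' u')
| sym_addA t u w : sym_eq (SAdd t (SAdd u w)) (SAdd (SAdd t u) w)
| sym_addC t u : sym_eq (SAdd t u) (SAdd u t)
| sym_add0 t : sym_eq (SAdd (SConst 0) t) t
| sym_addN t : sym_eq (SAdd (SOpp t) t) (SConst 0)
| sym_mulA t u w : sym_eq (SMul t (SMul u w)) (SMul (SMul t u) w)
| sym_mulC t u : sym_eq (SMul t u) (SMul u t)
| sym_mul1 t : sym_eq (SMul (SConst 1) t) t
| sym_mulDl t u w : sym_eq (SMul (SAdd t u) w) (SAdd (SMul t w) (SMul u w))
| sym_constD a b : sym_eq (SConst (a + b)) (SAdd (SConst a) (SConst b))
| sym_constM a b : sym_eq (SConst (a * b)) (SMul (SConst a) (SConst b))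
| sym_var_linear c v w :
    sym_eq (SVar (c *: v + w)) (SAdd (SMul (SConst c) (SVar v)) (SVar w)).

Section Sym.
Context {F : fieldType} (V : lmodType F).
Implicit Types t u : sym_term F V.

Definition sym_eqb t u : bool := `[< sym_eq t u >].
Lemma sym_eqb_equiv : equiv_class_of sym_eqb.
Proof.
split=> [t|t u|u t w]; first exact/asboolP/sym_refl.
  by apply/asboolP/asboolP; exact: sym_sym.
by move=> /asboolP tu /asboolP uw; apply/asboolP/(sym_trans tu uw).
Qed.
Canonical sym_equivRel := EquivRelPack sym_eqb_equiv.
Canonical sym_encModRel := defaultEncModRel sym_eqb.

Definition sym := {eq_quot sym_eqb}.
HB.instance Definition _ := Choice.on sym.
HB.instance Definition _ := EqQuotient.on sym.

Definition sym_class t : sym := \pi t.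

Lemma sym_classP t u : sym_class t = sym_class u <-> sym_eq t u.
Proof. by split=> [/eqmodP/asboolP //|h]; apply/eqmodP/asboolP. Qed.
Lemma sym_reprK (q : sym) : sym_class (repr q) = q. Proof. exact: reprK. Qed.
Lemma sym_class_repr t : sym_eq (repr (sym_class t)) t.
Proof. by apply/sym_classP; rewrite sym_reprK. Qed.

Definition sym_add (p q : sym) : sym := sym_class (SAdd (repr p) (repr q)).
Definition sym_opp (p : sym) : sym := sym_class (SOpp (repr p)).
Definition sym_mul (p q : sym) : sym := sym_class (SMul (repr p) (repr q)).
Definition sym_scale (c : F) (p : sym) : sym :=
  sym_mul (sym_class (SConst c)) p.

Lemma sym_addE t u : sym_add (sym_class t) (sym_class u) = sym_class (SAdd t u).
Proof. by apply/sym_classP/sym_congD; exact: sym_class_repr. Qed.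
Lemma sym_oppE t : sym_opp (sym_class t) = sym_class (SOpp t).
Proof. by apply/sym_classP/sym_congN; exact: sym_class_repr. Qed.
Lemma sym_mulE t u : sym_mul (sym_class t) (sym_class u) = sym_class (SMul t u).
Proof. by apply/sym_classP/sym_congM; exact: sym_class_repr. Qed.

Fact sym_addqA : associative sym_add.
Proof.
move=> x y z; rewrite -[x]sym_reprK -[y]sym_reprK -[z]sym_reprK !sym_addE.
exact/sym_classP/sym_addA.
Qed.
Fact sym_addqC : commutative sym_add.
Proof.
move=> x y; rewrite -[x]sym_reprK -[y]sym_reprK !sym_addE.
exact/sym_classP/sym_addC.
Qed.
Fact sym_addq0 : left_id (sym_class (SConst 0)) sym_add.
Proof. by move=> x; rewrite -[x]sym_reprK sym_addE; exact/sym_classP/sym_add0. Qed.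
Fact sym_addqN : left_inverse (sym_class (SConst 0)) sym_opp sym_add.
Proof.
by move=> x; rewrite -[x]sym_reprK sym_oppE sym_addE; exact/sym_classP/sym_addN.
Qed.
HB.instance Definition _ :=
  GRing.isZmodule.Build sym sym_addqA sym_addqC sym_addq0 sym_addqN.

Fact sym_mulqA : associative sym_mul.
Proof.
move=> x y z; rewrite -[x]sym_reprK -[y]sym_reprK -[z]sym_reprK !sym_mulE.
exact/sym_classP/sym_mulA.
Qed.
Fact sym_mulqC : commutative sym_mul.
Proof.
move=> x y; rewrite -[x]sym_reprK -[y]sym_reprK !sym_mulE.
exact/sym_classP/sym_mulC.
Qed.
Fact sym_mulq1 : left_id (sym_class (SConst 1)) sym_mul.
Proof. by move=> x; rewrite -[x]sym_reprK sym_mulE; exact/sym_classP/sym_mul1. Qed.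
Fact sym_mulqDl : left_distributive sym_mul +%R.
Proof.
move=> x y z; rewrite -[x]sym_reprK -[y]sym_reprK -[z]sym_reprK.
rewrite [X in sym_mul X _]sym_addE !sym_mulE [RHS]sym_addE.
exact/sym_classP/sym_mulDl.
Qed.

Fixpoint sym_aug t : F :=
  match t with
  | SVar _ => 0
  | SConst c => c
  | SAdd t u => sym_aug t + sym_aug u
  | SOpp t => - sym_aug t
  | SMul t u => sym_aug t * sym_aug u
  end.
Lemma sym_aug_eq t u : sym_eq t u -> sym_aug t = sym_aug u.
Proof.
elim=> /=; intros;
  rewrite ?addrA ?add0r ?addNr ?mulrA ?mul1r ?mulrDl ?mulr0 ?addr0 //;
  try congruence; by [rewrite addrC | rewrite mulrC].
Qed.
Fact sym_1_neq_0 : sym_class (SConst 1) != 0.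
Proof. by apply/eqP => /sym_classP/sym_aug_eq /= /eqP; rewrite oner_eq0. Qed.

HB.instance Definition _ := GRing.Zmodule_isComNzRing.Build sym
  sym_mulqA sym_mulqC sym_mulq1 sym_mulqDl sym_1_neq_0.

Fact sym_scaleA a b x : sym_scale a (sym_scale b x) = sym_scale (a * b) x.
Proof.
rewrite /sym_scale sym_mulqA sym_mulE; congr sym_mul.
exact/sym_classP/sym_sym/sym_constM.
Qed.
Fact sym_scale1 : left_id 1 sym_scale. Proof. exact: sym_mulq1. Qed.
Fact sym_scaleDr : right_distributive sym_scale +%R.
Proof. by move=> c; exact: (@mulrDr sym). Qed.
Fact sym_scaleDl x : {morph sym_scale^~ x : a b / a + b}.
Proof.
move=> a b; rewrite -[RHS](@mulrDl sym); congr sym_mul.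
by rewrite [RHS]sym_addE; exact/sym_classP/sym_constD.
Qed.
HB.instance Definition _ := GRing.Zmodule_isLmodule.Build F sym
  sym_scaleA sym_scale1 sym_scaleDr sym_scaleDl.
Fact sym_scaleAl (a : F) (x y : sym) : a *: (x * y) = (a *: x) * y.
Proof. exact: (@mulrA sym). Qed.
HB.instance Definition _ := GRing.Lmodule_isLalgebra.Build F sym sym_scaleAl.
HB.instance Definition _ := GRing.Lalgebra_isComAlgebra.Build F sym.

Definition sym_var (v : V) : sym := sym_class (SVar v).

Fact sym_var_is_linear : linear sym_var.
Proof.
move=> c v w.
have ->: c *: sym_var v + sym_var w = sym_class (SAdd (SMul (SConst c) (SVar v)) (SVar w)).
  by rewrite -sym_addE -sym_mulE.
exact/sym_classP/sym_var_linear.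
Qed.
HB.instance Definition _ :=
  GRing.isLinear.Build F V sym *:%R sym_var sym_var_is_linear.

(* The homogeneous component of degree [q]. *)
Definition sym_pow (q : nat) : submodule sym :=
  span (fun s => exists v : 'I_q -> V, s = \prod_(i < q) sym_var (v i)).

End Sym.

(* Restriction of scalars along [F -> A]. *)
Definition res_scal (F : fieldType) (A : lalgType F) (M : lmodType A) : Type := M.

Section RestrictScalars.
Context {F : fieldType} {A : lalgType F} (M : lmodType A).
HB.instance Definition _ := GRing.Zmodule.copy (res_scal M) M.

Definition res_scale (c : F) (x : res_scal M) : res_scal M := (c%:A : A) *: (x : M).
Fact res_scaleA a b x : res_scale a (res_scale b x) = res_scale (a * b) x.
Proof. by rewrite /res_scale scalerA -scalerAl mul1r scalerA. Qed.
Fact res_scale1 : left_id 1 res_scale.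
Proof. by move=> x; rewrite /res_scale !scale1r. Qed.
Fact res_scaleDr : right_distributive res_scale +%R.
Proof. by move=> c x y; rewrite /res_scale scalerDr. Qed.
Fact res_scaleDl x : {morph res_scale^~ x : a b / a + b}.
Proof. by move=> a b; rewrite /res_scale !scalerDl. Qed.
HB.instance Definition _ := GRing.Zmodule_isLmodule.Build F (res_scal M)
  res_scaleA res_scale1 res_scaleDr res_scaleDl.

Lemma res_scalE c (x : res_scal M) : c *: x = (c%:A : A) *: (x : M).
Proof. by []. Qed.
End RestrictScalars.

(* [A (x)_F U] is the [A]-module generated by the symbols [1 (x) u], subject to
   [F]-linearity in [u]. *)
Inductive ext_scal_rel (F : fieldType) (A : lalgType F) (U : lmodType F) :
    mod_term A U -> mod_term A U -> Prop :=
| ext_scal_linear c u v :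
    ext_scal_rel (MGen (c *: u + v)) (MAdd (MScale c%:A (MGen u)) (MGen v)).

Section ExtendScalars.
Context {F : fieldType} (A : lalgType F).

Definition ext_scal (U : lmodType F) := pres_mod (@ext_scal_rel F A U).
HB.instance Definition _ U := GRing.Lmodule.on (ext_scal U).

Definition one_tens (U : lmodType F) (u : U) : res_scal (ext_scal U) := pm_gen _ u.

Fact one_tens_linear U : linear (@one_tens U).
Proof.
move=> c u v; rewrite /one_tens /pm_gen.
have /pm_classP-> := mod_rel (ext_scal_linear A c u v).
by rewrite pm_classD pm_classZ.
Qed.
HB.instance Definition _ U :=
  GRing.isLinear.Build F U (res_scal (ext_scal U)) *:%R (@one_tens U) (@one_tens_linear U).

Section Lift.
Context {U : lmodType F} {M : lmodType A} (f : {linear U -> res_scal M}).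

Fact ext_scal_lift_rel (t u : mod_term A U) : ext_scal_rel t u ->
  @mod_eval A U M f t = @mod_eval A U M f u.
Proof. by case=> c x y /=; rewrite linearP. Qed.

(* [a (x) u |-> a *: f u] *)
Definition ext_scal_lift : {linear ext_scal U -> M} := pm_lift ext_scal_lift_rel.

End Lift.

Definition ext_scal_map (U W : lmodType F) (f : {linear U -> W}) :
    {linear ext_scal U -> ext_scal W} :=
  ext_scal_lift (@one_tens W \o f).

End ExtendScalars.

Inductive ext2_rel (F : fieldType) (V : lmodType F) :
    mod_term F (V * V) -> mod_term F (V * V) -> Prop :=
| ext2_linear1 c u u' v : ext2_rel (MGen (c *: u + u', v))
    (MAdd (MScale c (MGen (u, v))) (MGen (u', v)))
| ext2_linear2 c u v v' : ext2_rel (MGen (u, c *: v + v'))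
    (MAdd (MScale c (MGen (u, v))) (MGen (u, v')))
| ext2_alt u : ext2_rel (MGen (u, u)) MZero.

Inductive ext3_rel (F : fieldType) (V : lmodType F) :
    mod_term F (V * V * V) -> mod_term F (V * V * V) -> Prop :=
| ext3_linear1 c u u' v w : ext3_rel (MGen (c *: u + u', v, w))
    (MAdd (MScale c (MGen (u, v, w))) (MGen (u', v, w)))
| ext3_linear2 c u v v' w : ext3_rel (MGen (u, c *: v + v', w))
    (MAdd (MScale c (MGen (u, v, w))) (MGen (u, v', w)))
| ext3_linear3 c u v w w' : ext3_rel (MGen (u, v, c *: w + w'))
    (MAdd (MScale c (MGen (u, v, w))) (MGen (u, v, w')))
| ext3_alt12 u w : ext3_rel (MGen (u, u, w)) MZero
| ext3_alt13 u v : ext3_rel (MGen (u, v, u)) MZero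
| ext3_alt23 u v : ext3_rel (MGen (u, v, v)) MZero.

Section Exterior.
Context {F : fieldType} (V : lmodType F).

Definition ext2 := pres_mod (@ext2_rel F V).
HB.instance Definition _ := GRing.Lmodule.on ext2.
Definition wedge2 (u v : V) : ext2 := pm_gen _ (u, v).

Definition ext3 := pres_mod (@ext3_rel F V).
HB.instance Definition _ := GRing.Lmodule.on ext3.
Definition wedge3 (u v w : V) : ext3 := pm_gen _ (u, v, w).

End Exterior.

Section WedgeTheory.
Context {F : fieldType} {V : lmodType F}.
Implicit Types u v w : V.

Lemma wedge2_linearl c u u' v :
  wedge2 (c *: u + u') v = c *: wedge2 u v + wedge2 u' v.
Proof.
have /pm_classP := mod_rel (ext2_linear1 c u u' v).
by rewrite pm_classD pm_classZ; exact.
Qed.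
Lemma wedge2_linearr c u v v' :
  wedge2 u (c *: v + v') = c *: wedge2 u v + wedge2 u v'.
Proof.
have /pm_classP := mod_rel (ext2_linear2 c u v v').
by rewrite pm_classD pm_classZ; exact.
Qed.
Lemma wedge2vv u : wedge2 u u = 0.
Proof. by have /pm_classP := mod_rel (ext2_alt u); exact. Qed.
Lemma wedge2C u v : wedge2 u v = - wedge2 v u.
Proof.
have := wedge2vv (1 *: u + v).
rewrite wedge2_linearl !wedge2_linearr !wedge2vv !scale1r add0r addr0 addrC.
by move/eqP; rewrite addr_eq0 => /eqP->; rewrite opprK.
Qed.

Section Lift2.
Context {M : lmodType F} (f : V -> V -> M).
Context (f_linl : forall v, linear (f^~ v)) (f_linr : forall u, linear (f u)).
Context (f_alt : forall u, f u u = 0).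

Fact ext2_lift_rel (t u : mod_term F (V * V)) : ext2_rel t u ->
  mod_eval (fun p => f p.1 p.2) t = mod_eval (fun p => f p.1 p.2) u.
Proof. by case=> [c x x' y|c x y y'|x] /=; rewrite ?f_linl ?f_linr ?f_alt. Qed.

Definition ext2_lift : {linear ext2 V -> M} := pm_lift ext2_lift_rel.
End Lift2.
End WedgeTheory.

Section Koszul.
Context {F : fieldType} (V : lmodType F).
Local Notation S := (sym V).
Local Notation "S (x) U" := (ext_scal S U) (at level 40).

Definition var_tens (v : V) (om : ext2 V) : res_scal (S (x) ext2 V) :=
  sym_var v *: (one_tens S om : S (x) ext2 V).

Lemma var_tens_linearl om : linear (var_tens^~ om).
Proof.
move=> c v w; rewrite /var_tens linearP scalerDl.
by congr (_ + _); rewrite res_scalE scalerA -scalerAl mul1r.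
Qed.
Lemma var_tens_linearr v : linear (var_tens v).
Proof.
move=> c om om'; rewrite /var_tens linearP [LHS]scalerDr.
by congr (_ + _); rewrite !res_scalE !scalerA mulrC.
Qed.
HB.instance Definition _ v := GRing.isLinear.Build F (ext2 V)
  (res_scal (S (x) ext2 V)) *:%R (var_tens v) (var_tens_linearr v).

Definition delta3_gen (p : V * V * V) : res_scal (S (x) ext2 V) :=
  let: (u, v, w) := p in
  var_tens u (wedge2 v w) - var_tens v (wedge2 u w) + var_tens w (wedge2 u v).

Fact delta3_rel (t u : mod_term F (V * V * V)) : ext3_rel t u ->
  mod_eval delta3_gen t = mod_eval delta3_gen u.
Proof.
have E (M : lmodType F) (c : F) (a a' b b' d d' : M) :
    (c *: a + a') - (c *: b + b') + (c *: d + d') =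
    c *: (a - b + d) + (a' - b' + d').
  by rewrite scalerDr scalerBr opprD (addrACA (c *: a)) [LHS]addrACA.
case=> /= [c x x' y z|c x y y' z|c x y z z'|x y|x y|x y].
- by rewrite var_tens_linearl !wedge2_linearl !var_tens_linearr E.
- by rewrite var_tens_linearl wedge2_linearl wedge2_linearr !var_tens_linearr E.
- by rewrite var_tens_linearl !wedge2_linearr !var_tens_linearr E.
- by rewrite subrr add0r wedge2vv linear0.
- by rewrite wedge2vv linear0 subr0 (wedge2C y x) linearN addNr.
- by rewrite wedge2vv linear0 sub0r addNr.
Qed.

Definition delta3 : {linear S (x) ext3 V -> S (x) ext2 V} :=
  ext_scal_lift (pm_lift delta3_rel).

Section Module.
Context (K : submodule (ext2 V)).

(* [S (x) (ext3 V + K)] is written as [(S (x) ext3 V) + (S (x) K)]. *)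
Definition koszul_map (x : (S (x) ext3 V) * (S (x) submod_type K)) : S (x) ext2 V :=
  delta3 x.1 + ext_scal_map S (submod_val (N := K)) x.2.

Fact koszul_map_linear : linear koszul_map.
Proof.
by move=> c x y; rewrite /koszul_map !linearP /= scalerDr addrACA.
Qed.
HB.instance Definition _ :=
  GRing.isLinear.Build S _ _ *:%R koszul_map koszul_map_linear.

Definition koszul_mod := coker koszul_map.

(* The image of [Sym^q(V) (x) ext2 V]. *)
Definition koszul_deg (q : nat) (w : koszul_mod) : Prop :=
  exists (n : nat) (s : 'I_n -> S) (om : 'I_n -> ext2 V),
    (forall i, s i \in sym_pow V q) /\
    w = \sum_(i < n) qproj (im_mod koszul_map) (s i *: (one_tens S (om i) : S (x) ext2 V)).

Definition koszul_nilpotent : Prop :=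
  exists q0 : nat, forall q : nat, (q0 <= q)%N ->
    forall w : koszul_mod, koszul_deg q w -> w = 0.

End Module.
End Koszul.

HB.mixin Record Lmodule_isLie (F : fieldType) L of GRing.Lmodule F L := {
  lie : L -> L -> L;
  lie_linearl : forall y, linear (lie^~ y);
  lie_linearr : forall x, linear (lie x);
  lievv : forall x, lie x x = 0;
  lie_jacobi : forall x y z,
    lie x (lie y z) + lie y (lie z x) + lie z (lie x y) = 0
}.

#[short(type="lieAlgType")]
HB.structure Definition LieAlgebra (F : fieldType) :=
  {L of GRing.Lmodule F L & Lmodule_isLie F L}.

Section LieTheory.
Context {F : fieldType} {L : lieAlgType F}.
Implicit Types x y z : L.

Lemma lieC x y : lie x y = - lie y x.
Proof.
have := lievv (1 *: x + y).
rewrite lie_linearl !lie_linearr !lievv !scale1r add0r addr0 addrC.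
by move/eqP; rewrite addr_eq0 => /eqP->; rewrite opprK.
Qed.
Lemma lieBl x y z : lie (x - y) z = lie x z - lie y z.
Proof. by rewrite addrC -scaleN1r lie_linearl scaleN1r addrC. Qed.
Lemma lieBr x y z : lie x (y - z) = lie x y - lie x z.
Proof. by rewrite addrC -scaleN1r lie_linearr scaleN1r addrC. Qed.
Lemma lie0r x : lie x 0 = 0.
Proof. by rewrite -[X in lie _ X](subrr x) lieBr subrr. Qed.

End LieTheory.

Record lie_ideal (F : fieldType) (L : lieAlgType F) := LieIdeal {
  ideal_mod :> submodule L;
  ideal_lie : forall x y, y \in ideal_mod -> lie x y \in ideal_mod }.

Section LieQuotient.
Context {F : fieldType} {L : lieAlgType F} (I : lie_ideal L).

Definition quot_lie := quot_mod I.
HB.instance Definition _ := GRing.Lmodule.on quot_lie.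

Definition lproj (x : L) : quot_lie := qproj I x.
HB.instance Definition _ := GRing.Linear.copy lproj (qproj I).

Definition qlie (p q : quot_lie) : quot_lie := lproj (lie (repr p) (repr q)).

Lemma qlieE x y : qlie (lproj x) (lproj y) = lproj (lie x y).
Proof.
apply/qprojP; set x' := repr _; set y' := repr _.
rewrite -[lie x' y'](subrK (lie x' y)) -addrA -lieBr -lieBl.
apply: submodD; first exact/ideal_lie/qproj_repr.
by rewrite lieC; apply/submodN/ideal_lie/qproj_repr.
Qed.
Lemma lprojK (p : quot_lie) : lproj (repr p) = p. Proof. exact: qreprK. Qed.

Fact qlie_linearl y : linear (qlie^~ y).
Proof.
move=> c x z; rewrite -[x]lprojK -[y]lprojK -[z]lprojK -linearP !qlieE -linearP.
by rewrite lie_linearl.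
Qed.
Fact qlie_linearr x : linear (qlie x).
Proof.
move=> c y z; rewrite -[x]lprojK -[y]lprojK -[z]lprojK -linearP !qlieE -linearP.
by rewrite lie_linearr.
Qed.
Fact qlievv x : qlie x x = 0.
Proof. by rewrite -[x]lprojK qlieE lievv linear0. Qed.
Fact qlie_jacobi x y z :
  qlie x (qlie y z) + qlie y (qlie z x) + qlie z (qlie x y) = 0.
Proof.
have := congr1 lproj (lie_jacobi (repr x) (repr y) (repr z)).
by rewrite !linearD linear0 /= -!qlieE !lprojK.
Qed.
HB.instance Definition _ := Lmodule_isLie.Build F quot_lie
  qlie_linearl qlie_linearr qlievv qlie_jacobi.

End LieQuotient.

Inductive lie_term (F X : Type) : Type :=
| LGen of X
| LZero
| LAdd of lie_term F X & lie_term F X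
| LOpp of lie_term F X
| LScale of F & lie_term F X
| LBr of lie_term F X & lie_term F X.
Arguments LGen {F X}.
Arguments LZero {F X}.

HB.instance Definition _ F X := gen_eqMixin (lie_term F X).
HB.instance Definition _ F X := gen_choiceMixin (lie_term F X).

Inductive lie_eq (F : fieldType) (X : Type)
    (rel : lie_term F X -> lie_term F X -> Prop) :
    lie_term F X -> lie_term F X -> Prop :=
| lie_rel t u : rel t u -> lie_eq rel t u
| lie_refl t : lie_eq rel t t
| lie_sym t u : lie_eq rel t u -> lie_eq rel u t
| lie_trans t u w : lie_eq rel t u -> lie_eq rel u w -> lie_eq rel t w
| lie_congD t t' u u' : lie_eq rel t t' -> lie_eq rel u u' ->
    lie_eq rel (LAdd t u) (LAdd t' u')
| lie_congN t t' : lie_eq rel t t' -> lie_eq rel (LOpp t) (LOpp t')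
| lie_congZ c t t' : lie_eq rel t t' -> lie_eq rel (LScale c t) (LScale c t')
| lie_congB t t' u u' : lie_eq rel t t' -> lie_eq rel u u' ->
    lie_eq rel (LBr t u) (LBr t' u')
| lie_addA t u w : lie_eq rel (LAdd t (LAdd u w)) (LAdd (LAdd t u) w)
| lie_addC t u : lie_eq rel (LAdd t u) (LAdd u t)
| lie_add0 t : lie_eq rel (LAdd LZero t) t
| lie_addN t : lie_eq rel (LAdd (LOpp t) t) LZero
| lie_scaleA a b t : lie_eq rel (LScale a (LScale b t)) (LScale (a * b) t)
| lie_scale1 t : lie_eq rel (LScale 1 t) t
| lie_scaleDr a t u : lie_eq rel (LScale a (LAdd t u)) (LAdd (LScale a t) (LScale a u))
| lie_scaleDl a b t : lie_eq rel (LScale (a + b) t) (LAdd (LScale a t) (LScale b t))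
| lie_brl c t u w : lie_eq rel (LBr (LAdd (LScale c t) u) w)
    (LAdd (LScale c (LBr t w)) (LBr u w))
| lie_brr c t u w : lie_eq rel (LBr t (LAdd (LScale c u) w))
    (LAdd (LScale c (LBr t u)) (LBr t w))
| lie_brvv t : lie_eq rel (LBr t t) LZero
| lie_brJ t u w :
    lie_eq rel (LAdd (LAdd (LBr t (LBr u w)) (LBr u (LBr w t))) (LBr w (LBr t u))) LZero.

Section PresentedLie.
Context {F : fieldType} {X : Type} (rel : lie_term F X -> lie_term F X -> Prop).

Definition lie_eqb t u : bool := `[< lie_eq rel t u >].
Lemma lie_eqb_equiv : equiv_class_of lie_eqb.
Proof.
split=> [t|t u|u t w]; first exact/asboolP/lie_refl.
  by apply/asboolP/asboolP; exact: lie_sym.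
by move=> /asboolP tu /asboolP uw; apply/asboolP/(lie_trans tu uw).
Qed.
Canonical lie_equivRel := EquivRelPack lie_eqb_equiv.
Canonical lie_encModRel := defaultEncModRel lie_eqb.

Definition pres_lie := {eq_quot lie_eqb}.
HB.instance Definition _ := Choice.on pres_lie.
HB.instance Definition _ := EqQuotient.on pres_lie.

Definition pl_class (t : lie_term F X) : pres_lie := \pi t.
Definition pl_gen (x : X) : pres_lie := pl_class (LGen x).

Lemma pl_classP t u : pl_class t = pl_class u <-> lie_eq rel t u.
Proof. by split=> [/eqmodP/asboolP //|h]; apply/eqmodP/asboolP. Qed.
Lemma pl_reprK q : pl_class (repr q) = q. Proof. exact: reprK. Qed.
Lemma pl_class_repr t : lie_eq rel (repr (pl_class t)) t.
Proof. by apply/pl_classP; rewrite pl_reprK. Qed.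

Definition pl_add (p q : pres_lie) : pres_lie := pl_class (LAdd (repr p) (repr q)).
Definition pl_opp (p : pres_lie) : pres_lie := pl_class (LOpp (repr p)).
Definition pl_scale (c : F) (p : pres_lie) : pres_lie := pl_class (LScale c (repr p)).
Definition pl_lie (p q : pres_lie) : pres_lie := pl_class (LBr (repr p) (repr q)).

Lemma pl_addE t u : pl_add (pl_class t) (pl_class u) = pl_class (LAdd t u).
Proof. by apply/pl_classP/lie_congD; exact: pl_class_repr. Qed.
Lemma pl_oppE t : pl_opp (pl_class t) = pl_class (LOpp t).
Proof. by apply/pl_classP/lie_congN; exact: pl_class_repr. Qed.
Lemma pl_scaleE c t : pl_scale c (pl_class t) = pl_class (LScale c t).
Proof. by apply/pl_classP/lie_congZ; exact: pl_class_repr. Qed.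
Lemma pl_lieE t u : pl_lie (pl_class t) (pl_class u) = pl_class (LBr t u).
Proof. by apply/pl_classP/lie_congB; exact: pl_class_repr. Qed.

Fact pl_addA : associative pl_add.
Proof.
move=> x y z; rewrite -[x]pl_reprK -[y]pl_reprK -[z]pl_reprK !pl_addE.
exact/pl_classP/lie_addA.
Qed.
Fact pl_addC : commutative pl_add.
Proof.
move=> x y; rewrite -[x]pl_reprK -[y]pl_reprK !pl_addE.
exact/pl_classP/lie_addC.
Qed.
Fact pl_add0 : left_id (pl_class LZero) pl_add.
Proof. by move=> x; rewrite -[x]pl_reprK pl_addE; exact/pl_classP/lie_add0. Qed.
Fact pl_addN : left_inverse (pl_class LZero) pl_opp pl_add.
Proof.
by move=> x; rewrite -[x]pl_reprK pl_oppE pl_addE; exact/pl_classP/lie_addN.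
Qed.
HB.instance Definition _ :=
  GRing.isZmodule.Build pres_lie pl_addA pl_addC pl_add0 pl_addN.

Lemma pl_classD t u : pl_class (LAdd t u) = pl_class t + pl_class u.
Proof. exact/esym/pl_addE. Qed.

Fact pl_scaleA a b x : pl_scale a (pl_scale b x) = pl_scale (a * b) x.
Proof. by rewrite -[x]pl_reprK !pl_scaleE; exact/pl_classP/lie_scaleA. Qed.
Fact pl_scale1 : left_id 1 pl_scale.
Proof. by move=> x; rewrite -[x]pl_reprK pl_scaleE; exact/pl_classP/lie_scale1. Qed.
Fact pl_scaleDr : right_distributive pl_scale +%R.
Proof.
move=> c x y; rewrite -[x]pl_reprK -[y]pl_reprK -pl_classD !pl_scaleE -pl_classD.
exact/pl_classP/lie_scaleDr.
Qed.
Fact pl_scaleDl x : {morph pl_scale^~ x : a b / a + b}.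
Proof.
move=> a b; rewrite -[x]pl_reprK !pl_scaleE -pl_classD.
exact/pl_classP/lie_scaleDl.
Qed.
HB.instance Definition _ :=
  GRing.Zmodule_isLmodule.Build F pres_lie pl_scaleA pl_scale1 pl_scaleDr pl_scaleDl.

Lemma pl_classN t : pl_class (LOpp t) = - pl_class t.
Proof. exact/esym/pl_oppE. Qed.
Lemma pl_classZ c t : pl_class (LScale c t) = c *: pl_class t.
Proof. exact/esym/pl_scaleE. Qed.

Fact pl_lie_linearl y : linear (pl_lie^~ y).
Proof.
move=> c x z; rewrite -[x]pl_reprK -[y]pl_reprK -[z]pl_reprK.
rewrite -pl_classZ -pl_classD !pl_lieE -pl_classZ -pl_classD.
exact/pl_classP/lie_brl.
Qed.
Fact pl_lie_linearr x : linear (pl_lie x).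
Proof.
move=> c y z; rewrite -[x]pl_reprK -[y]pl_reprK -[z]pl_reprK.
rewrite -pl_classZ -pl_classD !pl_lieE -pl_classZ -pl_classD.
exact/pl_classP/lie_brr.
Qed.
Fact pl_lievv x : pl_lie x x = 0.
Proof. by rewrite -[x]pl_reprK pl_lieE; exact/pl_classP/lie_brvv. Qed.
Fact pl_lie_jacobi x y z :
  pl_lie x (pl_lie y z) + pl_lie y (pl_lie z x) + pl_lie z (pl_lie x y) = 0.
Proof.
rewrite -[x]pl_reprK -[y]pl_reprK -[z]pl_reprK !pl_lieE -!pl_classD.
exact/pl_classP/lie_brJ.
Qed.
HB.instance Definition _ := Lmodule_isLie.Build F pres_lie
  pl_lie_linearl pl_lie_linearr pl_lievv pl_lie_jacobi.

End PresentedLie.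

Definition gen_cartan (n : nat) (A : 'M[int]_n) : Prop :=
  [/\ forall i, A i i = 2,
      forall i j, i != j -> A i j <= 0 &
      forall i j, A i j = 0 -> A j i = 0].

(* [cartan_dim] reads [n + corank A]. *)
Record realization (F : fieldType) (n : nat) (A : 'M[int]_n) := Realization {
  cartan :> vectType F;
  coroot : 'I_n -> cartan;
  root : 'I_n -> 'Hom(cartan, F^o);
  cartan_dim : \dim {: cartan} = (n + (n - \rank (map_mx intr A : 'M[F]_n)))%N;
  coroot_free : free [seq coroot i | i <- enum 'I_n];
  root_free : free [seq root i | i <- enum 'I_n];
  root_coroot : forall i j, root j (coroot i) = (A i j)%:~R }.

Inductive km_gen (n : nat) (h : Type) : Type :=
| KH of h
| KE of 'I_n
| KF of 'I_n.
Arguments KH {n h}.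
Arguments KE {n h}.
Arguments KF {n h}.

Section KacMoody.
Context {F : fieldType} {n : nat} {A : 'M[int]_n} (H : realization F A).

Local Notation gH h := (LGen (KH h)).
Local Notation gE i := (LGen (KE i)).
Local Notation gF i := (LGen (KF i)).

(* [km_linear] makes [h] enter as a vector space, not merely as a set of
   generators. *)
Inductive km_rel : lie_term F (km_gen n H) -> lie_term F (km_gen n H) -> Prop :=
| km_linear c (h h' : H) : km_rel (gH (c *: h + h')) (LAdd (LScale c (gH h)) (gH h'))
| km_hh (h h' : H) : km_rel (LBr (gH h) (gH h')) LZero
| km_ef i j : km_rel (LBr (gE i) (gF j)) (if i == j then gH (coroot H i) else LZero)
| km_he (h : H) i : km_rel (LBr (gH h) (gE i)) (LScale (root H i h) (gE i))
| km_hf (h : H) i : km_rel (LBr (gH h) (gF i)) (LScale (- root H i h) (gF i)).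

Definition km_tilde : lieAlgType F := pres_lie km_rel.

Definition tilde_h (h : H) : km_tilde := pl_gen km_rel (KH h).

Definition meets_h_trivially (I : lie_ideal km_tilde) : Prop :=
  forall h : H, tilde_h h \in I -> tilde_h h = 0.

(* The largest ideal that meets [h] trivially is the sum of all such ideals. *)
Definition km_rad_mod : submodule km_tilde :=
  span (fun x => exists I : lie_ideal km_tilde, meets_h_trivially I /\ x \in I).

Fact km_rad_lie (x y : km_tilde) : y \in km_rad_mod -> lie x y \in km_rad_mod.
Proof.
move=> /asboolP[p [c [v [Pv ->]]]].
have -> : lie x (\sum_(i < p) c i *: v i) = \sum_(i < p) c i *: lie x (v i).
  elim/big_rec2: _ => [|i a b _ <-]; first exact: lie0r.
  by rewrite lie_linearr.
apply/asboolP; exists p, c, (fun i => lie x (v i)); split=> // i.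
by have [I [hI Iv]] := Pv i; exists I; split=> //; apply: ideal_lie.
Qed.

Definition km_rad : lie_ideal km_tilde := LieIdeal km_rad_lie.

Definition kac_moody : lieAlgType F := quot_lie km_rad.

Definition km_h (h : H) : kac_moody := lproj km_rad (tilde_h h).

Definition weight_space (d : 'Hom(H, F^o)) (x : kac_moody) : Prop :=
  forall h : H, lie (km_h h) x = (d h : F) *: x.

(* The sum of the weight spaces of the elements of the root lattice whose
   coefficient on the [k]-th simple root is [i]. *)
Definition km_grade (k : 'I_n) (i : int) : submodule kac_moody :=
  span (fun x => exists c : 'I_n -> int,
    c k = i /\ weight_space (\sum_(j < n) (c j)%:~R *: root H j) x).

Section Koszul.
Context (k : 'I_n).

Let g1 := submod_type (km_grade k 1).

Definition grade1_lie (x y : g1) : kac_moody := lie (submod_val x) (submod_val y).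

Fact grade1_lie_linearl y : linear (grade1_lie^~ y).
Proof. by move=> c x z; rewrite /grade1_lie linearP lie_linearl. Qed.
Fact grade1_lie_linearr x : linear (grade1_lie x).
Proof. by move=> c y z; rewrite /grade1_lie linearP lie_linearr. Qed.
Fact grade1_lievv x : grade1_lie x x = 0.
Proof. exact: lievv. Qed.

(* With values in the whole algebra rather than in its degree 2 part, which
   does not affect the kernel. *)
Definition grade1_bracket : {linear ext2 g1 -> kac_moody} :=
  ext2_lift grade1_lie_linearl grade1_lie_linearr grade1_lievv.

End Koszul.
End KacMoody.

Section Diagram.
Context {n : nat} (A : 'M[int]_n).

(* Multiplicity of the arrow from [i] to [j]; zero means no arrow. *)
Definition arrow_mult (i j : 'I_n) : nat := if i == j then 0%N else `|A j i|%N.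

Definition adjacent (i j : 'I_n) : bool :=
  (0 < arrow_mult i j)%N || (0 < arrow_mult j i)%N.

(* The component of [i] in the diagram from which the node [k] is removed. *)
Definition component_without (k i : 'I_n) : {set 'I_n} :=
  [set j | connect (fun a b => [&& a != k, b != k & adjacent a b]) i j].

Definition subdiagram (S : {set 'I_n}) : 'M[int]_#|S| :=
  mxsub (fun i => enum_val i) (fun j => enum_val j) A.

(* The maximum ranges over the arrows towards [k], so no [m] qualifies if there
   is none. *)
Definition max_mult_towards (k : 'I_n) (m : nat) : Prop :=
  (exists i, (0 < arrow_mult i k)%N /\ arrow_mult i k = m) /\
  (forall i, (arrow_mult i k <= m)%N).

End Diagram.

(* All realizations of [A] are isomorphic, so it suffices to test one. *)
Definition finite_type (F : fieldType) (n : nat) (A : 'M[int]_n) : Prop :=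
  exists H : realization F A, fin_dim (kac_moody H).

Definition admissible (F : fieldType) (n : nat) (A : 'M[int]_n) (k : 'I_n) : Prop :=
  forall i, i != k -> finite_type F (subdiagram A (component_without A k i)).

(* Main.v *)
(* Let x = e_k. Words ad(e_i1) .. ad(e_ir) x with all i_j <> k span g_1, and by the Serre
   relations x /\ [e_i, x] lies in K for every i <> k iff no arrow towards k is multiple.

   In that case the derivations D_i = ad(e_i), i <> k, act on the Koszul module W.
   Applying D_i to x^h (x /\ u) = 0 gives x^(h+1) (x /\ D_i u) = 0, so by induction a power
   of x annihilates W. The radical of Ann(W) is stable under the D_i in characteristic 0,
   so it contains g_1, and W is nilpotent because g_1 is finite-dimensional. For this last
   fact the e_i with i <> k generate a finite-dimensional nilpotent Lie algebra by
   admissibility; its elements that act nilpotently on x contain the e_i and are stable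
   under exp(t ad(e_i)), hence they span it (Kac-Peterson), and then x generates a
   finite-dimensional module.

   If a_ki <= -2, let phi and psi be the coordinates of x and [e_i, x] on g_1. Then
   phi /\ psi factors through the bracket because [x, [e_i, x]] <> 0, so it kills K, and
   s (x) u /\ v |-> s(phi) (phi /\ psi)(u, v) shows that x^q (x /\ [e_i, x]) is nonzero
   in W for all q. *)
Require Import Defs.
From HB Require Import structures.
From mathcomp Require Import all_boot all_order all_algebra generic_quotient.
From mathcomp Require Import boolp reals complex ring.

Set Implicit Arguments.
Unset Strict Implicit.
Unset Printing Implicit Defensive.

Import Defs GRing.Theory Num.Theory.
Local Open Scope ring_scope.

(** * Spans, eigenvectors and Lie algebra identities *)

(** In [kac_moody] the Serre relations are not part of the presentation, and the algebra of a
    subdiagram does not come with a map into the algebra of the diagram, because both are quotients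
    by maximal ideals. One principle settles both difficulties: a vector of positive height that all
    [f j] kill is zero ([words_f_zero]). It yields the Serre relations and, by comparing the same
    word in two algebras letter by letter ([word_pairs]), carries the vanishing of words from the
    finite-dimensional algebra of a component into the large one. Nonvanishing needs the opposite
    tool: a linear functional with value one on a prescribed element of the Cartan subalgebra that
    kills all nonzero weight spaces. It comes from Verma modules of [km_tilde] and descends to the
    quotient. It shows that the Cartan subalgebra embeds, and it provides the coordinates [phi] and
    [psi]. Weight decompositions are replaced by eigenvalue arguments for a single operator [ad h],
    often with [h = rho], on which all simple roots take the value one. *)

Section SpanTheory.
Context {R : pzRingType} {M : lmodType R}.
Implicit Types (P Q : M -> Prop) (N : submodule M).

Lemma submod_big N (I : Type) (r : seq I) (p : pred I) (x : I -> M) :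
  (forall i, p i -> x i \in N) -> \sum_(i <- r | p i) x i \in N.
Proof.
move=> Nx; elim/big_ind: _ => //; [exact: submod0|exact: submodD].
Qed.

Lemma mem_span P x : P x -> x \in span P.
Proof.
move=> Px; apply/asboolP; exists 1, (fun=> 1), (fun=> x).
by split=> //; rewrite big_ord1 scale1r.
Qed.

Lemma span_ind P Q :
  Q 0 -> (forall c x y, P x -> Q y -> Q (c *: x + y)) ->
  forall x, x \in span P -> Q x.
Proof.
move=> Q0 QD x /asboolP[m [c [v [Pv ->]]]].
by elim/big_rec: _ => // i y _ Qy; apply: QD.
Qed.

Lemma span_sub P N : (forall x, P x -> x \in N) -> forall x, x \in span P -> x \in N.
Proof.
move=> PN; apply: span_ind => [|c x y Px Ny]; first exact: submod0.
exact: submodDZ (PN _ Px) Ny.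
Qed.

Lemma span_family P (T : finType) (b : T -> M) : (forall t, b t \in span P) ->
  exists (J : finType) (y : J -> M), (forall j, P (y j)) /\
    forall t, b t \in span (fun z => exists j, z = y j).
Proof.
move=> Pb.
have /choice[q qP] t : exists q : {m & ('I_m -> R) * ('I_m -> M)}%type,
    (forall i, P ((tagged q).2 i)) /\ b t = \sum_i (tagged q).1 i *: (tagged q).2 i.
  by have /asboolP[m [c [v [Pv ->]]]] := Pb t; exists (existT (fun m => ('I_m -> R) * ('I_m -> M))%type m (c, v)).
exists {t : T & 'I_(tag (q t))}, (fun j => (tagged (q (tag j))).2 (tagged j)).
split=> [j|t]; first by case: (qP (tag j)).
have [_ ->] := qP t; apply: submod_big => i _; apply: submodZ.
by apply: mem_span; exists (Tagged (fun t => 'I_(tag (q t))) i).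
Qed.

Lemma span_mono P Q : (forall x, P x -> Q x) -> forall x, x \in span P -> x \in span Q.
Proof. by move=> PQ; apply: span_sub => x /PQ; exact: mem_span. Qed.

Lemma span_finP (J : finType) (b : J -> M) x :
  x \in span (fun y => exists j, y = b j) -> exists a : J -> R, x = \sum_j a j *: b j.
Proof.
apply: (span_ind (Q := fun x => exists a : J -> R, x = \sum_j a j *: b j)).
  by exists (fun=> 0); rewrite big1 // => j _; rewrite scale0r.
move=> c _ y [j0 ->] [a ->]; exists (fun j => c *+ (j == j0) + a j).
rewrite [RHS](eq_bigr (fun j => (c *+ (j == j0)) *: b j + a j *: b j)); last first.
  by move=> j _ /=; rewrite scalerDl.
rewrite big_split /=; congr (_ + _); rewrite (bigD1 j0) //= eqxx mulr1n big1 ?addr0 // => j.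
by move/negbTE->; rewrite mulr0n scale0r.
Qed.

(** Over a finite alphabet there are only finitely many words of bounded length. *)
Lemma span_wordsP (I : finType) (f : seq I -> M) (m : nat) : exists (J : finType) (b : J -> M),
  (forall j, exists w, b j = f w) /\
  forall x, x \in span (fun y => exists2 w, (size w < m)%N & y = f w) ->
    exists a : J -> R, x = \sum_j a j *: b j.
Proof.
pose J : finType := {i : 'I_m & i.-tuple I}.
exists J, (fun j : J => f (tagged j)); split=> [j|x]; first by exists (tagged j).
move=> fx; apply: span_finP; move: x fx; apply: span_mono => _ [w wm ->].
by exists (Tagged (fun i : 'I_m => i.-tuple I) (in_tuple w : (Ordinal wm).-tuple I)).
Qed.

End SpanTheory.

#[global] Opaque span.

Lemma span_map {R : pzRingType} {M M' : lmodType R} (f : {linear M -> M'})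
    (P : M -> Prop) (N : submodule M') :
  (forall x, P x -> f x \in N) -> forall x, x \in span P -> f x \in N.
Proof.
move=> PN; apply: span_ind => [|c x y Px Ny]; first by rewrite linear0 submod0.
by rewrite linearP; apply: submodDZ; first exact: PN.
Qed.

Section Eigen.
Context {F : fieldType} {M : lmodType F} (T : {linear M -> M}).

(** The product of the [T - a] over the eigenvalues [a != d] preserves [N], kills the components of
    eigenvalue other than [d] and multiplies the remaining one by a nonzero scalar. [N] is a bare
    predicate so that it can also be equality with zero. *)
Lemma eigen_component (N : M -> Prop) (I : finType) (c : I -> F) (x : I -> M) (d : F) :
  (forall a y z, N y -> N z -> N (a *: y + z)) -> N 0 -> (forall y, N y -> N (T y)) ->
  (forall i, T (x i) = c i *: x i) -> N (\sum_i x i) ->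
  N (\sum_(i | c i == d) x i).
Proof.
move=> ND N0 NT Tx Nx.
have prodN (s : seq F) : N (\sum_i (\prod_(a <- s) (c i - a)) *: x i).
  elim: s => [|a s IHs]; first by under eq_bigr do rewrite big_nil scale1r.
  have := ND (- a) _ _ IHs (NT _ IHs); congr N.
  rewrite [X in _ + X = _]linear_sum scaler_sumr -big_split; apply: eq_bigr => i _ /=.
  by rewrite [T _]linearZ /= Tx big_cons !scalerA -scalerDl; congr (_ *: _);
    rewrite addrC mulrC mulNr -mulrBl.
pose s := [seq a <- codom c | a != d].
have := prodN s; rewrite (bigID (fun i => c i == d)) /= [X in _ + X]big1 => [|i cid].
  rewrite addr0 (eq_bigr (fun i => (\prod_(a <- s) (d - a)) *: x i)); last first.
    by move=> i /eqP->.
  rewrite -scaler_sumr => /(fun h => ND (\prod_(a <- s) (d - a))^-1 _ _ h N0).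
  rewrite addr0 scalerA mulVf ?scale1r // prodf_seq_neq0.
  by apply/allP=> a; rewrite mem_filter subr_eq0 eq_sym => /andP[].
have cs : c i \in s by rewrite mem_filter cid; exact: codom_f.
by rewrite (big_rem _ cs) /= subrr mul0r scale0r.
Qed.

Lemma eigen_split (P : F -> M -> Prop) (N : submodule M) (d : F) :
  (forall c x, P c x -> T x = c *: x) -> (forall c a x, P c x -> P c (a *: x)) ->
  (forall y, y \in N -> T y \in N) ->
  forall x, x \in span (fun y => exists c, P c y) -> x \in N ->
  exists y, [/\ y \in N, y \in span (P d) &
    x - y \in span (fun y => exists2 c, c != d & P c y)].
Proof.
move=> PT PZ NT x /asboolP[m [a [v [Pv ->]]]] Nx.
have [c cP] := choice Pv.
exists (\sum_(i | c i == d) a i *: v i); split.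
- apply: (eigen_component (N := fun y => y \in N)) Nx => //.
  + by move=> b y z; exact: submodDZ.
  + exact: submod0.
  + by move=> i; rewrite [T _]linearZ /= (PT _ _ (cP i)) !scalerA mulrC.
- apply: (submod_big (N := span _)) => i /eqP <-.
  exact/mem_span/PZ.
- rewrite [X in X - _](bigID (fun i => c i == d)) /= addrAC subrr add0r.
  apply: (submod_big (N := span _)) => i ci.
  by apply: mem_span; exists (c i) => //; exact: PZ.
Qed.

Lemma eigen_span (P : F -> M -> Prop) (d : F) :
  (forall c x, P c x -> T x = c *: x) -> (forall c a x, P c x -> P c (a *: x)) ->
  forall x, x \in span (fun y => exists c, P c y) -> T x = d *: x -> x \in span (P d).
Proof.
move=> PT PZ x /asboolP[m [a [v [Pv xE]]]] Tx.
have [c cP] := choice Pv.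
(* [- x] joins the summands as one more eigenvector of eigenvalue [d]. The total is then zero, and
   so is its component for [d]. *)
pose x' (o : option 'I_m) := if o is Some i then a i *: v i else - x.
pose c' (o : option 'I_m) := if o is Some i then c i else d.
have : \sum_(o | c' o == d) x' o = 0.
  apply: (eigen_component (N := fun y => y = 0)) => [b y z -> ->||y ->|[i|]|] //.
  + by rewrite scaler0 addr0.
  + exact: linear0.
  + by rewrite /= [T _]linearZ /= (PT _ _ (cP i)) !scalerA mulrC.
  + by rewrite /= linearN /= Tx scalerN.
  + rewrite (bigD1 None) //= xE (reindex_omap Some id) /=; last by case.
    by rewrite [X in _ + X](eq_bigl xpredT) ?addNr // => j; rewrite /= eqxx.
have dd : c' None == d by exact: eqxx.
rewrite (bigD1 _ dd) /= addrC => /eqP; rewrite subr_eq0 => /eqP <-.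
apply: (submod_big (N := span _)) => -[i|] /andP[/eqP <- //] _.
by apply: mem_span; apply: PZ; exact: cP.
Qed.

(** [#|J|.+1] vectors in the span of [#|J|] vectors satisfy a nontrivial linear relation. As [c] is
    injective, each eigenvalue component of this relation is a single term. *)
Lemma eigen_bound (J : finType) (b : J -> M) (x : nat -> M) (c : nat -> F) :
  (forall i, exists a : J -> F, x i = \sum_j a j *: b j) -> injective c ->
  (forall i, T (x i) = c i *: x i) -> exists2 i, (i <= #|J|)%N & x i = 0.
Proof.
move=> bP cI Tx; have [a aP] := choice bP.
pose A := \matrix_(i < #|J|.+1, j < #|J|) a i (enum_val j).
have /rowV0Pn[u /sub_kermxP uA u0] : kermx A != 0.
  rewrite kermx_eq0 -row_leq_rank -ltnNge.
  exact: leq_ltn_trans (rank_leq_col _) _.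
have /rV0Pn[i ui] := u0.
exists i; first by rewrite -ltnS.
have sum0 : \sum_(l < #|J|.+1) u 0 l *: x l = 0.
  rewrite (eq_bigr (fun l : 'I_#|J|.+1 => \sum_j (u 0 l * A l j) *: b (enum_val j))); last first.
    move=> l _; rewrite {1}(aP l) scaler_sumr (big_enum_val (A := J)) /=.
    by apply: eq_bigr => j _; rewrite mxE scalerA.
  rewrite exchange_big /= big1 // => j _; rewrite -scaler_suml.
  by move/matrixP: uA => /(_ 0 j); rewrite !mxE => ->; rewrite scale0r.
have : \sum_(l < #|J|.+1 | c l == c i) u 0 l *: x l = 0.
  apply: (eigen_component (N := fun y => y = 0)) sum0 => // [d y z -> ->|y ->|l].
  - by rewrite scaler0 addr0.
  - exact: linear0.
  - by rewrite [T _]linearZ /= Tx !scalerA mulrC.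
rewrite (big_pred1 i) => [/eqP|l]; last by rewrite /= (inj_eq cI).
by rewrite scaler_eq0 (negbTE ui) /= => /eqP.
Qed.

End Eigen.

Section LieMore.
Context {F : fieldType} {L : lieAlgType F}.
Implicit Types x y z : L.

HB.instance Definition _ x := GRing.isLinear.Build F L L *:%R (lie x) (lie_linearr x).

Lemma lie_derivation x y z : lie x (lie y z) = lie (lie x y) z + lie y (lie x z).
Proof.
have /eqP := lie_jacobi x y z.
rewrite -addrA addr_eq0 opprD => /eqP->.
by rewrite -(lieC (lie x y)) addrC [lie z x]lieC linearN opprK.
Qed.

Lemma lie_lie x y z : lie (lie x y) z = lie x (lie y z) - lie y (lie x z).
Proof. by rewrite lie_derivation addrK. Qed.

Lemma lieDl x y z : lie (x + y) z = lie x z + lie y z.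
Proof. by rewrite -[x]scale1r lie_linearl !scale1r. Qed.
Lemma lieZl c x z : lie (c *: x) z = c *: lie x z.
Proof. by rewrite lieC [lie z _]linearZ /= -scalerN -lieC. Qed.
Lemma lieNl x z : lie (- x) z = - lie x z.
Proof. by rewrite -scaleN1r lieZl scaleN1r. Qed.
Lemma lie0l z : lie 0 z = 0 :> L.
Proof. by rewrite lieC lie0r oppr0. Qed.
Lemma lie_suml (I : Type) (r : seq I) (P : pred I) (x : I -> L) z :
  lie (\sum_(i <- r | P i) x i) z = \sum_(i <- r | P i) lie (x i) z.
Proof.
by elim/big_rec2: _ => [|i u v _ <-]; rewrite ?lie0l ?lieDl.
Qed.

Lemma lie_leibniz m x y z :
  iter m (lie x) (lie y z) =
  \sum_(i < m.+1) lie (iter i (lie x) y) (iter (m - i) (lie x) z) *+ 'C(m, i).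
Proof.
elim: m => [|m IHm]; first by rewrite big_ord1 /= bin0.
rewrite iterS IHm linear_sum [RHS]big_ord_recl [X in _ = _ + X]big_ord_recr /=.
rewrite ?subn0 ?bin0 ?mulr1n.
under eq_bigr => i _ do rewrite linearMn /= lie_derivation mulrnDl.
rewrite big_split /= big_ord_recr [X in _ + X = _]big_ord_recl /=.
rewrite ?subnn ?subn0 ?bin0 ?binn ?mulr1n /=.
rewrite addrACA [X in X + _ = _]addrC -addrA; congr (_ + _).
rewrite addrCA addrC; congr (_ + _).
rewrite -big_split /=; apply: eq_bigr => i _.
rewrite /bump leq0n !add1n add0n subSS -[lie x (iter (m - _) _ _)]iterS subnSK //.
by rewrite binS mulrnDr addrC.
Qed.

End LieMore.

(** * Koszul modules *)

Section PresentedModuleInd.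
Context {R : pzRingType} {X : Type} {rel : mod_term R X -> mod_term R X -> Prop}.

Lemma pres_mod_ind (Q : pres_mod rel -> Prop) :
  Q 0 -> (forall c x y, Q x -> Q y -> Q (c *: x + y)) ->
  (forall x, Q (pm_gen rel x)) -> forall q, Q q.
Proof.
move=> Q0 QD Qgen q; rewrite -[q]pm_reprK; elim: (repr q) => //.
- by move=> t Qt u Qu; rewrite pm_classD -[pm_class _ t]scale1r; exact: QD.
- by move=> t Qt; rewrite pm_classN -scaleN1r -[_ *: _]addr0; exact: QD.
- by move=> c t Qt; rewrite pm_classZ -[_ *: _]addr0; exact: QD.
Qed.

Section ActLift.
Context {M : zmodType} (act : R -> M -> M) (f : X -> M).

(** The action is a bare function, so that the target needs no registered [R]-module structure. The
    targets below are [F], on which [sym V] acts through the value at a functional, and pairs of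
    tensors, on which it acts through dual numbers. *)
Fixpoint act_eval (t : mod_term R X) : M :=
  match t with
  | MGen x => f x
  | MZero => 0
  | MAdd t u => act_eval t + act_eval u
  | MOpp t => - act_eval t
  | MScale c t => act c (act_eval t)
  end.

Lemma act_eval_eq :
  (forall a b x, act a (act b x) = act (a * b) x) -> (forall x, act 1 x = x) ->
  (forall a x y, act a (x + y) = act a x + act a y) ->
  (forall a b x, act (a + b) x = act a x + act b x) ->
  (forall t u, rel t u -> act_eval t = act_eval u) ->
  forall t u, mod_eq rel t u -> act_eval t = act_eval u.
Proof.
move=> actA act1 actDr actDl frel t u.
elim=> /=; intros; rewrite ?addrA ?add0r ?addNr ?actA ?act1 ?actDr ?actDl //;
  try congruence; by [exact: frel | rewrite addrC].
Qed.

End ActLift.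
End PresentedModuleInd.

Section SymTheory.
Context {F : fieldType} {V : lmodType F}.
Local Notation S := (sym V).
Local Notation cl := (@sym_class F V).

Lemma sym_classD t u : cl (SAdd t u) = cl t + cl u.
Proof. exact/esym/sym_addE. Qed.
Lemma sym_classM t u : cl (SMul t u) = cl t * cl u.
Proof. exact/esym/sym_mulE. Qed.
Lemma sym_class0 : cl (SConst 0) = 0. Proof. by []. Qed.
Lemma sym_class1 : cl (SConst 1) = 1. Proof. by []. Qed.
Lemma sym_classC c : cl (SConst c) = c%:A.
Proof.
transitivity (cl (SConst c) * 1); first by rewrite mulr1.
by rewrite -sym_class1.
Qed.

Section Eval.
Context (phi : V -> F) (phi_linear : forall c u v, phi (c *: u + v) = c * phi u + phi v).

(** Elements of [sym V] are regarded as polynomial functions on the dual of [V]; this is the value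
    at the point [phi]. *)
Fixpoint sym_eval_term (t : sym_term F V) : F :=
  match t with
  | SVar v => phi v
  | SConst c => c
  | SAdd t u => sym_eval_term t + sym_eval_term u
  | SOpp t => - sym_eval_term t
  | SMul t u => sym_eval_term t * sym_eval_term u
  end.

Lemma sym_eval_term_eq t u : sym_eq t u -> sym_eval_term t = sym_eval_term u.
Proof.
elim=> /=; intros;
  rewrite ?addrA ?add0r ?addNr ?mulrA ?mul1r ?mulrDl ?phi_linear //;
  try congruence; by [rewrite addrC | rewrite mulrC].
Qed.

Definition sym_eval (s : S) : F := sym_eval_term (repr s).

Lemma sym_eval_class t : sym_eval (cl t) = sym_eval_term t.
Proof. exact/sym_eval_term_eq/sym_class_repr. Qed.
Lemma sym_evalD s t : sym_eval (s + t) = sym_eval s + sym_eval t.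
Proof. by rewrite -[s]sym_reprK -[t]sym_reprK -sym_classD !sym_eval_class. Qed.
Lemma sym_evalM s t : sym_eval (s * t) = sym_eval s * sym_eval t.
Proof. by rewrite -[s]sym_reprK -[t]sym_reprK -sym_classM !sym_eval_class. Qed.
Lemma sym_eval_scalar c : sym_eval c%:A = c.
Proof. by rewrite -sym_classC sym_eval_class. Qed.
Lemma sym_eval_var v : sym_eval (sym_var v) = phi v.
Proof. exact: sym_eval_class. Qed.

End Eval.

Section Derivation.
Context (D : {linear V -> V}).

Fixpoint sym_der_term (t : sym_term F V) : S :=
  match t with
  | SVar v => sym_var (D v)
  | SConst c => 0
  | SAdd t u => sym_der_term t + sym_der_term u
  | SOpp t => - sym_der_term t
  | SMul t u => sym_der_term t * cl u + cl t * sym_der_term u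
  end.

Lemma sym_der_term_eq t u : sym_eq t u -> sym_der_term t = sym_der_term u.
Proof.
elim=> /=; intros.
all: rewrite ?sym_classM ?sym_classD ?sym_class1 ?sym_class0 ?mul0r ?mulr0 ?mul1r ?add0r
  ?addr0 ?addNr ?addrA //; try congruence.
- congr (_ * _ + _ * _) => //; exact/sym_classP.
- exact: addrC.
- by rewrite mulrDl mulrDr !mulrA addrA.
- by rewrite addrC mulrC [X in _ + X]mulrC.
- by rewrite mulrDl mulrDl -!addrA; congr (_ + _); rewrite addrCA.
- by rewrite sym_classC -scalerAl mul1r !linearP.
Qed.

Definition sym_der (s : S) : S := sym_der_term (repr s).

Lemma sym_der_class t : sym_der (cl t) = sym_der_term t.
Proof. exact/sym_der_term_eq/sym_class_repr. Qed.
Lemma sym_derD s t : sym_der (s + t) = sym_der s + sym_der t.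
Proof. by rewrite -[s]sym_reprK -[t]sym_reprK -sym_classD !sym_der_class. Qed.
Lemma sym_derM s t : sym_der (s * t) = sym_der s * t + s * sym_der t.
Proof. by rewrite -[s]sym_reprK -[t]sym_reprK -sym_classM !sym_der_class. Qed.
Lemma sym_der_scalar c : sym_der c%:A = 0.
Proof. by rewrite -sym_classC sym_der_class. Qed.
Lemma sym_der1 : sym_der 1 = 0.
Proof. by rewrite -sym_class1 sym_der_class. Qed.
Lemma sym_der_var v : sym_der (sym_var v) = sym_var (D v).
Proof. exact: sym_der_class. Qed.
Lemma sym_derX s m : sym_der (s ^+ m) = m%:R * s ^+ m.-1 * sym_der s.
Proof.
elim: m => [|m IHm]; first by rewrite expr0 sym_der1 !mul0r.
rewrite exprS sym_derM IHm /=; case: m {IHm} => [|m]; first by rewrite !mul0r mulr0 addr0 mulr1 mul1r expr0 mul1r.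
rewrite [m.+2%:R]mulrS !mulrDl mul1r mulrC; congr (_ + _).
by rewrite /= !mulrA [s * _]mulrC -!mulrA [s * (_ * _)]mulrA -exprS.
Qed.

End Derivation.
End SymTheory.

Lemma coker_eq0 {R : pzRingType} {M N : lmodType R} (f : {linear M -> N}) x :
  qproj (im_mod f) x = 0 <-> exists y, f y = x.
Proof.
rewrite -(linear0 (qproj (im_mod f))).
split=> [/qprojP|fx]; last apply/qprojP; rewrite subr0; last exact/asboolP.
by move/asboolP.
Qed.

Section KoszulTheory.
Context {F : fieldType} {V : lmodType F} (K : submodule (ext2 V)).
Local Notation S := (sym V).

Definition tens2 : lmodType S := ext_scal S (ext2 V).
Definition tens2_one (om : ext2 V) : tens2 := one_tens S om.
Local Notation wd u v := (tens2_one (wedge2 u v)).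

Definition koszul_im (x : tens2) : Prop := exists y, koszul_map (K := K) y = x.

Lemma koszul_im0 : koszul_im 0.
Proof. by exists 0; exact: linear0. Qed.

Lemma koszul_imDZ s x y : koszul_im x -> koszul_im y -> koszul_im (s *: x + y).
Proof. by move=> [a <-] [b <-]; exists (s *: a + b); exact: linearP. Qed.

Lemma koszul_map_pair a b : koszul_map (K := K) (a, b) =
  delta3 V a + ext_scal_map S (submod_val (N := K)) b.
Proof. by []. Qed.

Lemma koszul_rel3 u v w : koszul_im
  (sym_var u *: wd v w - sym_var v *: wd u w + sym_var w *: wd u v).
Proof.
exists (one_tens S (wedge3 u v w), 0).
rewrite koszul_map_pair linear0 addr0.
by rewrite [delta3 _ _]pm_lift_class /= [pm_lift _ _]pm_lift_class.
Qed.

Lemma koszul_relK k : k \in K -> koszul_im (tens2_one k).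
Proof.
move=> Kk; exists (0, one_tens S (SubmodType Kk)).
by rewrite koszul_map_pair linear0 add0r [ext_scal_map _ _ _]pm_lift_class.
Qed.

(** The inductive step also provides membership in the image: a derivation [D] sends [s *: x] to
    [s *: D x + D s *: x], and the second term is in the image only because [x] is. *)
Lemma koszul_im_ind (Q : tens2 -> Prop) :
  Q 0 -> (forall s x y, koszul_im x -> koszul_im y -> Q x -> Q y -> Q (s *: x + y)) ->
  (forall u v w, Q (sym_var u *: wd v w - sym_var v *: wd u w + sym_var w *: wd u v)) ->
  (forall k, k \in K -> Q (tens2_one k)) ->
  forall x, koszul_im x -> Q x.
Proof.
move=> Q0 QD Q3 QK x [[a b] <-] {x}; rewrite koszul_map_pair.
suff [Qa Na] : Q (delta3 V a) /\ koszul_im (delta3 V a).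
  suff [Qb Nb] : Q (ext_scal_map S (submod_val (N := K)) b) /\
      koszul_im (ext_scal_map S (submod_val (N := K)) b).
    by rewrite -[delta3 V a]scale1r; exact: QD.
  elim/(@pres_mod_ind _ _ (@ext_scal_rel F S (submod_type K))): b => [|s x y [Qx Nx] [Qy Ny]|k].
  - by rewrite linear0; split=> //; exact: koszul_im0.
  - by rewrite linearP; split; [exact: QD|exact: koszul_imDZ].
  - rewrite [ext_scal_map _ _ _]pm_lift_class /=; split; first exact/QK/valP.
    exact/koszul_relK/valP.
elim/(@pres_mod_ind _ _ (@ext_scal_rel F S (ext3 V))): a => [|s x y [Qx Nx] [Qy Ny]|].
- by rewrite linear0; split=> //; exact: koszul_im0.
- by rewrite linearP; split; [exact: QD|exact: koszul_imDZ].
move=> om; rewrite [delta3 _ _]pm_lift_class /=.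
elim/(@pres_mod_ind _ _ (@ext3_rel F V)): om => [|c x y [Qx Nx] [Qy Ny]|[[u v] w]].
- by rewrite linear0; split=> //; exact: koszul_im0.
- by rewrite linearP; split; [exact: (QD c%:A)|exact: (koszul_imDZ c%:A)].
- rewrite [pm_lift _ _]pm_lift_class /=; split; first exact: Q3.
  exact: koszul_rel3.
Qed.

Lemma koszul_nilpotentP : koszul_nilpotent K <->
  exists q0, forall q, (q0 <= q)%N -> forall (v : 'I_q -> V) om,
    koszul_im ((\prod_(i < q) sym_var (v i)) *: tens2_one om).
Proof.
have zeroP := @coker_eq0 _ _ tens2 (@koszul_map F V K).
split=> -[q0 nilK]; exists q0 => q q0q.
  move=> v om; apply/zeroP/nilK; first exact: q0q.
  exists 1%N, (fun=> \prod_(i < q) sym_var (v i)), (fun=> om); split; last by rewrite big_ord1.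
  by move=> _; apply: mem_span; exists v.
move=> w [m [s [om [sq ->]]]]; rewrite big1 // => i _; apply/zeroP.
move: (s i) (sq i); apply: span_ind => [|c _ y [v ->] Ny].
  by rewrite scale0r; exact: koszul_im0.
rewrite scalerDl -mulr_algl -scalerA; apply: koszul_imDZ => //.
exact: nilK q0q _ _.
Qed.

(** The map [G] below sends tensors to [F], with [sym V] acting by evaluation at [phi]. It kills the
    Koszul relations because [phi /\ phi /\ psi = 0], and [K] because [area] does, but it sends x^q
    (x /\ u) to phi(x)^(q+1) psi(u). *)
Lemma koszul_not_nilpotent (phi psi : {linear V -> F^o})
    (area : {linear ext2 V -> F^o}) (x u : V) :
  (forall v w, area (wedge2 v w) = phi v * psi w - phi w * psi v) ->
  (forall k, k \in K -> area k = 0) ->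
  phi x != 0 -> psi x = 0 -> psi u != 0 -> ~ koszul_nilpotent K.
Proof.
move=> areaE areaK.
have phiP c v w : phi (c *: v + w) = c * phi v + phi w by exact: linearP.
pose act (s : S) (a : F) := sym_eval phi s * a.
pose ev := act_eval act (fun om => area om : F).
have ev_eq t t' : mod_eq (@ext_scal_rel F S (ext2 V)) t t' -> ev t = ev t'.
  apply: act_eval_eq => [a b y|y|a y z|a b y|{}t {}t'].
  - by rewrite /act mulrA -sym_evalM.
  - by rewrite /act -[1]scale1r sym_eval_scalar // mul1r.
  - by rewrite /act mulrDr.
  - by rewrite /act -mulrDl -sym_evalD.
  by case=> c y z /=; rewrite linearP /act sym_eval_scalar.
pose G (y : tens2) : F := ev (repr y).
have G_class t : G (pm_class _ t) = ev t by exact/ev_eq/pm_class_repr.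
have GD y z : G (y + z) = G y + G z.
  by rewrite -[y]pm_reprK -[z]pm_reprK -pm_classD !G_class.
have GN y : G (- y) = - G y.
  by rewrite -[y]pm_reprK -pm_classN !G_class.
have GZ s y : G (s *: y) = sym_eval phi s * G y.
  by rewrite -[y]pm_reprK -pm_classZ !G_class.
have G0 : G 0 = 0 by exact: (G_class MZero).
have Gone om : G (tens2_one om) = area om by exact: (G_class (MGen om)).
have Gim y : koszul_im y -> G y = 0.
  apply: (koszul_im_ind (Q := fun y => G y = 0)) => //.
  - by move=> s {}y z _ _ Gy Gz; rewrite GD GZ Gy Gz mulr0 addr0.
  - move=> a b c; rewrite !(GD, GN, GZ) !Gone !areaE !sym_eval_var //; ring.
  - by move=> k Kk; rewrite Gone; exact: areaK.
move=> phix psix psiu /koszul_nilpotentP[q /(_ q (leqnn q) (fun=> x) (wedge2 x u))].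
move/Gim; rewrite GZ Gone areaE psix mulr0 subr0.
rewrite prodr_const card_ord => /eqP; rewrite !mulf_eq0 (negbTE phix) (negbTE psiu) !orbF.
suff -> : sym_eval phi (sym_var x ^+ q) = phi x ^+ q by rewrite expf_eq0 (negbTE phix) andbF.
elim: q => [|q IHq]; first by rewrite !expr0 -[1]scale1r sym_eval_scalar.
by rewrite !exprS sym_evalM // IHq sym_eval_var.
Qed.

End KoszulTheory.

(** * Derivations of Koszul modules *)

Section KoszulDerivation.
Context {F : fieldType} {V : lmodType F} (D : {linear V -> V}).
Local Notation S := (sym V).
Local Notation P := (@tens2 F V).
Local Notation wd u v := (tens2_one (wedge2 u v)).

Definition wedge2_der (u v : V) : ext2 V := wedge2 (D u) v + wedge2 u (D v).

Fact wedge2_der_linearl v : linear (wedge2_der^~ v).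
Proof.
by move=> c x y; rewrite /wedge2_der linearP !wedge2_linearl scalerDr addrACA.
Qed.
Fact wedge2_der_linearr u : linear (wedge2_der u).
Proof.
by move=> c x y; rewrite /wedge2_der linearP !wedge2_linearr scalerDr addrACA.
Qed.
Fact wedge2_dervv u : wedge2_der u u = 0.
Proof. by rewrite /wedge2_der wedge2C addNr. Qed.

Definition ext2_der : {linear ext2 V -> ext2 V} :=
  ext2_lift wedge2_der_linearl wedge2_der_linearr wedge2_dervv.

Lemma ext2_der_wedge2 u v : ext2_der (wedge2 u v) = wedge2 (D u) v + wedge2 u (D v).
Proof. exact: pm_lift_class. Qed.

Lemma tens2_one_linear c (u v : ext2 V) :
  tens2_one (c *: u + v) = c%:A *: tens2_one u + tens2_one v.
Proof. exact: (@one_tens_linear F S). Qed.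

(* [S (x) ext2 V] with [S] acting through [s |-> s + eps D s] on the dual numbers. *)
Let act (s : S) (p : P * P) : P * P := (s *: p.1, s *: p.2 + sym_der D s *: p.1).
Let ev := act_eval act (fun om => (tens2_one om, tens2_one (ext2_der om))).

Lemma der_ev1 t : (ev t).1 = pm_class _ t.
Proof.
elim: t => [om||t IHt u IHu|t IHt|s t IHt] //=.
- by rewrite IHt IHu pm_classD.
- by rewrite IHt pm_classN.
- by rewrite IHt pm_classZ.
Qed.

Lemma der_ev_eq t u : mod_eq (@ext_scal_rel F S (ext2 V)) t u -> ev t = ev u.
Proof.
apply: act_eval_eq => [a b [y z]|[y z]|a [y z] [y' z']|a b [y z]|{}t {}u];
  rewrite /act /=.
- congr (_, _); first by rewrite scalerA.
  rewrite scalerDr !scalerA -addrA -scalerDl sym_derM addrC.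
  by rewrite [_ * b + _]addrC addrC.
- by rewrite sym_der1 scale0r addr0 !scale1r.
- congr (_, _); first by rewrite scalerDr.
  by rewrite !scalerDr addrACA.
- congr (_, _); first by rewrite scalerDl.
  by rewrite sym_derD !scalerDl addrACA.
- case=> c x y /=; congr (_, _); first exact: tens2_one_linear.
  by rewrite /act /= linearP sym_der_scalar scale0r addr0 tens2_one_linear.
Qed.

Definition tens2_der (x : P) : P := (ev (repr x)).2.

Lemma tens2_der_class t : tens2_der (pm_class _ t) = (ev t).2.
Proof. by congr (_.2); exact/der_ev_eq/pm_class_repr. Qed.
Lemma tens2_derD x y : tens2_der (x + y) = tens2_der x + tens2_der y.
Proof. by rewrite -[x]pm_reprK -[y]pm_reprK -pm_classD !tens2_der_class. Qed.
Lemma tens2_derN x : tens2_der (- x) = - tens2_der x.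
Proof. by rewrite -[x]pm_reprK -pm_classN !tens2_der_class. Qed.
Lemma tens2_derZ s x : tens2_der (s *: x) = s *: tens2_der x + sym_der D s *: x.
Proof. by rewrite -[x]pm_reprK -pm_classZ !tens2_der_class -der_ev1. Qed.
Lemma tens2_der_one om : tens2_der (tens2_one om) = tens2_one (ext2_der om).
Proof. exact: (tens2_der_class (MGen om)). Qed.
Lemma tens2_der_wedge2 u v : tens2_der (wd u v) = wd (D u) v + wd u (D v).
Proof.
rewrite tens2_der_one ext2_der_wedge2 -[X in tens2_one (X + _)]scale1r tens2_one_linear.
by rewrite !scale1r.
Qed.

Context (K : submodule (ext2 V)) (DK : forall k, k \in K -> ext2_der k \in K).

Lemma koszul_im_der x : koszul_im K x -> koszul_im K (tens2_der x).
Proof.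
have E (M : zmodType) (a1 a2 a3 b1 b2 b3 c1 c2 c3 : M) :
    a1 - b1 + c1 + (a2 - b2 + c2 + (a3 - b3 + c3)) =
    a2 + a3 + a1 - (b1 + b3 + b2) + (c1 + c2 + c3).
  by rewrite !opprD [LHS](AC (3*(3*3)) (((4*7)*1)*((2*8)*5)*((3*6)*9))).
apply: (koszul_im_ind (Q := fun x => koszul_im K (tens2_der x))) => [|s {}x y Kx _ Dx Dy|u v w|k Kk].
- suff -> : tens2_der 0 = 0 by exact: koszul_im0.
  exact: (tens2_der_class MZero).
- by rewrite tens2_derD tens2_derZ -addrA; apply: koszul_imDZ => //; exact: koszul_imDZ.
- have := koszul_imDZ 1 (koszul_rel3 K (D u) v w)
    (koszul_imDZ 1 (koszul_rel3 K u (D v) w) (koszul_rel3 K u v (D w))).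
  rewrite !scale1r; congr (koszul_im K _).
  rewrite !(tens2_derD, tens2_derN, tens2_derZ) !tens2_der_wedge2 !sym_der_var !scalerDr.
  exact: E.
- by rewrite tens2_der_one; exact/koszul_relK/DK.
Qed.

End KoszulDerivation.

(** * A nilpotency criterion for Koszul modules with derivations *)

Section KoszulCriterion.
Context {F : numFieldType} {V : lmodType F} (K : submodule (ext2 V)).
Local Notation S := (sym V).
Local Notation wd u v := (tens2_one (wedge2 u v)).
Local Notation im := (koszul_im K).

Lemma koszul_imD y z : im y -> im z -> im (y + z).
Proof. by move=> Ky; rewrite -[y]scale1r; exact: koszul_imDZ. Qed.
Lemma koszul_imZ s y : im y -> im (s *: y).
Proof. by move=> Ky; rewrite -[_ *: _]addr0; exact: koszul_imDZ (koszul_im0 K). Qed.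
Lemma koszul_imB y z : im y -> im z -> im (y - z).
Proof. by move=> Ky Kz; rewrite addrC -scaleN1r; exact: koszul_imDZ. Qed.

Lemma tens2_one0 : tens2_one 0 = 0 :> @tens2 F V.
Proof.
have := tens2_one_linear (V := V) (-1) 0 0.
by rewrite scaler0 addr0 scaleN1r => ->; rewrite scaleNr scale1r addNr.
Qed.

Lemma wedge2v0 (u : V) : wedge2 u 0 = 0.
Proof. by have := wedge2_linearr (-1) u 0 0; rewrite scaler0 addr0 scaleN1r addNr. Qed.

Definition koszul_ann (s : S) : Prop := forall y, im (s *: y).

Lemma koszul_annD s t : koszul_ann s -> koszul_ann t -> koszul_ann (s + t).
Proof. by move=> Ks Kt y; rewrite scalerDl; exact: koszul_imD. Qed.
Lemma koszul_annMl s t : koszul_ann t -> koszul_ann (s * t).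
Proof. by move=> Kt y; rewrite -scalerA; exact/koszul_imZ/Kt. Qed.
Lemma koszul_annMr s t : koszul_ann s -> koszul_ann (s * t).
Proof. by rewrite mulrC; exact: koszul_annMl. Qed.
Lemma koszul_annN s : koszul_ann s -> koszul_ann (- s).
Proof. by rewrite -mulN1r; exact: koszul_annMl. Qed.

Lemma koszul_ann_wedge s : (forall u v, im (s *: wd u v)) -> koszul_ann s.
Proof.
move=> Ks; apply: (@pres_mod_ind _ _ (@ext_scal_rel F S (ext2 V))).
- by rewrite scaler0; exact: koszul_im0.
- move=> t x y Kx Ky; rewrite scalerDr; apply: koszul_imD => //.
  by rewrite scalerA mulrC -scalerA; exact: koszul_imZ.
apply: (@pres_mod_ind _ _ (@ext2_rel F V)) => [|c x y Kx Ky|[u v]]; last exact: Ks.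
  change (im (s *: tens2_one 0)).
  by rewrite tens2_one0 scaler0; exact: koszul_im0.
change (im (s *: tens2_one (c *: x + y))).
rewrite tens2_one_linear scalerDr; apply: koszul_imD => //.
by rewrite scalerA mulrC -scalerA; exact: koszul_imZ.
Qed.

Section Derivation.
Context (D : {linear V -> V}) (DK : forall k, k \in K -> ext2_der D k \in K).
Local Notation d := (sym_der D).

(** By the Leibniz rule [d s *: y] is the derivative of [s *: y] minus [s *: tens2_der D y], and
    both are in the image. *)
Lemma koszul_ann_der s : koszul_ann s -> koszul_ann (d s).
Proof.
move=> Ks y; have := koszul_imB (koszul_im_der DK (Ks y)) (Ks (tens2_der D y)).
by rewrite tens2_derZ addrC addKr.
Qed.

(** Differentiate and multiply by [d a]. This extra factor, the reason why the exponent of [d a]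
    grows by two, makes the term that contains [d (d a)] a multiple of the given annihilator. What
    remains is [m.+1] times the claim, and [m.+1] is invertible in characteristic zero. *)
Lemma koszul_ann_radical_step a m j :
  koszul_ann (a ^+ m.+1 * d a ^+ j.*2) -> koszul_ann (a ^+ m * d a ^+ j.+1.*2).
Proof.
move=> Ka; have Kd := koszul_annMr (d a) (koszul_ann_der Ka).
have Kda : koszul_ann (j.*2%:R * d (d a) * (a ^+ m.+1 * d a ^+ j.*2)).
  exact: koszul_annMl.
have := koszul_annD Kd (koszul_annN Kda).
have -> : d (a ^+ m.+1 * d a ^+ j.*2) * d a - j.*2%:R * d (d a) * (a ^+ m.+1 * d a ^+ j.*2) =
    m.+1%:R * (a ^+ m * d a ^+ j.+1.*2).
  rewrite sym_derM !sym_derX doubleS !exprS /=.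
  case: j.*2 => [|j']; first by rewrite !mul0r; ring.
  by rewrite /= !exprS; ring.
have unit_m : (m.+1%:R : F)^-1%:A * m.+1%:R = 1 :> S.
  by rewrite -scaler_nat -scalerAl mul1r scalerA mulVf ?scale1r // pnatr_eq0.
by move/(koszul_annMl ((m.+1%:R : F)^-1%:A)); rewrite mulrA unit_m mul1r.
Qed.

(** The [m] factors [a] are traded one at a time for two factors [d a] each. *)
Lemma koszul_ann_radical a m : koszul_ann (a ^+ m) -> exists p, koszul_ann (d a ^+ p).
Proof.
move=> Ka; exists m.*2.
suff : koszul_ann (a ^+ (m - m) * d a ^+ m.*2) by rewrite subnn mul1r.
elim: {-2 3}m (leqnn m) => [|j IHj] jm; first by rewrite subn0 mulr1.
by apply: koszul_ann_radical_step; rewrite subnSK //; exact/IHj/ltnW.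
Qed.

(** The derivative of x^h (x /\ u), multiplied by x, has three terms: a multiple of the hypothesis,
    x^(h+1) (D x /\ u) and the claim. The second is removed by the Koszul relation for x, D x and u,
    whose other two terms are covered by the hypothesis and by [wedge2 x (D x) \in K]. *)
Lemma koszul_wedge_step x u h : wedge2 x (D x) \in K ->
  im (sym_var x ^+ h *: wd x u) -> im (sym_var x ^+ h.+1 *: wd x (D u)).
Proof.
set X := sym_var x => /koszul_relK xDx Kh.
have K1 : im (X ^+ h *: (X *: wd (D x) u)).
  have := koszul_imD (koszul_rel3 K x (D x) u) (koszul_imZ (sym_var (D x)) (koszul_im0 K)).
  rewrite scaler0 addr0 => /(koszul_imZ (X ^+ h)) K3.
  have := koszul_imB K3 (koszul_imZ (X ^+ h * sym_var u) xDx).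
  rewrite -scalerA -scalerBr addrK => K4.
  have := koszul_imD K4 (koszul_imZ (sym_var (D x)) Kh).
  by rewrite scalerBr [X in _ + X]scalerA [_ * X ^+ h]mulrC -[X in _ + X]scalerA subrK.
have := koszul_imZ X (koszul_im_der DK Kh).
rewrite tens2_derZ tens2_der_wedge2 sym_derX sym_der_var => K2.
have := koszul_imB (koszul_imB K2 K1) (koszul_imZ (h%:R * sym_var (D x)) Kh).
congr (im _); rewrite -/X !scalerDr !scalerA exprS.
have -> : X * (h%:R * X ^+ h.-1 * sym_var (D x)) = h%:R * sym_var (D x) * X ^+ h.
  case: (h) => [|h']; first by rewrite !mul0r mulr0.
  by rewrite /= exprS; ring.
by rewrite [X ^+ h * X]mulrC addrAC addrK addrC addKr.
Qed.

End Derivation.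

Lemma koszul_nilpotent_criterion (I : finType) (D : I -> {linear V -> V}) (x : V) (N : nat) :
  let word := foldr (fun i v => D i v) x in
  (forall i k, k \in K -> ext2_der (D i) k \in K) ->
  (forall i, wedge2 x (D i x) \in K) ->
  (forall v, v \in Defs.span (fun y => exists w, y = word w)) ->
  (forall w, (N <= size w)%N -> word w = 0) ->
  koszul_nilpotent K.
Proof.
move=> word DK xDx Vword word0; set X := sym_var x.
have wedge_word w : im (X ^+ size w *: wd x (word w)).
  elim: w => [|i w IHw]; last first.
    change (im (X ^+ (size w).+1 *: wd x (D i (word w)))).
    exact: koszul_wedge_step (DK i) _ _ _ (xDx i) IHw.
  by rewrite /= wedge2vv tens2_one0 scaler0; exact: koszul_im0.
have wedge_x v : im (X ^+ N *: wd x v).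
  apply: (span_ind (Q := fun v => im (X ^+ N *: wd x v))) (Vword v).
    by rewrite wedge2v0 tens2_one0 scaler0; exact: koszul_im0.
  move=> c _ y [w ->] Ky.
  rewrite wedge2_linearr tens2_one_linear scalerDr; apply: koszul_imD => //.
  rewrite scalerA mulrC -scalerA; apply: koszul_imZ.
  have [Nw|/ltnW Nw] := leqP N (size w).
    rewrite word0 // wedge2v0 tens2_one0 scaler0.
    exact: koszul_im0.
  by rewrite -(subnK Nw) exprD -scalerA; exact: koszul_imZ.
(* One more factor [X] reduces an arbitrary wedge to wedges with [x]: modulo the image,
   [X *: wd u v] equals [sym_var u *: wd x v - sym_var v *: wd x u]. *)
have annX : koszul_ann (X ^+ N.+1).
  apply: koszul_ann_wedge => u v; rewrite exprSr -scalerA.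
  have := koszul_imZ (X ^+ N) (koszul_rel3 K x u v).
  rewrite scalerDr scalerBr => K3.
  have := koszul_imD (koszul_imB K3 (koszul_imZ (sym_var v) (wedge_x u)))
     (koszul_imZ (sym_var u) (wedge_x v)).
  by rewrite !scalerA ![_ * X ^+ N]mulrC addrK subrK.
have annW w : exists p, koszul_ann (sym_var (word w) ^+ p).
  elim: w => [|i w [p annp]]; first by exists N.+1.
  have [q annq] := koszul_ann_radical (DK i) annp.
  by exists q; rewrite sym_der_var in annq.
have [T [b [b_word Vb]]] := span_wordsP word N.
have {}Vb v : exists c : T -> F, v = \sum_t c t *: b t.
  apply: Vb; move: v (Vword v); apply: span_sub => _ [w ->].
  have [Nw|wN] := leqP N (size w); first by rewrite word0 // submod0.
  by apply: mem_span; exists w.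
have [p annp] : exists p, forall t, koszul_ann (sym_var (b t) ^+ p).
  have /choice[q qP] t : exists p, koszul_ann (sym_var (b t) ^+ p).
    by have [w ->] := b_word t.
  exists (\max_t q t) => t.
  by rewrite -(subnK (leq_bigmax t)) exprD; exact/koszul_annMl/qP.
(* Pigeonhole: once the factors are expanded in the [b t], every monomial of degree above [#|T| * p]
   contains some [b t] at least [p] times. *)
apply/koszul_nilpotentP; exists (#|T| * p).+1 => q qT v om.
have [c cP] := choice (fun i => Vb (v i)).
suff : koszul_ann (\prod_(i < q) sym_var (v i)) by [].
under eq_bigr => i _ do rewrite cP linear_sum.
rewrite bigA_distr_bigA /=; elim/big_ind: _ => [y|s t|f _].
- by rewrite scale0r; exact: koszul_im0.
- exact: koszul_annD.
have [t pt] : exists t, (p <= #|[pred i | f i == t]|)%N.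
  apply/existsP; apply: contraLR qT; rewrite negb_exists => /forallP small.
  rewrite -leqNgt -[X in (X <= _)%N](card_ord q) -sum1_card.
  rewrite (partition_big f xpredT) //= -sum_nat_const; apply: leq_sum => t _.
  by rewrite sum1_card; apply: ltnW; rewrite ltnNge; exact: small.
rewrite (bigID (fun i => f i == t)) /=; apply: koszul_annMr.
rewrite (eq_bigr (fun i => (c i t)%:A * sym_var (b t))); last first.
  by move=> i /eqP ->; rewrite linearZ /= -scalerAl mul1r.
rewrite big_split /=; apply: koszul_annMl; rewrite prodr_const.
by rewrite -(subnK pt) exprD; exact: koszul_annMl.
Qed.

End KoszulCriterion.

(** * Locally finite actions of nilpotent Lie algebras *)

Section LocalNilpotency.
Context {F : numFieldType} {L : lieAlgType F}.
Implicit Types x y z u v : L.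

Definition ad_nilp y u : Prop := exists m, iter m (lie y) u = 0.

Lemma iter_lie_linear m y : linear (iter m (lie y)).
Proof. by elim: m => // m IHm c u v; rewrite !iterS IHm linearP. Qed.

Lemma iter_lie0 m y : iter m (lie y) 0 = 0.
Proof. by elim: m => //= m ->; rewrite linear0. Qed.

Lemma iter_lie_le m p y u : (m <= p)%N -> iter m (lie y) u = 0 -> iter p (lie y) u = 0.
Proof. by move=> mp yu; rewrite -(subnK mp) iterD yu iter_lie0. Qed.

Lemma ad_nilp0 y : ad_nilp y 0.
Proof. by exists 0. Qed.

Lemma ad_nilpDZ y c u v : ad_nilp y u -> ad_nilp y v -> ad_nilp y (c *: u + v).
Proof.
move=> [m yu] [p yv]; exists (maxn m p).
by rewrite iter_lie_linear (iter_lie_le _ yu) ?leq_maxl // (iter_lie_le _ yv)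
  ?leq_maxr // scaler0 addr0.
Qed.

Lemma iter_lie_bracket m p y z u :
  iter m (lie y) z = 0 -> iter p (lie y) u = 0 -> iter (m + p) (lie y) (lie z u) = 0.
Proof.
move=> yz yu; rewrite lie_leibniz big1 // => i _.
have [mi|im] := leqP m i; first by rewrite (iter_lie_le mi yz) lie0l mul0rn.
rewrite [iter (_ - _) _ _](iter_lie_le _ yu) ?linear0 ?mul0rn //.
by rewrite -addnBAC ?leq_addl // ltnW.
Qed.

Lemma ad_nilp_bracket y z u : ad_nilp y z -> ad_nilp y u -> ad_nilp y (lie z u).
Proof. by move=> [m yz] [p yu]; exists (m + p)%N; exact: iter_lie_bracket. Qed.

(** The square of side [m] and the triangle below its antidiagonal differ only in vanishing
    terms. *)
Lemma triangular_sum m (f : nat -> nat -> L) :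
  (forall a b, (m <= a + b)%N -> f a b = 0) ->
  \sum_(a < m) \sum_(b < m) f a b = \sum_(s < m) \sum_(i < s.+1) f i (s - i)%N.
Proof.
move=> f0.
under [RHS]eq_bigr => s _ do rewrite (big_ord_widen m (fun i => f i (s - i)%N)) //.
rewrite [RHS](exchange_big_dep xpredT) //=; apply: eq_bigr => a _.
transitivity (\sum_(a <= s < m) f a (s - a)%N); last first.
  by rewrite big_geq_mkord; apply: eq_bigl => s; rewrite ltnS.
rewrite -[X in \sum_(X <= _ < _) _]add0n big_addn big_mkord.
under [RHS]eq_bigr => i _ do rewrite addnK.
rewrite [RHS](big_ord_widen m (f a)) ?leq_subr // [RHS]big_mkcond.
apply: eq_bigr => b _; case: ltnP => // mb; rewrite f0 //.
by rewrite -leq_subLR.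
Qed.

(** A truncation of [exp (t ad x) z]. The cutoff is explicit because [ad x] is only nilpotent on
    particular vectors; beyond the order of nilpotency the value no longer depends on it
    ([ad_exp_widen]). *)
Definition ad_exp m (t : F) x z := \sum_(s < m) (t ^+ s / s`!%:R) *: iter s (lie x) z.

Lemma ad_exp_widen m p t x z : (m <= p)%N -> iter m (lie x) z = 0 ->
  ad_exp p t x z = ad_exp m t x z.
Proof.
move=> mp xz; rewrite /ad_exp [RHS](big_ord_widen p (fun s => (t ^+ s / s`!%:R) *: iter s (lie x) z)) //.
rewrite [RHS]big_mkcond; apply: eq_bigr => s _.
by case: ltnP => // ms; rewrite (iter_lie_le ms xz) scaler0.
Qed.

(** The exponential of a derivation is multiplicative: by the Leibniz rule the term of degree s on
    the left is the s-th antidiagonal of the product of the two series, and all antidiagonals from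
    [m + p] on vanish. *)
Lemma ad_exp_bracket m p t x y u : iter m (lie x) y = 0 -> iter p (lie x) u = 0 ->
  ad_exp (m + p) t x (lie y u) = lie (ad_exp m t x y) (ad_exp p t x u).
Proof.
move=> xy xu; rewrite -(ad_exp_widen t (leq_addr p m) xy) -(ad_exp_widen t (leq_addl m p) xu).
pose f a b := (t ^+ a / a`!%:R * (t ^+ b / b`!%:R)) *:
  lie (iter a (lie x) y) (iter b (lie x) u).
rewrite [RHS](_ : _ = \sum_(a < m + p) \sum_(b < m + p) f a b); last first.
  rewrite lie_suml; apply: eq_bigr => a _; rewrite linear_sum; apply: eq_bigr => b _.
  by rewrite /= lieZl [lie _ (_ *: _)]linearZ /= scalerA.
rewrite triangular_sum => [|a b mp_ab]; last first.
  rewrite /f; have [ma|am] := leqP m a; first by rewrite (iter_lie_le ma xy) lie0l scaler0.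
  rewrite (iter_lie_le _ xu) ?linear0 ?scaler0 //.
  by rewrite -(leq_add2l m) (leq_trans mp_ab) // leq_add2r ltnW.
apply: eq_bigr => s _; rewrite lie_leibniz scaler_sumr; apply: eq_bigr => i _.
have si : (i <= s)%N by rewrite -ltnS.
rewrite -scaler_nat scalerA; congr (_ *: _).
rewrite mulrACA -exprD subnKC // -mulrA -invfM -natrM; congr (_ * _).
rewrite -(bin_fact si) !natrM.
by field; rewrite !pnatr_eq0 -!lt0n !fact_gt0 bin_gt0 si.
Qed.

(** By the binomial formula the coefficients of degree s add up to (t - t)^s / s!, which vanishes
    unless s = 0. *)
Lemma ad_exp_inv m t x z : iter m (lie x) z = 0 -> ad_exp m t x (ad_exp m (- t) x z) = z.
Proof.
case: m => [/= ->|m xz]; first by rewrite /ad_exp big_ord0.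
pose f a b := (t ^+ a / a`!%:R * ((- t) ^+ b / b`!%:R)) *: iter (a + b) (lie x) z.
rewrite [LHS](_ : _ = \sum_(a < m.+1) \sum_(b < m.+1) f a b); last first.
  apply: eq_bigr => a _; rewrite /ad_exp.
  have -> : iter a (lie x) (\sum_(s < m.+1) ((- t) ^+ s / s`!%:R) *: iter s (lie x) z) =
      \sum_(s < m.+1) ((- t) ^+ s / s`!%:R) *: iter (a + s) (lie x) z.
    elim/big_rec2: _ => [|i u v _ <-]; first exact: iter_lie0.
    by rewrite iter_lie_linear iterD.
  by rewrite scaler_sumr; apply: eq_bigr => b _; rewrite scalerA.
rewrite triangular_sum => [|a b mab]; last by rewrite /f (iter_lie_le mab xz) scaler0.
rewrite big_ord_recl [X in _ + X]big1 => [|s _].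
  by rewrite addr0 big_ord1 /f /= !expr0 fact0 !divr1 mulr1 scale1r.
rewrite (eq_bigr (fun i : 'I_(bump 0 s).+1 => ((bump 0 s)`!%:R^-1 *
    ((- t) ^+ (bump 0 s - i) * t ^+ i *+ 'C(bump 0 s, i))) *: iter (bump 0 s) (lie x) z)) => [|i _].
  rewrite -scaler_suml -mulr_sumr -exprDn addNr /bump /= add1n expr0n /= mulr0.
  by rewrite scale0r.
have si : (i <= bump 0 s)%N by rewrite -ltnS.
rewrite /f subnKC //; congr (_ *: _); rewrite -(bin_fact si) !natrM -[_ *+ _]mulr_natl.
by field; rewrite !pnatr_eq0 -!lt0n !fact_gt0 bin_gt0 si.
Qed.

(* Conjugating the operator [ad y] by [exp (t ad x)]. *)
Lemma ad_nilp_exp m t x y v : iter m (lie x) y = 0 -> ad_nilp x v ->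
  (forall u, u \in Defs.span (fun z => exists s, z = iter s (lie x) v) -> ad_nilp y u) ->
  ad_nilp (ad_exp m t x y) v.
Proof.
move=> xy [p xv] ynil; pose u := ad_exp p (- t) x v.
have xu : iter p (lie x) u = 0.
  rewrite /u /ad_exp; elim/big_rec: _ => [|i w _ IHw]; first exact: iter_lie0.
  by rewrite iter_lie_linear IHw addr0 -iterD addnC iterD xv iter_lie0 scaler0.
have [q yu] : ad_nilp y u.
  apply: ynil; apply: (submod_big (N := Defs.span _)) => i _.
  by apply: submodZ; apply: mem_span; exists (val i).
exists q; have {xu} : exists2 r, iter r (lie x) u = 0 & ad_exp r t x u = v.
  by exists p => //; rewrite ad_exp_inv.
(* The exponential intertwines [lie y] with the bracket by the conjugate of [y]. The cutoff [r] is
   existential because every bracket with [y] raises it by [m]. *)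
suff : forall w, (exists2 r, iter r (lie x) u = 0 & ad_exp r t x u = w) ->
    exists2 r, iter r (lie x) (iter q (lie y) u) = 0 &
      ad_exp r t x (iter q (lie y) u) = iter q (lie (ad_exp m t x y)) w.
  move=> /[apply] -[r _ <-]; rewrite yu /ad_exp big1 // => s _.
  by rewrite iter_lie0 scaler0.
move=> w [r xu uw]; elim: q {yu} => [|q [r' IHx IHw]]; first by exists r.
exists (m + r')%N; first exact: iter_lie_bracket.
by rewrite !iterS ad_exp_bracket // IHw.
Qed.

Lemma polynomial_coef_mem (G : submodule L) m (z : nat -> L) :
  (forall t : F, \sum_(s < m) t ^+ s *: z s \in G) -> forall s, (s < m)%N -> z s \in G.
Proof.
elim: m z => [//|m IHm] z Gz.
(* [p (2 t) - 2 ^ m p t] has no term of degree [m]. *)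
have low s : (s < m)%N -> z s \in G.
  move=> sm; have /(IHm (fun s => (2 ^+ s - 2 ^+ m) *: z s)) /(_ s sm) : forall t : F,
      \sum_(s < m) t ^+ s *: ((2 ^+ s - 2 ^+ m) *: z s) \in G.
    move=> t; suff -> : \sum_(s < m) t ^+ s *: ((2 ^+ s - 2 ^+ m) *: z s) =
        \sum_(s < m.+1) (2 * t) ^+ s *: z s - 2 ^+ m *: \sum_(s < m.+1) t ^+ s *: z s.
      exact: submodB (Gz _) (submodZ _ (Gz _)).
    rewrite !big_ord_recr /= exprMn scalerDr opprD scalerA addrACA subrr addr0.
    rewrite scaler_sumr -sumrB; apply: eq_bigr => i _.
    by rewrite exprMn !scalerA -scalerBl; congr (_ *: _); ring.
  move/(submodZ (2 ^+ s - 2 ^+ m)^-1); rewrite scalerA mulVf ?scale1r //.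
  by rewrite subr_eq0 -!natrX eqr_nat eqn_exp2l // ltn_eqF.
move=> s; rewrite ltnS leq_eqVlt => /orP[/eqP->|]; last exact: low.
have Gs : \sum_(i < m) z i \in G by apply: submod_big => i _; exact: low.
have := submodB (Gz 1) Gs; rewrite big_ord_recr /= expr1n scale1r.
by under eq_bigr do rewrite expr1n scale1r; rewrite addrAC subrr add0r.
Qed.

End LocalNilpotency.

Section LocalFiniteness.
Context {F : numFieldType} {L : lieAlgType F} {I : finType} (e : I -> L).
Implicit Types (w : seq I) (x y z u v : L).

Definition adw w v := foldr (fun i u => lie (e i) u) v w.

Lemma adw_cat w w' v : adw (w ++ w') v = adw w (adw w' v).
Proof. exact: foldr_cat. Qed.

Lemma adw0 w : adw w 0 = 0.
Proof. by elim: w => //= i w ->; rewrite linear0. Qed.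

Lemma adw_nseq m i v : adw (nseq m i) v = iter m (lie (e i)) v.
Proof. by elim: m => //= m ->. Qed.

(* The term of index [p.+1] of the lower central series of the subalgebra generated by [e]. *)
Definition word_span p : submodule L :=
  span (fun x => exists w i, (p <= size w)%N /\ x = adw w (e i)).

Lemma word_spanS p q x : (p <= q)%N -> x \in word_span q -> x \in word_span p.
Proof.
move=> pq; apply: span_mono => _ [w [i [qw ->]]].
by exists w, i; split=> //; exact: leq_trans qw.
Qed.

Lemma word_span_gen i : e i \in word_span 0.
Proof. by apply: mem_span; exists [::], i. Qed.

Lemma word_span_lie_gen p i y : y \in word_span p -> lie (e i) y \in word_span p.+1.
Proof.
apply: span_map => _ [w [j [pw ->]]].
by apply: mem_span; exists (i :: w), j.
Qed.

(** Induction on [w], since [ad [e j, z]] is the commutator of [ad (e j)] and [ad z]. *)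
Lemma word_span_lie_word w i q y :
  y \in word_span q -> lie (adw w (e i)) y \in word_span (size w + q).+1.
Proof.
elim: w q y => [|j w IHw] q y qy /=; first exact: word_span_lie_gen.
rewrite lie_lie; apply: submodB.

  exact/word_span_lie_gen/IHw.
by rewrite addSnnS; exact/IHw/word_span_lie_gen.
Qed.

Lemma word_span_lie p q x y :
  x \in word_span p -> y \in word_span q -> lie x y \in word_span (p + q).+1.
Proof.
move=> px qy; rewrite lieC; apply: submodN; move: x px.
apply: span_map => _ [w [i [pw ->]]] /=; rewrite lieC; apply: submodN.
by apply: word_spanS (word_span_lie_word _ _ qy); rewrite ltnS leq_add2r.
Qed.

Lemma word_span_iter m y z : y \in word_span 0 -> z \in word_span 0 ->
  iter m (lie y) z \in word_span m.
Proof. by move=> ny nz; elim: m => //= m; exact: (word_span_lie ny). Qed.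

(** A word of s letters applied to [v] is an eigenvector of [ad r] with eigenvalue s + c, so
    different lengths have different eigenvalues. By [eigen_bound] some suffix of a long word
    already kills [v]. *)
Lemma adw_bounded r v c (J : finType) (b : J -> L) : (forall i, lie r (e i) = e i) ->
  lie r v = c *: v -> (forall w, exists a : J -> F, adw w v = \sum_j a j *: b j) ->
  forall w, (#|J| <= size w)%N -> adw w v = 0.
Proof.
move=> re rv vb w Jw.
(* [x i] is the suffix of length [i] applied to [v]; beyond the length of [w] it is zero, which
   still satisfies the eigenvector equation. *)
pose x i := if (i <= size w)%N then adw (drop (size w - i) w) v else 0.
have rw s : lie r (adw s v) = ((size s)%:R + c) *: adw s v.
  elim: s => [|i s IHs]; first by rewrite add0r.
  rewrite /= lie_derivation re IHs linearZ /=.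
  by rewrite -natr1 [X in _ = X *: _]addrAC [RHS]scalerDl scale1r [LHS]addrC.
have [] := @eigen_bound _ _ (lie r) J b x (fun i => i%:R + c).
- move=> i; rewrite /x; case: leqP => // _; exists (fun=> 0).
  by rewrite big1 // => j _; rewrite scale0r.
- by move=> i j /addIr/eqP; rewrite eqr_nat => /eqP.
- move=> i; rewrite /x; case: leqP => [iw|_]; last by rewrite linear0 scaler0.
  by rewrite /= rw size_drop subKn.
move=> i iJ; rewrite /x (leq_trans iJ Jw) => wi.
by rewrite -(cat_take_drop (size w - i) w) adw_cat wi adw0.
Qed.

Context (N : nat) (nilp : forall w i, (N <= size w)%N -> adw w (e i) = 0).
Context (v : L) (v_nilp : forall i, ad_nilp (e i) v).

Lemma word_span_nilp x : x \in word_span N -> x = 0.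
Proof.
apply: (span_ind (Q := fun x => x = 0)) => // c _ y [w [i [Nw ->]]] ->.
by rewrite nilp // scaler0 addr0.
Qed.

Lemma word_span_ad_nilp y z : y \in word_span 0 -> z \in word_span 0 ->
  iter N (lie y) z = 0.
Proof. by move=> ny nz; exact/word_span_nilp/word_span_iter. Qed.

(** Nilpotency on [v] is not visibly preserved by sums or brackets; hence the use of the linear span
    and of conjugation by exponentials. *)
Definition integrable y := y \in word_span 0 /\ ad_nilp y v.

Lemma integrable_exp t i y : integrable y -> integrable (ad_exp N t (e i) y).
Proof.
move=> [ny yv]; split.
  apply: submod_big => s _; apply: submodZ.
  exact: word_spanS (word_span_iter _ (word_span_gen i) ny).
apply: ad_nilp_exp => //; first exact: word_span_ad_nilp (word_span_gen i) ny.
apply: (span_ind (Q := ad_nilp y)); first exact: ad_nilp0.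
move=> c _ z [s ->] yz; apply: ad_nilpDZ => //; elim: s => //= s IHs.
apply: ad_nilp_bracket => //; exists N; exact: word_span_ad_nilp ny (word_span_gen i).
Qed.

(* The bracket is the linear coefficient of the polynomial curve [t |-> exp (t ad (e i)) y]
   of integrable elements. *)
Lemma span_integrable_lie_gen i x : x \in span integrable -> lie (e i) x \in span integrable.
Proof.
apply: span_map => y [ny yv] /=.
(* For [N <= 1] the truncated curve has no linear term, but then all brackets with the generators
   vanish. *)
have [N1|N1] := leqP N 1.
  suff -> : lie (e i) y = 0 by exact: submod0.
  by apply/word_span_nilp/(word_spanS N1); exact: word_span_lie_gen.
have := @polynomial_coef_mem F L (span integrable) N (fun s => s`!%:R^-1 *: iter s (lie (e i)) y).
move=> /(_ _ 1%N N1); rewrite /= ?factS ?fact0 ?muln1 invr1 scale1r; apply=> t.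
suff <- : ad_exp N t (e i) y = \sum_(s < N) t ^+ s *: (s`!%:R^-1 *: iter s (lie (e i)) y).
  by apply: mem_span; exact: integrable_exp.
by apply: eq_bigr => s _; rewrite scalerA.
Qed.

Lemma span_integrable_word w i : adw w (e i) \in span integrable.
Proof.
elim: w => [|j w IHw]; last exact: span_integrable_lie_gen.
by apply: mem_span; split; [exact: word_span_gen|exact: v_nilp].
Qed.

Lemma integrable_family : exists (J : finType) (y : J -> L), (forall j, integrable (y j)) /\
  forall x, x \in word_span 0 -> exists a : J -> F, x = \sum_j a j *: y j.
Proof.
(* A nonempty sequence lists the letters in the order in which they act, the innermost generator
   first. Words with fewer than [N] letters on a generator thus become sequences of length at most
   [N]. *)
pose f s := if s is i :: w then adw (rev w) (e i) else 0.
have [T [b [bw bP]]] := span_wordsP f N.+1.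
have [|J [y [gy yP]]] := @span_family _ _ integrable T b.
  move=> t; have [[|i w] ->] := bw t; [exact: submod0|exact: span_integrable_word].
exists J, y; split=> // x nx; apply: span_finP.
suff /bP[a ->] : x \in span (fun y => exists2 w, (size w < N.+1)%N & y = f w).
  by apply: submod_big => t _; exact/submodZ/yP.
move: x nx; apply: span_sub => _ [w [i [_ ->]]].
have [/nilp -> |wN] := leqP N (size w); first exact: submod0.
by apply: mem_span; exists (i :: rev w) => /=; rewrite ?size_rev ?revK.
Qed.

(* Modulo shorter words the letters of a word in the [y j] commute, so in a long word
   some letter can be moved to the right until a power of it kills [v]. *)
Lemma adw_finite : exists (J : finType) (b : J -> L),
  forall w, exists a : J -> F, adw w v = \sum_j a j *: b j.
Proof.
have [J [y [gy yP]]] := integrable_family.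
pose yw := foldr (fun j u => lie (y j) u).
pose U q : submodule L := span (fun x => exists2 s : seq J, (size s <= q)%N & x = yw v s).
have US p q x : (p <= q)%N -> x \in U p -> x \in U q.
  by move=> pq; apply: span_mono => _ [s sp ->]; exists s => //; exact: leq_trans pq.
have Uy j q x : x \in U q -> lie (y j) x \in U q.+1.
  by apply: span_map => _ [s sq ->]; apply: mem_span; exists (j :: s).
(* Any element of [word_span 0], in particular a bracket of two letters, costs a single letter in
   the filtration [U]. This is why exchanging two neighbours changes a word only by shorter
   words. *)
have Un z q x : z \in word_span 0 -> x \in U q -> lie z x \in U q.+1.
  move=> /yP[a ->] Ux; rewrite lie_suml; apply: submod_big => j _.
  by rewrite lieZl; apply: submodZ; exact: Uy.
have Uw s : yw v s \in U (size s) by apply: mem_span; exists s.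
have move_front j s1 s2 :
    yw v (j :: s1 ++ s2) - yw v (s1 ++ j :: s2) \in U (size (s1 ++ s2)).
  elim: s1 => [|i s1 IHs]; first by rewrite subrr submod0.
  rewrite [yw v _]/= lie_derivation -addrA -linearB; apply: submodD; last exact: Uy.
  by apply: Un (Uw _); apply: (word_spanS (leq0n 1)); exact: (word_span_lie (p := 0) (q := 0) (gy _).1 (gy _).1).
have perm s s' : perm_eq s s' -> yw v s - yw v s' \in U (size s).-1.
  elim: s s' => [|j s IHs] s'.
    by move=> /perm_size/esym/size0nil ->; rewrite subrr submod0.
  move=> ss'; have js' : j \in s' by rewrite -(perm_mem ss') mem_head.
  case/splitPr: js' ss' => s1 s2; rewrite -[j :: s2]cat1s perm_sym perm_catCA perm_sym perm_cons => ss.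
  rewrite -(subrK (yw v (j :: s1 ++ s2)) (yw v (j :: s))) -addrA; apply: submodD.
    have IH := IHs _ ss; rewrite -linearB.
    case: s {IHs} ss IH => [|i s] ss IH; last exact: Uy IH.
    by move/perm_size/esym/size0nil: ss => ->; rewrite subrr linear0 submod0.
  by rewrite /= (perm_size ss); exact: move_front.
have [M yM] : exists M, forall j, iter M (lie (y j)) v = 0.
  have [M MP] := choice (fun j => (gy j).2).
  by exists (\max_j M j) => j; apply: iter_lie_le (MP j); exact: leq_bigmax.
have U_reduce s : (#|J| * M < size s)%N -> yw v s \in U (size s).-1.
  move=> sM; have [j Mj] : exists j, (M <= count_mem j s)%N.
    apply/existsP; apply: contraLR sM; rewrite negb_exists => /forallP small.
    rewrite -leqNgt -sum_nat_const -sum1_size (eq_bigr (fun i => \sum_j (i == j : nat))).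
      rewrite exchange_big; apply: leq_sum => j _; rewrite -big_mkcond sum1_count.
      by have := small j; rewrite -ltnNge => /ltnW; congr (_ <= _)%N; apply: eq_count => i; rewrite /= eq_sym.
    move=> i _; rewrite (bigD1 i) //= eqxx big1 // => j ji.
    by rewrite eq_sym (negbTE ji).
  rewrite -(subrK (yw v ([seq i <- s | i != j] ++ nseq (count_mem j s) j)) (yw v s)).
  apply: submodD.
    apply: perm; rewrite -[X in X ++ _](eq_filter (a1 := predC (pred1 j))) //.
    rewrite perm_sym perm_catC perm_sym.
    suff -> : nseq (count_mem j s) j = filter (pred1 j) s by rewrite perm_sym perm_filterC.
    by rewrite -size_filter; apply/esym/all_pred1P/filter_all.
  rewrite -(subnK Mj) nseqD catA /yw foldr_cat.
  suff -> : foldr (fun j u => lie (y j) u) v (nseq M j) = 0.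
    rewrite (_ : foldr _ 0 _ = 0) ?submod0 //.
    by elim: (_ ++ _) => //= i s' ->; rewrite linear0.
  by rewrite -(yM j); elim: M {yM sM Mj} => //= m ->.
have {}Uw s : yw v s \in U (#|J| * M).
  have [m] := ubnP (size s); elim: m s => // m IHm s; rewrite ltnS => sm.
  have [sM|sM] := leqP (size s) (#|J| * M); first exact: US sM (Uw s).
  move: (U_reduce _ sM); apply: span_sub => _ [s' s's ->]; apply: IHm; apply: leq_ltn_trans s's _.
  by case: (size s) sM sm.
have [T [b [_ bP]]] := span_wordsP (yw v) (#|J| * M).+1.
exists T, b => w; apply: bP.
suff [q] : exists q, adw w v \in U q by apply: span_sub => _ [s _ ->]; exact: Uw.
elim: w => [|i w [q Uq]]; first by exists 0; apply: mem_span; exists [::].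
by exists q.+1; exact: Un (word_span_gen i) Uq.
Qed.

End LocalFiniteness.

(** * Kac-Moody algebras *)

(** These relations are kept apart from the Cartan matrix because they hold in [km_tilde] as well as
    in its quotient, and because exchanging the [e i] with the [f i] gives another instance
    ([chevalley_swap]), which halves the work. *)
Record chevalley (F : fieldType) (n : nat) (H : lmodType F) (L : lieAlgType F)
    (hh : {linear H -> L}) (e f : 'I_n -> L) (cor : 'I_n -> H) (rt : 'I_n -> H -> F) :
    Prop := Chevalley {
  chevalley_hh : forall h h', lie (hh h) (hh h') = 0;
  chevalley_ef : forall i j, lie (e i) (f j) = if i == j then hh (cor i) else 0;
  chevalley_he : forall h i, lie (hh h) (e i) = rt i h *: e i;
  chevalley_hf : forall h i, lie (hh h) (f i) = - rt i h *: f i }.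

Lemma chevalley_swap (F : fieldType) (n : nat) (H : lmodType F) (L : lieAlgType F)
    (hh : {linear H -> L}) (e f : 'I_n -> L) (cor : 'I_n -> H) (rt : 'I_n -> H -> F) :
  chevalley hh e f cor rt -> chevalley hh f e (fun i => - cor i) (fun i h => - rt i h).
Proof.
case=> hhh ef he hf; split=> // [i j|h i]; last by rewrite opprK.
rewrite lieC ef eq_sym; case: eqP => [->|]; by rewrite ?linearN ?oppr0.
Qed.

Section Chevalley.
Context {F : numFieldType} {n : nat} {H : lmodType F} {L : lieAlgType F}.
Context {hh : {linear H -> L}} {e f : 'I_n -> L} {cor : 'I_n -> H} {rt : 'I_n -> H -> F}.
Context (C : chevalley hh e f cor rt).
Implicit Types (w : seq 'I_n) (x y z v : L).

Definition weight w h := \sum_(i <- w) rt i h.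

Lemma lie_h_adw h w c v : lie (hh h) v = c *: v ->
  lie (hh h) (adw e w v) = (weight w h + c) *: adw e w v.
Proof.
move=> hv; elim: w => [|i w IHw]; first by rewrite /weight big_nil add0r.
rewrite /= lie_derivation (chevalley_he C) lieZl IHw [lie (e i) (_ *: _)]linearZ /= -scalerDl.
by rewrite /weight big_cons addrA.
Qed.

Lemma lie_f_gen i j : lie (f j) (e i) = if i == j then - hh (cor i) else 0.
Proof. by rewrite lieC (chevalley_ef C); case: eqP; rewrite ?oppr0. Qed.

Lemma lie_f_lie_e i j z : lie (f j) (lie (e i) z) =
  lie (e i) (lie (f j) z) - (if i == j then lie (hh (cor i)) z else 0).
Proof.
rewrite lie_derivation lie_f_gen addrC; congr (_ + _).
by case: eqP => _; rewrite ?lieNl // lie0l oppr0.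
Qed.

(** The part of height [m.+1] of the subalgebra generated by the [e i]: the innermost generator
    counts as well. *)
Definition words_of_size m : submodule L :=
  span (fun x => exists w i, size w = m /\ x = adw e w (e i)).

Lemma words_gen i : e i \in words_of_size 0.
Proof. by apply: mem_span; exists [::], i. Qed.

Lemma words_lie_gen m i x : x \in words_of_size m -> lie (e i) x \in words_of_size m.+1.
Proof.
apply: span_map => _ [w [j [wm ->]]]; apply: mem_span.
by exists (i :: w), j; rewrite /= wm.
Qed.

Lemma words_lie_h m h x : x \in words_of_size m -> lie (hh h) x \in words_of_size m.
Proof.
apply: span_map => _ [w [i [wm ->]]] /=.
rewrite (lie_h_adw w (chevalley_he C h i)); apply: submodZ; apply: mem_span.
by exists w, i.
Qed.

Lemma words_lie_f m j x : x \in words_of_size m.+1 -> lie (f j) x \in words_of_size m.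
Proof.
apply: span_map => _ [w [i [wm ->]]] /=; elim: w m wm => [//|a w IHw] m [wm].
rewrite [adw _ _ _]/= lie_f_lie_e; apply: submodB; last first.
  case: eqP => _; last exact: submod0.
  by apply: words_lie_h; apply: mem_span; exists w, i.
case: m wm => [/size0nil ->|m wm]; last exact/words_lie_gen/IHw.
rewrite lie_f_gen; case: eqP => _; last by rewrite linear0 submod0.
rewrite linearN /= lieC opprK (chevalley_he C); apply: submodZ; exact: words_gen.
Qed.

Lemma words_rho rho m x : (forall i, rt i rho = 1) ->
  x \in words_of_size m -> lie (hh rho) x = m.+1%:R *: x.
Proof.
move=> rt1; apply: (span_ind (Q := fun x => lie (hh rho) x = m.+1%:R *: x)).
  by rewrite linear0 scaler0.
move=> c _ y [w [i [wm ->]]] Qy; rewrite linearP /= Qy scalerDr; congr (_ + _).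
rewrite (lie_h_adw w (chevalley_he C rho i)) rt1 !scalerA mulrC; congr (_ * _ *: _).
rewrite /weight (eq_bigr (fun=> 1)) // big_const_seq count_predT iter_addr_0 wm.
by rewrite -natr1.
Qed.

Lemma lie_f_word_borel j w i :
  lie (f j) (adw e w (e i)) \in
    span (fun x => (exists h, x = hh h) \/ (exists w i, x = adw e w (e i))).
Proof.
case: w => [|a w].
  rewrite /= lie_f_gen; case: eqP => _; last exact: submod0.
  by apply: mem_span; left; exists (- cor i); rewrite linearN.
have : lie (f j) (adw e (a :: w) (e i)) \in words_of_size (size w).
  by apply: words_lie_f; apply: mem_span; exists (a :: w), i.
by apply: span_mono => _ [w' [i' [_ ->]]]; right; exists w', i'.
Qed.

End Chevalley.

(** Generation as a Lie algebra, encoded by its induction principle. *)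
Definition lie_generated (F : fieldType) (L : lieAlgType F) (G : L -> Prop) : Prop :=
  forall Q : L -> Prop, Q 0 -> (forall c x y, Q x -> Q y -> Q (c *: x + y)) ->
    (forall x y, Q x -> Q y -> Q (lie x y)) -> (forall x, G x -> Q x) -> forall x, Q x.

Definition chevalley_gens (F : fieldType) (n : nat) (H : lmodType F) (L : lieAlgType F)
    (hh : H -> L) (e f : 'I_n -> L) (x : L) : Prop :=
  [\/ exists h, x = hh h, exists i, x = e i | exists i, x = f i].

(** The elements that normalize [N] form a subalgebra. *)
Lemma lie_generated_stable (F : fieldType) (L : lieAlgType F) (G : L -> Prop) (N : submodule L) :
  lie_generated G -> (forall g x, G g -> x \in N -> lie g x \in N) ->
  forall x y, y \in N -> lie x y \in N.
Proof.
move=> Ggen GN; apply: Ggen => [y _|c x x' Qx Qx' y Ny|x x' Qx Qx' y Ny|g Gg y]; last exact: GN.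
- by rewrite lie0l submod0.
- by rewrite lie_linearl submodDZ ?Qx ?Qx'.
- by rewrite lie_lie submodB ?Qx ?Qx' // ?Qx ?Qx'.
Qed.

Section Triangular.
Context {F : numFieldType} {n : nat} {H : lmodType F} {L : lieAlgType F}.
Context {hh : {linear H -> L}} {e f : 'I_n -> L} {cor : 'I_n -> H} {rt : 'I_n -> H -> F}.
Context (C : chevalley hh e f cor rt).
Context (gen : lie_generated (chevalley_gens hh e f)).

Definition triangular x := [\/ exists h, x = hh h,
  exists w i, x = adw e w (e i) | exists w i, x = adw f w (f i)].

(** The span contains the generators and is stable under brackets with them, so it is an ideal that
    contains all generators. *)
Lemma triangular_span x : x \in span triangular.
Proof.
pose B : submodule L := span triangular.
have Cs := chevalley_swap C.
have lie_eh i h : lie (e i) (hh h) = - (rt i h *: e i).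
  by rewrite lieC (chevalley_he C).
have lie_fh i h : lie (f i) (hh h) = - (- rt i h *: f i).
  by rewrite lieC (chevalley_hf C).
have genB g y : chevalley_gens hh e f g -> y \in B -> lie g y \in B.
  move=> Gg; apply: span_map => {}y /= [[h' ->]|[w [j ->]]|[w [j ->]]]; case: Gg => [[h ->]|[i ->]|[i ->]].
  - by rewrite (chevalley_hh C); exact: submod0.
  - rewrite lie_eh; apply/submodN/submodZ/mem_span.
    by constructor 2; exists [::], i.
  - rewrite lie_fh; apply/submodN/submodZ/mem_span.
    by constructor 3; exists [::], i.
  - rewrite (lie_h_adw C w (chevalley_he C h j)); apply/submodZ/mem_span.
    by constructor 2; exists w, j.
  - by apply: mem_span; constructor 2; exists (i :: w), j.
  - move: (lie_f_word_borel C i w j); apply: span_mono => z [Hz|Hz].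
      by constructor 1.
    by constructor 2.
  - rewrite (lie_h_adw Cs w (chevalley_he Cs h j)); apply/submodZ/mem_span.
    by constructor 3; exists w, j.
  - move: (lie_f_word_borel Cs i w j); apply: span_mono => z [Hz|Hz].
      by constructor 1.
    by constructor 3.
  - by apply: mem_span; constructor 3; exists (i :: w), j.
have stB := lie_generated_stable gen genB.
apply: (gen (Q := fun x => x \in B)) => [|c {}x y|{}x y _|{}x]; first exact: submod0.
- exact: submodDZ.
- exact: stB.
case=> [[h ->]|[i ->]|[i ->]]; apply: mem_span.
- by constructor 1; exists h.
- by constructor 2; exists [::], i.
- by constructor 3; exists [::], i.
Qed.

End Triangular.

(* The functional of [km_functional] kills all nonzero weight spaces; for the Kac-Moody
   algebra it is a vacuum expectation value in a Verma module. *)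
Record km_algebra (F : fieldType) (n : nat) (A : 'M[int]_n) (H : lmodType F)
    (L : lieAlgType F) (hh : {linear H -> L}) (e f : 'I_n -> L)
    (cor : 'I_n -> H) (rt : 'I_n -> H -> F) : Prop := KmAlgebra {
  km_chevalley : chevalley hh e f cor rt;
  km_generated : lie_generated (chevalley_gens hh e f);
  km_simple : forall N : submodule L, (forall x y, y \in N -> lie x y \in N) ->
    (forall h, hh h \in N -> h = 0) -> forall x, x \in N -> x = 0;
  km_functional : forall h, h != 0 -> exists m : {linear L -> F^o},
    m (hh h) = 1 /\ forall h' x, m (lie (hh h') x) = 0;
  km_root_linear : forall i c h h', rt i (c *: h + h') = c * rt i h + rt i h';
  km_cartan : forall i j, rt j (cor i) = (A i j)%:~R;
  km_coweight : exists om : 'I_n -> H, forall i j, rt j (om i) = (i == j)%:R;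
  km_coroot_neq0 : forall i, cor i != 0 }.

(** * Representations of presented Lie algebras and Verma modules *)

Section LieRep.
Context {F : fieldType} {X : Type} {M : lmodType F} (op : X -> {linear M -> M}).

Fixpoint lie_rep (t : lie_term F X) : M -> M :=
  match t with
  | LGen x => op x
  | LZero => fun=> 0
  | LAdd t u => fun m => lie_rep t m + lie_rep u m
  | LOpp t => fun m => - lie_rep t m
  | LScale c t => fun m => c *: lie_rep t m
  | LBr t u => fun m => lie_rep t (lie_rep u m) - lie_rep u (lie_rep t m)
  end.

Lemma lie_rep_linear t : linear (lie_rep t).
Proof.
elim: t => [x||t IHt u IHu|t IHt|c t IHt|t IHt u IHu] a x' y' /=.
- exact: linearP.
- by rewrite scaler0 addr0.
- by rewrite IHt IHu scalerDr addrACA.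
- by rewrite IHt scalerN opprD.
- by rewrite IHt scalerDr !scalerA mulrC.
- by rewrite IHu IHt IHt IHu scalerBr opprD addrACA.
Qed.

Lemma lie_repD t x y : lie_rep t (x + y) = lie_rep t x + lie_rep t y.
Proof. by rewrite -[x]scale1r lie_rep_linear !scale1r. Qed.
Lemma lie_rep0 t : lie_rep t 0 = 0.
Proof. by have /eqP := lie_repD t 0 0; rewrite addr0 -subr_eq subrr eq_sym => /eqP. Qed.
Lemma lie_repZ t c x : lie_rep t (c *: x) = c *: lie_rep t x.
Proof. by rewrite -[c *: x]addr0 lie_rep_linear lie_rep0 addr0. Qed.
Lemma lie_repN t x : lie_rep t (- x) = - lie_rep t x.
Proof. by rewrite -scaleN1r lie_repZ scaleN1r. Qed.

Lemma lie_rep_eq (rel : lie_term F X -> lie_term F X -> Prop) :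
  (forall t u, rel t u -> lie_rep t =1 lie_rep u) ->
  forall t u, lie_eq rel t u -> lie_rep t =1 lie_rep u.
Proof.
move=> rep_rel t u; elim=> {t u} /=.
- exact: rep_rel.
- by [].
- by move=> t u _ IH x; rewrite IH.
- by move=> t u w _ IH1 _ IH2 x; rewrite IH1 IH2.
- by move=> t t' u u' _ IH1 _ IH2 x; rewrite IH1 IH2.
- by move=> t t' _ IH x; rewrite IH.
- by move=> c t t' _ IH x; rewrite IH.
- by move=> t t' u u' _ IH1 _ IH2 x; rewrite !IH1 !IH2.
- by move=> t u w x; rewrite addrA.
- by move=> t u x; rewrite addrC.
- by move=> t x; rewrite add0r.
- by move=> t x; rewrite addNr.
- by move=> a b t x; rewrite scalerA.
- by move=> t x; rewrite scale1r.
- by move=> a t u x; rewrite scalerDr.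
- by move=> a b t x; rewrite scalerDl.
- by move=> c t u w x; rewrite lie_repD lie_repZ scalerBr opprD addrACA.
- by move=> c t u w x; rewrite lie_repD lie_repZ scalerBr opprD addrACA.
- by move=> t x; rewrite subrr.
- move=> t u w x; rewrite !(lie_repD, lie_repN, opprD, opprK).
  (* The Jacobi identity for commutators expands into twelve terms that cancel in pairs. *)
  rewrite [LHS](AC ((2*2)*(2*2)*(2*2)) ((1*11)*(2*8)*(3*5)*(4*10)*(6*12)*(7*9))) /=.
  by rewrite !(subrr, addNr, addr0).
Qed.

End LieRep.

Section FreeLinear.
Context {F : fieldType} {X : Type} {M : lmodType F}.

Definition no_rel (t u : mod_term F X) : Prop := False.
Definition free_mod : lmodType F := pres_mod no_rel.
Definition free_gen (x : X) : free_mod := pm_gen no_rel x.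

Fact no_rel_lift (g : X -> M) t u : no_rel t u -> mod_eval g t = mod_eval g u.
Proof. by []. Qed.

Definition free_lift (g : X -> M) : {linear free_mod -> M} := pm_lift (no_rel_lift g).

Lemma free_liftE g x : free_lift g (free_gen x) = g x.
Proof. exact: pm_lift_class. Qed.

Lemma free_ext (f g : free_mod -> M) : linear f -> linear g ->
  (forall x, f (free_gen x) = g (free_gen x)) -> f =1 g.
Proof.
move=> fL gL fg; have lin0 (h : free_mod -> M) : linear h -> h 0 = 0.
  by move=> hL; have := hL (-1) 0 0; rewrite scaler0 addr0 scaleN1r addNr.
apply: pres_mod_ind => [|c x y fgx fgy|]; last exact: fg.
  by rewrite !lin0.
by rewrite fL gL fgx fgy.
Qed.

End FreeLinear.

Section VermaModule.
Context {F : fieldType} {n : nat} {A : 'M[int]_n} (H : realization F A).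
Context (lam : {linear H -> F^o}).

Local Notation M := (@free_mod F (seq 'I_n)).
Local Notation vw := (@free_gen F (seq 'I_n)).

(** In [km_tilde] the [f i] generate a free Lie algebra, so the Verma module of highest weight [lam]
    has the words in the [f i] as a basis. [verma_f] prepends a letter, [verma_h] is diagonal, and
    [verma_e] is moved past each letter by the commutation relation and kills the empty word. *)
Definition word_weight (w : seq 'I_n) (h : H) : F := lam h - \sum_(i <- w) root H i h.

Definition verma_f i : {linear M -> M} := free_lift (fun w => vw (i :: w)).
Definition verma_h h : {linear M -> M} := free_lift (fun w => word_weight w h *: vw w).
Fixpoint verma_e_word j (w : seq 'I_n) : M :=
  if w is i :: w' then verma_f i (verma_e_word j w') +
    (if i == j then word_weight w' (coroot H j) *: vw w' else 0) else 0.
Definition verma_e j : {linear M -> M} := free_lift (verma_e_word j).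

Definition verma_op (g : km_gen n H) : {linear M -> M} :=
  match g with KH h => verma_h h | KE i => verma_e i | KF i => verma_f i end.

Lemma word_weight_linear w c h h' :
  word_weight w (c *: h + h') = c * word_weight w h + word_weight w h'.
Proof.
rewrite /word_weight linearP mulrBr addrACA -opprD; congr (_ - _).
rewrite mulr_sumr -big_split; apply: eq_bigr => i _ /=; rewrite linearP.
by [].
Qed.

Lemma verma_h_word h w : verma_h h (vw w) = word_weight w h *: vw w.
Proof. exact: free_liftE. Qed.
Lemma verma_f_word i w : verma_f i (vw w) = vw (i :: w).
Proof. exact: free_liftE. Qed.
Lemma verma_e_wordE j w : verma_e j (vw w) = verma_e_word j w.
Proof. exact: free_liftE. Qed.

Lemma verma_hf h i x : verma_h h (verma_f i x) - verma_f i (verma_h h x) =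
  - root H i h *: verma_f i x.
Proof.
(* [t] and [u] express the two sides as actions of formal terms, so that [lie_rep_linear] gives
   their linearity in [x]. *)
pose t : lie_term F (km_gen n H) := LBr (LGen (KH h)) (LGen (KF i)).
pose u : lie_term F (km_gen n H) := LScale (- root H i h) (LGen (KF i)).
apply: (free_ext (lie_rep_linear verma_op t) (lie_rep_linear verma_op u)) => w /=.
rewrite verma_f_word !verma_h_word linearZ /= verma_f_word -scalerBl; congr (_ *: _).
by rewrite /word_weight big_cons; ring.
Qed.

Lemma verma_he_word h j w :
  verma_h h (verma_e_word j w) = (word_weight w h + root H j h) *: verma_e_word j w.
Proof.
elim: w => [|i w IHw] /=; first by rewrite linear0 scaler0.
rewrite linearD /= scalerDr; congr (_ + _).
  have /eqP := verma_hf h i (verma_e_word j w); rewrite subr_eq => /eqP ->.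
  rewrite IHw linearZ /= -scalerDl; congr (_ *: _).
  by rewrite /word_weight big_cons; ring.
case: eqP => [->|_]; last by rewrite linear0 scaler0.
rewrite linearZ /= verma_h_word !scalerA mulrC; congr (_ * _ *: _).
by rewrite /word_weight big_cons; ring.
Qed.

Lemma verma_rel t u : km_rel t u -> lie_rep verma_op t =1 lie_rep verma_op u.
Proof.
move=> tu; apply: free_ext => [||w]; [exact: lie_rep_linear|exact: lie_rep_linear|].
case: tu => [c h h'|h h'|i j|h j|h i] /=; last exact: verma_hf.
- by rewrite !verma_h_word word_weight_linear scalerDl scalerA.
- rewrite !verma_h_word [verma_h h _]linearZ [verma_h h' _]linearZ /= !verma_h_word.
  by rewrite !scalerA mulrC subrr.
- rewrite verma_f_word !verma_e_wordE /= addrC addKr eq_sym.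
  by case: eqP => [->|_] //=; rewrite verma_h_word.
- rewrite verma_e_wordE verma_he_word verma_h_word linearZ /= verma_e_wordE.
  by rewrite -scalerBl addrC addKr.
Qed.

Definition vacuum : {linear M -> F^o} := free_lift (fun w => (w == [::])%:R : F^o).

Lemma vacuum_h h x : vacuum (verma_h h x) = lam h * vacuum x.
Proof.
apply: (free_ext (f := fun x => vacuum (verma_h h x)) (g := fun x => lam h * vacuum x : F^o)) => [c y z|c y z|w].
- by rewrite !linearP.
- by rewrite linearP [RHS]addrC mulrDr addrC; congr (_ + _); exact: mulrCA.
rewrite verma_h_word linearZ /= !free_liftE; case: w => [|i w] /=.
  by rewrite /word_weight big_nil subr0.
by rewrite mulr0 [LHS]mulr0.
Qed.

Definition vacuum_coef (x : km_tilde H) : F^o :=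
  vacuum (lie_rep verma_op (repr x) (vw [::])).

Lemma vacuum_coef_class t :
  vacuum_coef (pl_class _ t) = vacuum (lie_rep verma_op t (vw [::])).
Proof. by congr (vacuum _); exact: (lie_rep_eq verma_rel (pl_class_repr _ _)). Qed.

Fact vacuum_coef_linear : linear vacuum_coef.
Proof.
move=> c x y; rewrite -[x]pl_reprK -[y]pl_reprK -pl_classZ -pl_classD.
by rewrite !vacuum_coef_class /= linearP.
Qed.
HB.instance Definition _ :=
  GRing.isLinear.Build F (km_tilde H) F^o *:%R vacuum_coef vacuum_coef_linear.

Lemma vacuum_coef_h h : vacuum_coef (tilde_h h) = lam h.
Proof.
rewrite vacuum_coef_class /= verma_h_word linearZ /= free_liftE eqxx.
by rewrite /word_weight big_nil subr0 [LHS]mulr1.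
Qed.

(** The vacuum vector and the vacuum coefficient are both scaled by [lam h], so the two terms of the
    commutator cancel. Hence every vector of nonzero weight is killed. *)
Lemma vacuum_coef_lie_h h x : vacuum_coef (lie (tilde_h h) x) = 0.
Proof.
rewrite -[x]pl_reprK [lie _ _]pl_lieE vacuum_coef_class /= linearB /= vacuum_h.
rewrite verma_h_word lie_repZ linearZ /= /word_weight big_nil subr0.
exact: subrr.
Qed.

End VermaModule.

Section PresentedLieGenerated.
Context {F : fieldType} {X : Type} (rel : lie_term F X -> lie_term F X -> Prop).

Lemma pres_lie_generated : lie_generated (fun x => exists g, x = pl_gen rel g).
Proof.
move=> Q Q0 QD QB Qgen x; rewrite -[x]pl_reprK; elim: (repr x) => {x}.
- by move=> g; apply: Qgen; exists g.
- exact: Q0.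
- by move=> t Qt u Qu; rewrite pl_classD -[pl_class _ t]scale1r; exact: QD.
- by move=> t Qt; rewrite pl_classN -scaleN1r -[_ *: _]addr0; exact: QD.
- by move=> c t Qt; rewrite pl_classZ -[_ *: _]addr0; exact: QD.
- by move=> t Qt u Qu; rewrite -pl_lieE; exact: QB.
Qed.

End PresentedLieGenerated.

(** * The tilde algebra, its radical and the quotient *)

Section KacMoodyAlgebra.
Context {F : numFieldType} {n : nat} {A : 'M[int]_n} (H : realization F A).
Local Notation G := (km_tilde H).
Local Notation L := (kac_moody H).

Fact tilde_h_linear : linear (tilde_h (H := H)).
Proof.
move=> c h h'; rewrite /tilde_h /pl_gen -pl_classZ -pl_classD.
exact/pl_classP/lie_rel/km_linear.
Qed.
HB.instance Definition _ := GRing.isLinear.Build F H G *:%R (tilde_h (H := H)) tilde_h_linear.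

Definition tilde_e i : G := pl_gen _ (KE i).
Definition tilde_f i : G := pl_gen _ (KF i).

Lemma tilde_chevalley :
  chevalley (tilde_h (H := H)) tilde_e tilde_f (coroot H) (fun i h => root H i h).
Proof.
split=> [h h'|i j|h i|h i]; rewrite [lie _ _]pl_lieE.
- exact/pl_classP/lie_rel/km_hh.
- have /pl_classP -> := lie_rel (km_ef H i j).
  by case: eqP => [->|].
- have /pl_classP -> := lie_rel (km_he h i); exact: pl_classZ.
- have /pl_classP -> := lie_rel (km_hf h i); exact: pl_classZ.
Qed.

Lemma tilde_generated : lie_generated (chevalley_gens (tilde_h (H := H)) tilde_e tilde_f).
Proof.
move=> Q Q0 QD QB Qgen; apply: (pres_lie_generated Q0 QD QB) => _ [[h|i|i] ->]; apply: Qgen.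
- by constructor 1; exists h.
- by constructor 2; exists i.
- by constructor 3; exists i.
Qed.

(** Fundamental coweights: independence of the simple roots makes their coordinate matrix row free,
    and a right inverse has the coweights as columns. *)
Lemma root_dual : exists om : 'I_n -> H, forall i j, root H j (om i) = (i == j)%:R.
Proof.
pose b := vbasis {: H}.
pose A' := \matrix_(j < n, l < \dim {: H}) (root H j b`_l : F).
have /row_freeP[B AB] : row_free A'.
  rewrite -kermx_eq0; apply/rowV0P => u /sub_kermxP uA.
  have /freeP root_indep : free (mktuple (root H)) by exact: root_free.
  apply/rowP => i; rewrite [RHS]mxE; apply: root_indep i.
  apply/lfunP => h; rewrite lfunE sum_lfunE /= (coord_vbasis (memvf h)).
  rewrite (eq_bigr (fun i => \sum_l coord b l h *: (u 0 i * A' i l : F^o))) => [|i _].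
    rewrite exchange_big big1 // => l _; rewrite -scaler_sumr.
    by move/rowP: uA => /(_ l); rewrite !mxE => ->; rewrite scaler0.
  have -> : [seq root H i | i <- enum 'I_n]`_i = root H i.
    by rewrite -[RHS](tnth_mktuple (root H) i) (tnth_nth 0).
  rewrite scale_lfunE linear_sum scaler_sumr; apply: eq_bigr => l _.
  by rewrite linearZ mxE !scalerA mulrC -scalerA.
exists (fun i => \sum_l B l i *: b`_l) => i j.
rewrite linear_sum; move/matrixP: AB => /(_ j i); rewrite !mxE eq_sym => <-.
by apply: eq_bigr => l _; rewrite linearZ /= mxE mulrC.
Qed.

Section VacuumRadical.
Context (lam : {linear H -> F^o}).

(** An ideal contains the height components of its elements. If it meets the Cartan subalgebra
    trivially, the component of height zero vanishes, and the functional kills all others. *)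
Lemma vacuum_coef_rad x : x \in km_rad H -> vacuum_coef lam x = 0.
Proof.
apply: (span_ind (Q := fun x => vacuum_coef lam x = 0)) => [|c {}x y [I [hI Ix]] my].
  exact: linear0.
suff mx : vacuum_coef lam x = 0 by rewrite linearP /= mx my scaler0 addr0.
have [om omP] := root_dual; pose rho := \sum_i om i.
have rho1 i : root H i rho = 1.
  rewrite linear_sum (bigD1 i) //= omP eqxx big1 ?addr0 // => j ji.
  by rewrite omP (negbTE ji).
have C := tilde_chevalley; have Cs := chevalley_swap C.
(* For [d = 0] the predicate asks for an element of the Cartan subalgebra, not just for an
   eigenvector; the triangular decomposition provides this. *)
pose P (d : F) (z : G) := if d == 0 then exists h, z = tilde_h h
  else lie (tilde_h rho) z = d *: z.
have [] := @eigen_split _ _ (lie (tilde_h rho)) P I 0 _ _ _ x.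
- move=> d z; rewrite /P; case: eqP => [-> [h ->]|//].
  by rewrite scale0r /= (chevalley_hh C).
- move=> d a z; rewrite /P; case: eqP => _; last by move=> hz; rewrite linearZ /= hz !scalerA mulrC.
  by move=> [h ->]; exists (a *: h); rewrite linearZ.
- by move=> z; exact: ideal_lie.
- have := triangular_span C tilde_generated x; apply: span_mono => z [[h ->]|[w [i ->]]|[w [i ->]]].
  + by exists 0; rewrite /P eqxx; exists h.
  + exists (size w).+1%:R; rewrite /P pnatr_eq0; apply: (words_rho C rho1).
    by apply: mem_span; exists w, i.
  + exists (- (size w).+1%:R); rewrite /P oppr_eq0 pnatr_eq0.
    have : lie (tilde_h (- rho)) (adw tilde_f w (tilde_f i)) = (size w).+1%:R *: adw tilde_f w (tilde_f i).
      apply: (words_rho Cs) => [j|]; first by rewrite /= [root H j _]linearN /= opprK rho1.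
      by apply: mem_span; exists w, i.
    by move=> hz; rewrite -[rho]opprK [tilde_h _]linearN /= lieNl hz scaleNr.
- exact: Ix.
move=> y0 [Iy0 Py0 Pxy].
have y0_h : exists h, y0 = tilde_h h.
  apply: (span_ind (Q := fun y => exists h, y = tilde_h h)) Py0.
    by exists 0; rewrite linear0.
  by move=> a z z'; rewrite /P eqxx => -[h ->] [h' ->]; exists (a *: h + h'); rewrite linearP.
have y00 : y0 = 0 by case: y0_h Iy0 => h -> /hI.
rewrite y00 subr0 in Pxy; move: Pxy.
apply: (span_ind (Q := fun z => vacuum_coef lam z = 0)); first exact: linear0.
move=> a z z' [d d0]; rewrite /P (negbTE d0) => hz mz'.
suff mz : vacuum_coef lam z = 0 by rewrite linearP /= mz mz' scaler0 addr0.
apply/eqP; have := vacuum_coef_lie_h lam rho z.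
by rewrite hz linearZ => /eqP; rewrite scaler_eq0 (negbTE d0).
Qed.

End VacuumRadical.
End KacMoodyAlgebra.

Section KacMoodyInstance.
Context {F : numFieldType} {n : nat} {A : 'M[int]_n} (H : realization F A).
Local Notation L := (kac_moody H).

Fact km_h_linear : linear (km_h (H := H)).
Proof. by move=> c h h'; rewrite /km_h !linearP. Qed.
HB.instance Definition _ := GRing.isLinear.Build F H L *:%R (km_h (H := H)) km_h_linear.

Definition km_e i : L := lproj (km_rad H) (tilde_e H i).
Definition km_f i : L := lproj (km_rad H) (tilde_f H i).

Lemma lproj_lie (x y : km_tilde H) :
  lproj (km_rad H) (lie x y) = lie (lproj (km_rad H) x) (lproj (km_rad H) y).
Proof. exact/esym/qlieE. Qed.

Lemma lproj_rad x : lproj (km_rad H) x = 0 <-> x \in km_rad H.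
Proof.
rewrite -(linear0 (lproj (km_rad H))) -[X in _ <-> X \in _]subr0.
exact: qprojP.
Qed.

Lemma kac_moody_chevalley :
  chevalley (km_h (H := H)) km_e km_f (coroot H) (fun i h => root H i h).
Proof.
have [hhh ef he hf] := tilde_chevalley H.
split=> [h h'|i j|h i|h i]; rewrite -lproj_lie.
- by rewrite hhh linear0.
- by rewrite ef; case: eqP => // _; rewrite linear0.
- by rewrite he linearZ.
- by rewrite hf linearZ.
Qed.

Lemma kac_moody_generated : lie_generated (chevalley_gens (km_h (H := H)) km_e km_f).
Proof.
move=> Q Q0 QD QB Qgen x; rewrite -[x]lprojK.
apply: (tilde_generated (H := H) (Q := fun x => Q (lproj (km_rad H) x))) => [|c {}x y Qx Qy|{}x y Qx Qy|{}x].
- by rewrite linear0.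
- by rewrite linearP; exact: QD.
- by rewrite lproj_lie; exact: QB.
- case=> [[h ->]|[i ->]|[i ->]]; apply: Qgen.
  + by constructor 1; exists h.
  + by constructor 2; exists i.
  + by constructor 3; exists i.
Qed.

Section Preimage.
Context (N : submodule L) (Nlie : forall x y, y \in N -> lie x y \in N).

Fact km_preim_closed : submod_closed (fun x => lproj (km_rad H) x \in N).
Proof.
split=> [|c x y Nx Ny]; rewrite unfold_in ?linear0 ?submod0 //.
by rewrite linearP submodDZ.
Qed.
Fact km_preim_lie (x y : km_tilde H) : y \in Submodule km_preim_closed ->
  lie x y \in Submodule km_preim_closed.
Proof. by move=> Ny; rewrite unfold_in lproj_lie; exact: Nlie Ny. Qed.

(** The preimage of [N] in [km_tilde] is an ideal that meets the Cartan subalgebra trivially, so it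
    lies in the radical. *)
Lemma kac_moody_simple : (forall h, km_h h \in N -> h = 0) -> forall x, x \in N -> x = 0.
Proof.
move=> Nh x Nx; rewrite -[x]lprojK; apply/lproj_rad/mem_span.
exists (LieIdeal km_preim_lie); split; last by rewrite unfold_in /= lprojK.
by move=> h; rewrite unfold_in => /Nh ->; rewrite linear0.
Qed.
End Preimage.

Section Functional.
Context (lam : {linear H -> F^o}).

Definition km_functional_of (p : L) : F^o := vacuum_coef lam (repr p).

Lemma km_functional_lproj x : km_functional_of (lproj (km_rad H) x) = vacuum_coef lam x.
Proof.
rewrite /km_functional_of -[RHS]addr0 -(vacuum_coef_rad lam (qproj_repr (km_rad H) x)).
by rewrite linearB addrC subrK.
Qed.

Fact km_functional_linear : linear km_functional_of.
Proof.
by move=> c p q; rewrite -[p]lprojK -[q]lprojK -linearP !km_functional_lproj linearP.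
Qed.
HB.instance Definition _ :=
  GRing.isLinear.Build F L F^o *:%R km_functional_of km_functional_linear.
End Functional.

Lemma kac_moody_functional (h : H) : h != 0 ->
  exists m : {linear L -> F^o}, m (km_h h) = 1 /\ forall h' x, m (lie (km_h h') x) = 0.
Proof.
move=> h0; pose b := vbasis {: H}.
have [l bl] : exists l, coord b l h != 0.
  apply/existsP; apply: contraNT h0; rewrite negb_exists => /forallP b0.
  rewrite (coord_vbasis (memvf h)) big1 // => l _.
  by have := b0 l; rewrite negbK => /eqP ->; rewrite scale0r.
(* A coordinate that does not vanish at [h], rescaled to take the value one there. *)
pose lam h' : F^o := (coord b l h)^-1 * coord b l h'.
have lam_linear : linear lam.
  by move=> c x y; rewrite /lam linearP mulrDr mulrCA.
pose lamL : {linear H -> F^o} := HB.pack lam (GRing.isLinear.Build F H F^o *:%R lam lam_linear).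
exists (km_functional_of lamL); split=> [|h' x].
  by rewrite /= km_functional_lproj vacuum_coef_h /= /lam mulVf.
rewrite -[x]lprojK -lproj_lie /= km_functional_lproj; exact: vacuum_coef_lie_h.
Qed.

Lemma kac_moody_km : km_algebra A (km_h (H := H)) km_e km_f (coroot H) (fun i h => root H i h).
Proof.
split.
- exact: kac_moody_chevalley.
- exact: kac_moody_generated.
- exact: kac_moody_simple.
- exact: kac_moody_functional.
- by move=> i c h h'; rewrite linearP.
- exact: root_coroot.
- exact: root_dual.
- move=> i; have /free_not0 := coroot_free H; apply.
  exact: map_f (mem_enum _ i).
Qed.

End KacMoodyInstance.

(** * Vectors of positive height and the Serre relations *)

Section KmTheory.
Context {F : numFieldType} {n : nat} {A : 'M[int]_n} {H : lmodType F} {L : lieAlgType F}.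
Context {hh : {linear H -> L}} {e f : 'I_n -> L} {cor : 'I_n -> H} {rt : 'I_n -> H -> F}.
Context (K : km_algebra A hh e f cor rt).
Implicit Types (w : seq 'I_n) (x y z v : L).
Let C := km_chevalley K.

Lemma km_hh_inj h : hh h = 0 -> h = 0.
Proof.
move=> hh0; apply/eqP; apply: contraT => /(km_functional K)[m [m1 _]].
by move: m1; rewrite hh0 linear0 => /esym/eqP; rewrite oner_eq0.
Qed.

Lemma km_root_sum (i : 'I_n) (g : 'I_n -> H) : rt i (\sum_j g j) = \sum_j rt i (g j).
Proof.
have rt0 : rt i 0 = 0.
  by have := km_root_linear K i (-1) 0 0; rewrite scaler0 addr0 mulN1r addNr.
elim/big_rec2: _ => // j y h _ <-.
by rewrite -[g j]scale1r (km_root_linear K) mul1r scale1r.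
Qed.

Lemma km_rho : exists rho, forall i, rt i rho = 1.
Proof.
have [om omP] := km_coweight K; exists (\sum_i om i) => i.
rewrite km_root_sum (bigD1 i) //= omP eqxx big1 ?addr0 // => j ji.
by rewrite omP (negbTE ji).
Qed.

Lemma lie_h_adw_gen h w z :
  lie (hh h) (adw e w z) = weight (rt := rt) w h *: adw e w z + adw e w (lie (hh h) z).
Proof.
elim: w => [|i w IHw]; first by rewrite /weight big_nil scale0r add0r.
rewrite /= lie_derivation (chevalley_he C) lieZl IHw linearD /= linearZ /= addrA.
by rewrite -scalerDl /weight big_cons.
Qed.

(* The ideal generated by a vector of positive height that is killed by all [f j] has
   positive height, so it meets the Cartan subalgebra trivially. *)
Lemma words_f_zero m x : x \in words_of_size (e := e) m -> (forall j, lie (f j) x = 0) -> x = 0.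
Proof.
(* All such vectors are taken at once: [x] need not be a weight vector, so its bracket with the
   Cartan subalgebra may leave the line of [x], but it stays in this class. *)
move=> mx fx; pose lowest z := z \in words_of_size (e := e) m /\ forall j, lie (f j) z = 0.
pose J : submodule L := span (fun y => exists w z, lowest z /\ y = adw e w z).
have J_gen g y : chevalley_gens hh e f g -> y \in J -> lie g y \in J.
  move=> Gg; apply: span_map => _ [w [z [[mz fz] ->]]] /=.
  have adwJ w' : adw e w' z \in J by apply: mem_span; exists w', z.
  have lie_hJ h w' : lie (hh h) (adw e w' z) \in J.
    rewrite lie_h_adw_gen; apply: submodD; first exact: submodZ.
    apply: mem_span; exists w', (lie (hh h) z); split=> //; split.
      exact: (words_lie_h C).
    move=> j; rewrite lie_derivation fz linear0 addr0 lieC [lie (f j) _]lieC.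
    by rewrite (chevalley_hf C) linearN opprK linearZ /= lieC fz oppr0 scaler0.
  case: Gg => [[h ->]|[i ->]|[i ->]]; [exact: lie_hJ|exact: (adwJ (i :: w))|].
  elim: w => [|j w IHw]; first by rewrite /= fz submod0.
  rewrite [adw _ _ _]/= (lie_f_lie_e C); apply: submodB; last first.
    by case: eqP => _; [exact: lie_hJ|exact: submod0].
  move: IHw; apply: span_map => _ [w' [z' [mz' ->]]].
  by apply: mem_span; exists (j :: w'), z'.
apply: (km_simple K (lie_generated_stable (km_generated K) J_gen)) => [h Jh|]; last first.
  by apply: mem_span; exists [::], x.
have [rho rho1] := km_rho.
pose P c y := exists2 p, c = p.+1%:R :> F & y \in words_of_size (e := e) p.
have : hh h \in span (P 0).
  apply: (eigen_span (T := lie (hh rho))).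
  - by move=> c y [p -> py]; exact: (words_rho C).
  - by move=> c a y [p -> py]; exists p => //; exact: submodZ.
  - move: Jh; apply: span_mono => _ [w [z [[mz _] ->]]].
    exists (size w + m).+1%:R, (size w + m)%N => //.
    by elim: w => //= i w; exact: words_lie_gen.
  - by rewrite /= (chevalley_hh C) scale0r.
move=> hP; apply: km_hh_inj; move: hP; apply: (span_ind (Q := fun y => y = 0)) => // c y z.
by case=> p /eqP; rewrite eq_sym pnatr_eq0.
Qed.

Lemma lie_e_h i h : lie (e i) (hh h) = - (rt i h *: e i).
Proof. by rewrite lieC (chevalley_he C). Qed.

Lemma words_iter m i j : iter m (lie (e i)) (e j) \in words_of_size (e := e) m.
Proof.
by rewrite -adw_nseq; apply: mem_span; exists (nseq m i), j; rewrite size_nseq.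
Qed.

(** The sl2 computation for the string through [e k]; the scalar vanishes at [m = - A i k], where
    the string ends. *)
Lemma lie_f_iter_same m i k : i != k -> A i i = 2 ->
  lie (f i) (iter m.+1 (lie (e i)) (e k)) =
    - (m.+1%:R * ((A i k)%:~R + m%:R)) *: iter m (lie (e i)) (e k).
Proof.
move=> ik Aii; elim: m => [|m IHm].
  rewrite /= (lie_f_lie_e C) eqxx (lie_f_gen C) eq_sym (negbTE ik) linear0 sub0r.
  by rewrite (chevalley_he C) (km_cartan K) mul1r addr0 scaleNr.
rewrite iterS (lie_f_lie_e C) IHm eqxx linearZ /=.
rewrite -[lie (e i) (iter _ _ _)]/(iter m.+1 (lie (e i)) (e k)) -adw_nseq.
rewrite (lie_h_adw C _ (chevalley_he C _ _)) (km_cartan K) -scalerBl; congr (_ *: _).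
rewrite /weight (big_nseq) iter_addr_0 (km_cartan K) Aii -mulr_natl -!natr1.
ring.
Qed.

Lemma lie_f_iter_other m i j k : j != i -> j != k ->
  lie (f j) (iter m (lie (e i)) (e k)) = 0.
Proof.
move=> ji jk; elim: m => [|m IHm].
  by rewrite /= (lie_f_gen C) eq_sym (negbTE jk).
by rewrite /= (lie_f_lie_e C) IHm linear0 sub0r eq_sym (negbTE ji) oppr0.
Qed.

Lemma lie_f_iter_last m i k : i != k ->
  lie (f k) (iter m.+1 (lie (e i)) (e k)) = (A k i)%:~R *: iter m (lie (e i)) (e i).
Proof.
move=> ik; elim: m => [|m IHm].
  rewrite /= (lie_f_lie_e C) (negbTE ik) (lie_f_gen C) eqxx subr0 linearN /= lie_e_h opprK.
  by rewrite (km_cartan K).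
by rewrite iterS (lie_f_lie_e C) IHm (negbTE ik) subr0 linearZ.
Qed.

(** The vector has positive height and is killed by [f i] through the sl2 formula, by [f k] because
    [[e i, e i] = 0] or, if [m = 0], because [A k i = 0], and by every other [f j] since it commutes
    with both generators. *)
Lemma serre m i k : i != k -> A i i = 2 -> A i k = - m%:Z -> (A i k = 0 -> A k i = 0) ->
  iter m.+1 (lie (e i)) (e k) = 0.
Proof.
move=> ik Aii Aik Aki; apply: words_f_zero (words_iter _ _ _) _ => j.
have [->|ji] := eqVneq j i.
  by rewrite lie_f_iter_same // Aik mulrNz addNr mulr0 oppr0 scale0r.
have [->|jk] := eqVneq j k; last exact: lie_f_iter_other.
rewrite lie_f_iter_last //; case: m Aik => [|m] Aik.
  by rewrite Aki ?scale0r // Aik.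
by rewrite -[iter _ _ _]/(iter m.+1 (lie (e i)) (e i)) iterSr lievv iter_lie0 scaler0.
Qed.

Lemma km_fin_dim_bounded : fin_dim L ->
  exists N, forall w i, (N <= size w)%N -> adw e w (e i) = 0.
Proof.
case=> m [b bP]; have [rho rho1] := km_rho; exists m => w i mw.
have ei j : lie (hh rho) (e j) = e j by rewrite (chevalley_he C) rho1 scale1r.
by apply: (adw_bounded (r := hh rho) (c := 1) (b := b)); rewrite ?card_ord ?scale1r.
Qed.

End KmTheory.

(** * Finite type subdiagrams and the degree one part *)

Section Transfer.
Context {F : numFieldType}.
Context {p : nat} {A' : 'M[int]_p} {H' : lmodType F} {L' : lieAlgType F}.
Context {hh' : {linear H' -> L'}} {e' f' : 'I_p -> L'} {cor' : 'I_p -> H'} {rt' : 'I_p -> H' -> F}.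
Context (K' : km_algebra A' hh' e' f' cor' rt').
Context {n : nat} {A : 'M[int]_n} {H : lmodType F} {L : lieAlgType F}.
Context {hh : {linear H -> L}} {e f : 'I_n -> L} {cor : 'I_n -> H} {rt : 'I_n -> H -> F}.
Context (K : km_algebra A hh e f cor rt).
Context (iota : 'I_p -> 'I_n) (iota_inj : injective iota).
Context (iotaA : forall i j, A' i j = A (iota i) (iota j)).
Let C' := km_chevalley K'.
Let C := km_chevalley K.

(* The graph of the map sending each word of [m.+1] letters in the [e'] to the same word
   in the [e]; that this is a well-defined map is [word_pairs_fst0]. *)
Definition word_pairs m : submodule (L' * L)%type :=
  span (fun y => exists w i, size w = m /\
    y = (adw e' w (e' i), adw e (map iota w) (e (iota i)))).

Lemma word_pairs_gen i : (e' i, e (iota i)) \in word_pairs 0.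
Proof. by apply: mem_span; exists [::], i. Qed.

Lemma word_pairs_ind (Q : L' * L -> Prop) m : Q 0 ->
  (forall c x y, Q x -> Q y -> Q (c *: x + y)) ->
  (forall w i, size w = m -> Q (adw e' w (e' i), adw e (map iota w) (e (iota i)))) ->
  forall y, y \in word_pairs m -> Q y.
Proof.
move=> Q0 QD Qw; apply: span_ind => // c _ y [w [i [wm ->]]] Qy.
by apply: QD => //; exact: Qw.
Qed.

Lemma word_pairs_lie_e m i y : y \in word_pairs m ->
  (lie (e' i) y.1, lie (e (iota i)) y.2) \in word_pairs m.+1.
Proof.
apply: (word_pairs_ind (Q := fun y => (lie (e' i) y.1, lie (e (iota i)) y.2) \in word_pairs m.+1)) => [|c x {}y Qx Qy|w j wm] /=.
- by rewrite !linear0; exact: submod0.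
- by rewrite !linearP; exact: (submodDZ (N := word_pairs m.+1) c Qx Qy).
- by apply: mem_span; exists (i :: w), j; rewrite /= wm.
Qed.

Lemma weight_iota w j : weight (rt := rt') w (cor' j) = weight (rt := rt) (map iota w) (cor (iota j)).
Proof.
rewrite /weight big_map; apply: eq_bigr => i _.
by rewrite (km_cartan K') (km_cartan K) iotaA.
Qed.

Lemma word_pairs_lie_f m j y : y \in word_pairs m.+1 ->
  (lie (f' j) y.1, lie (f (iota j)) y.2) \in word_pairs m.
Proof.
apply: (word_pairs_ind (Q := fun y => (lie (f' j) y.1, lie (f (iota j)) y.2) \in word_pairs m)) => [|c x {}y Qx Qy|w i wm] /=.
- by rewrite !linear0; exact: submod0.
- by rewrite !linearP; exact: (submodDZ (N := word_pairs m) c Qx Qy).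
elim: w m wm => [//|a w IHw] m [wm] /=.
rewrite (lie_f_lie_e C') (lie_f_lie_e C) (inj_eq iota_inj).
have h_pair : (if a == j then lie (hh' (cor' a)) (adw e' w (e' i)) else 0,
    if a == j then lie (hh (cor (iota a))) (adw e (map iota w) (e (iota i))) else 0) \in word_pairs m.
  case: eqP => [->|_]; last exact: submod0.
  rewrite (lie_h_adw C' _ (chevalley_he C' _ _)) (lie_h_adw C _ (chevalley_he C _ _)).
  rewrite weight_iota (km_cartan K') (km_cartan K) iotaA.
  have Pw : (adw e' w (e' i), adw e (map iota w) (e (iota i))) \in word_pairs m.
    by apply: mem_span; exists w, i.
  exact: (submodZ (N := word_pairs m) _ Pw).
suff e_pair : (lie (e' a) (lie (f' j) (adw e' w (e' i))),
    lie (e (iota a)) (lie (f (iota j)) (adw e (map iota w) (e (iota i))))) \in word_pairs m.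
  exact: (submodB (N := word_pairs m) e_pair h_pair).
case: m {h_pair} wm => [/size0nil ->|m wm]; last exact: (word_pairs_lie_e a (IHw _ wm)).
rewrite /= (lie_f_gen C') (lie_f_gen C) (inj_eq iota_inj).
case: eqP => [->|_]; last by rewrite !linear0; exact: submod0.
rewrite !linearN /= (lie_e_h K') (lie_e_h K) !opprK (km_cartan K') (km_cartan K) iotaA.
exact: (submodZ (N := word_pairs 0) _ (word_pairs_gen a)).
Qed.

Lemma word_pairs_snd m y : y \in word_pairs m -> y.2 \in words_of_size (e := e) m /\
  forall l, (forall i, l != iota i) -> lie (f l) y.2 = 0.
Proof.
apply: (word_pairs_ind (Q := fun y => y.2 \in words_of_size (e := e) m /\
  forall l, (forall i, l != iota i) -> lie (f l) y.2 = 0)) => [|c x {}y [Qx fx] [Qy fy]|w i wm] /=.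
- by split=> [|l _]; rewrite ?linear0 ?submod0.
- by split=> [|l li]; [exact: submodDZ|rewrite linearP /= fx ?fy ?scaler0 ?addr0].
split=> [|l li]; first by apply: mem_span; exists (map iota w), (iota i); rewrite size_map.
elim: w {wm} => [|a w IHw] /=.
  by rewrite (lie_f_gen C) eq_sym (negbTE (li i)).
by rewrite (lie_f_lie_e C) IHw linear0 sub0r eq_sym (negbTE (li a)) oppr0.
Qed.

(** Induction on the length. Bracketing with [f' j] and [f (iota j)] gives a shorter pair whose
    first component is still zero, and the other [f l] kill [z] anyway, so [words_f_zero]
    applies. *)
Lemma word_pairs_fst0 m z : (0, z) \in word_pairs m -> z = 0.
Proof.
elim: m z => [|m IHm] z Pz; have [mz fz] := word_pairs_snd Pz.
  apply: (words_f_zero K mz) => l.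
  have [/existsP[j /eqP ->]|] := boolP [exists j, l == iota j]; last first.
    by rewrite negb_exists => /forallP li; exact: fz.
  (* For single generators the brackets lie on the lines of the coroots; functionals normalized at
     the two coroots show that both coefficients agree. *)
  have [m' [m'1 _]] := km_functional K' (km_coroot_neq0 K' j).
  have [m [m1 _]] := km_functional K (km_coroot_neq0 K (iota j)).
  have : m' (lie (f' j) 0) = m (lie (f (iota j)) z) /\
      exists c, lie (f (iota j)) z = c *: hh (cor (iota j)).
    apply: (word_pairs_ind (m := 0) (Q := fun y => m' (lie (f' j) y.1) = m (lie (f (iota j)) y.2) /\
      exists c, lie (f (iota j)) y.2 = c *: hh (cor (iota j)))) Pz => [|c x y [Qx [a ha]] [Qy [b hb]]|w i /size0nil -> /=].
    - by rewrite /= !linear0; split=> //; exists 0; rewrite scale0r.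
    - rewrite /= !linearP /= Qx Qy; split=> //; exists (c * a + b).
      by rewrite ha hb scalerA scalerDl.
    - rewrite (lie_f_gen C') (lie_f_gen C) (inj_eq iota_inj).
      case: eqP => [->|_]; last by rewrite !linear0; split=> //; exists 0; rewrite scale0r.
      by rewrite !linearN /= m1 m'1; split=> //; exists (-1); rewrite scaleN1r.
  move=> [m0 [c hc]]; move: m0; rewrite !linear0 hc linearZ /= m1 => /esym/eqP.
  by rewrite scaler_eq0 oner_eq0 orbF => /eqP ->; rewrite scale0r.
apply: (words_f_zero K mz) => l.
have [/existsP[j /eqP ->]|] := boolP [exists j, l == iota j]; last first.
  by rewrite negb_exists => /forallP li; exact: fz.
by apply: IHm; have := word_pairs_lie_f j Pz; rewrite /= linear0.
Qed.

Lemma adw_transfer w i : adw e' w (e' i) = 0 -> adw e (map iota w) (e (iota i)) = 0.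
Proof.
move=> w0; apply: (@word_pairs_fst0 (size w)); rewrite -w0.
by apply: mem_span; exists w, i.
Qed.

End Transfer.

Section DegreeOne.
Context {F : numFieldType} {n : nat} {A : 'M[int]_n} {H : lmodType F} {L : lieAlgType F}.
Context {hh : {linear H -> L}} {e f : 'I_n -> L} {cor : 'I_n -> H} {rt : 'I_n -> H -> F}.
Context (K : km_algebra A hh e f cor rt) (k : 'I_n).
Let C := km_chevalley K.

Definition other_gens (i : {i : 'I_n | i != k}) : L := e (val i).

Lemma adw_other_gens w v : adw other_gens w v = adw e (map val w) v.
Proof. by elim: w => //= i w ->. Qed.

(** An explicit description of the degree one part; [mem_km_grade1] identifies the two. *)
Definition degree1 : submodule L := span (fun x => exists w, x = adw other_gens w (e k)).

Lemma degree1_lie_gen i x : i != k -> x \in degree1 -> lie (e i) x \in degree1.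
Proof.
move=> ik; apply: span_map => _ [w ->]; apply: mem_span.
by exists (exist (fun i => i != k) i ik :: w).
Qed.

Lemma degree1_lie_adw w i x : i != k -> all (predC1 k) w ->
  x \in degree1 -> lie (adw e w (e i)) x \in degree1.
Proof.
move=> ik; elim: w x => [|j w IHw] x /=; first by move=> _; exact: degree1_lie_gen.
case/andP=> jk wk dx; rewrite lie_lie; apply: submodB.
  exact/degree1_lie_gen/IHw.
by apply: IHw wk _; exact: degree1_lie_gen.
Qed.

Lemma degree1_word w x : all (predC1 k) w -> x \in degree1 -> adw e w x \in degree1.
Proof.
by elim: w => //= i w IHw /andP[ik wk] dx; exact/degree1_lie_gen/IHw.
Qed.

Lemma degree1_gen : e k \in degree1.
Proof. by apply: mem_span; exists [::]. Qed.

(** If the letter [k] stands inside the word, antisymmetry turns [[e k, y]] into [- [y, e k]], where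
    [y] is a word without [k]; [ad y] is then a combination of words in the other generators. *)
Lemma degree1_adw w i : count_mem k (i :: w) = 1%N -> adw e w (e i) \in degree1.
Proof.
have no_k s : count_mem k s = 0%N -> all (predC1 k) s.
  by move=> s0; rewrite all_predC has_count s0.
rewrite /=; case: eqP => [-> [/no_k wk]|/eqP ik].
  exact: degree1_word wk degree1_gen.
rewrite add0n => cw; have kw : k \in w by rewrite -has_pred1 has_count cw.
case/splitPr: kw cw => w1 w2; rewrite count_cat /= eqxx add1n addnS => -[/eqP].
rewrite addn_eq0 => /andP[/eqP/no_k w1k /eqP/no_k w2k].
rewrite adw_cat; apply: degree1_word w1k _; rewrite /= lieC; apply: submodN.
exact: degree1_lie_adw degree1_gen.
Qed.

Context (om : H) (omP : forall j, rt j om = (j == k)%:R).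

Lemma weight_coweight w : weight (rt := rt) w om = (count_mem k w)%:R.
Proof.
rewrite /weight -sum1_count [X in X%:R]big_mkcond natr_sum; apply: eq_bigr => i _.
by rewrite omP /=; case: eqP.
Qed.

(** The spanning vectors of the triangular decomposition are eigenvectors of [om], whose eigenvalue
    is the number of letters [k], with a sign for the [f] side. Eigenvalue one leaves the words in
    the [e i] with a single [k]. *)
Lemma degree1_eigen x : lie (hh om) x = x -> x \in degree1.
Proof.
move=> x1; have Cs := chevalley_swap C.
pose P c y := lie (hh om) y = c *: y /\ (c = 1 -> y \in degree1).
suff : x \in span (P 1) by apply: span_sub => y [_]; apply.
apply: (eigen_span (T := lie (hh om))) => [c y []//|c a y [hy dy]||]; last by rewrite scale1r.
  split=> [|/dy]; last exact: submodZ.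
  by rewrite linearZ /= hy !scalerA mulrC.
have := triangular_span C (km_generated K) x; apply: span_mono => y [[h ->]|[w [i ->]]|[w [i ->]]].
- exists 0; split; first by rewrite (chevalley_hh C) scale0r.
  by move/esym/eqP; rewrite oner_eq0.
- exists (count_mem k (i :: w))%:R; split.
    by rewrite (lie_h_adw C _ (chevalley_he C _ _)) weight_coweight omP /= addnC natrD.
  by move/eqP; rewrite -[1]/(1%:R) eqr_nat => /eqP; exact: degree1_adw.
- exists (- (count_mem k (i :: w))%:R); split.
    rewrite (lie_h_adw Cs _ (chevalley_he Cs _ _)); congr (_ *: _).
    rewrite omP /= /weight sumrN -/(weight (rt := rt) w om) weight_coweight.
    by rewrite -opprD -natrD addnC.
  by move/eqP; rewrite eq_sym -subr_eq0 opprK -(natrD _ 1) pnatr_eq0.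
Qed.

End DegreeOne.

Section Bounded.
Context {F : numFieldType} {n : nat} {A : 'M[int]_n} (H : realization F A) (k : 'I_n).
Context (gcmA : gen_cartan A) (adm : admissible F A k).
Local Notation e := (km_e H).
Let K := kac_moody_km H.

Lemma gen_cartan_diag i : A i i = 2. Proof. by case: gcmA. Qed.
Lemma gen_cartan_sym i j : A i j = 0 -> A j i = 0. Proof. by case: gcmA => _ _; apply. Qed.
Lemma gen_cartan_neg i j : i != j -> exists m : nat, A i j = - m%:Z.
Proof.
case: gcmA => _ Aneg _ /Aneg; case: (A i j) => [m|m _]; last by exists m.+1; rewrite NegzE.
by rewrite lez_nat leqn0 => /eqP ->; exists 0.
Qed.

Lemma not_adjacent_commute i j : i != j -> ~~ adjacent A i j -> lie (e j) (e i) = 0.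
Proof.
rewrite /adjacent /arrow_mult => ij; rewrite (negbTE ij) eq_sym (negbTE ij).
rewrite negb_or -!leqNgt !leqn0 !absz_eq0 => /andP[/eqP Aji /eqP Aij].
by apply: (serre K (m := 0)); rewrite ?gen_cartan_diag // eq_sym.
Qed.

(** A letter outside the component of [i] commutes with all letters inside, hence with the word
    built so far. *)
Lemma word_component w i : i != k -> all (predC1 k) w -> adw e w (e i) != 0 ->
  all [in component_without A k i] w.
Proof.
set S := component_without A k i => ik; have iS : i \in S by rewrite inE connect0.
have Sk a : a \in S -> a != k.
  rewrite inE => /connectP[q qP ->]; elim/last_ind: q qP => // q b _.
  by rewrite rcons_path last_rcons => /andP[_ /and3P[]].
elim: w => //= j w IHw /andP[jk wk]; apply: contraNT; rewrite negb_and => jw.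
have [//|w0] := eqVneq (adw e w (e i)) 0; first by move=> ->; rewrite linear0.
have {}wS := IHw wk w0; rewrite wS orbF in jw.
have commute a : a \in S -> lie (e j) (e a) = 0.
  move=> aS; apply: not_adjacent_commute.
    by apply: contraNneq jw => <-.
  apply: contraNN jw => aj; move: (aS); rewrite !inE => /connect_trans; apply.
  by apply: connect1; rewrite Sk // jk.
apply/eqP; elim: w wS {IHw wk w0} => [_|a w IHw /andP[aS wS]] /=; first exact: commute.
by rewrite lie_derivation commute // lie0l IHw // linear0 addr0.
Qed.

Lemma component_bounded i : i != k -> exists N, forall w,
  all [in component_without A k i] w -> (N <= size w)%N -> adw e w (e i) = 0.
Proof.
move=> ik; have [H' finH'] := adm ik; have K' := kac_moody_km H'.
have [N NP] := km_fin_dim_bounded K' finH'; exists N => w wS Nw.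
set S := component_without A k i in H' finH' K' NP wS *.
have iS : i \in S by rewrite inE connect0.
have -> : w = map enum_val (map (enum_rank_in iS) w).
  rewrite -map_comp -[LHS]map_id; apply/eq_in_map => j jw.
  by rewrite /= enum_rankK_in //; exact: (allP wS).
rewrite -[i in e i](enum_rankK_in iS iS).
apply: (adw_transfer K' K) => [|a b|]; first exact: enum_val_inj.
  by rewrite mxE.
by apply: NP; rewrite size_map.
Qed.

Lemma other_gens_bounded : exists N, forall w i, (N <= size w)%N ->
  adw (other_gens (e := e) (k := k)) w (other_gens (e := e) (k := k) i) = 0.
Proof.
have /choice[N NP] i : exists N, i != k -> forall w,
    all [in component_without A k i] w -> (N <= size w)%N -> adw e w (e i) = 0.
  have [->|ik] := eqVneq i k; first by exists 0.
  by have [N NP] := component_bounded ik; exists N.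
exists (\max_i N i)%N => w [i ik] Nw; rewrite adw_other_gens /other_gens /=.
have wk : all (predC1 k) (map val w).
  by rewrite all_map; apply/allP => -[j jk] _.
apply/eqP; apply: contraT => w0; have wS := word_component ik wk w0.
rewrite (NP i ik _ wS) ?eqxx // in w0.
by rewrite size_map; apply: leq_trans Nw; exact: leq_bigmax.
Qed.

(** The Serre relations make each [e i] nilpotent on [e k], so local finiteness bounds the span of
    all words on [e k]; words of different length have different heights, so long words vanish. *)
Lemma degree1_bounded : exists N, forall w, (N <= size w)%N ->
  adw (other_gens (e := e) (k := k)) w (e k) = 0.
Proof.
have [N NP] := other_gens_bounded.
have [|J [b bP]] := adw_finite NP (v := e k).
  move=> [i ik]; have [m Aik] := gen_cartan_neg ik; exists m.+1.
  by apply: (serre K) Aik _ => //; [exact: gen_cartan_diag|exact: gen_cartan_sym].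
have [rho rho1] := km_rho K.
have er i : lie (km_h rho) (e i) = e i.
  by rewrite (chevalley_he (km_chevalley K)) rho1 scale1r.
exists #|J|; apply: (adw_bounded (r := km_h rho) (c := 1)) bP; last by rewrite scale1r.
by move=> [i ik]; exact: er.
Qed.

End Bounded.

(** * The degree one part and the case of simple arrows *)

Section GradeOne.
Context {F : numFieldType} {n : nat} {A : 'M[int]_n} (H : realization F A) (k : 'I_n).
Local Notation e := (km_e H).
Local Notation f := (km_f H).
Local Notation L := (kac_moody H).
Local Notation V := (submod_type (km_grade H k 1)).
Local Notation I := {i : 'I_n | i != k}.
Local Notation g := (other_gens (e := e) (k := k)).
Let K := kac_moody_km H.
Let C := km_chevalley K.

Lemma mem_km_grade1 x : x \in km_grade H k 1 <-> x \in degree1 (e := e) k.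
Proof.
split; last first.
  apply: span_mono => _ [w ->]; rewrite adw_other_gens.
  exists (fun j => (count_mem j (map val w))%:Z + (j == k)%:Z); split.
    rewrite eqxx (_ : count_mem k _ = 0%N) //; apply/count_memPn/negP.
    by case/mapP=> -[j jk] _ /= kj; move: (jk); rewrite -kj eqxx.
  move=> h; rewrite (lie_h_adw C _ (chevalley_he C _ _)); congr (_ *: _).
  rewrite sum_lfunE (eq_bigr (fun j => (count_mem j (map val w))%:R * (root H j h : F)
    + (j == k)%:R * root H j h)) => [|j _]; last first.
    by rewrite scale_lfunE -mulrDl; congr (_ * _); rewrite intrD.
  rewrite big_split /=; congr (_ + _); last first.
    rewrite (bigD1 k) //= eqxx mul1r big1 ?addr0 // => j /negbTE ->.
    by rewrite mul0r.
  rewrite /weight; elim: (map val w) => [|a s IHs].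
    by rewrite big_nil big1 // => j _; rewrite mul0r.
  rewrite big_cons IHs.
  rewrite [RHS](eq_bigr (fun j => (j == a)%:R * (root H j h : F) + (count_mem j s)%:R * root H j h)) => [|j _].
    rewrite big_split /=; congr (_ + _).
    rewrite (bigD1 a) //= eqxx mul1r big1 ?addr0 // => j /negbTE ->.
    by rewrite mul0r.
  by rewrite /= natrD mulrDl eq_sym.
have [om omP] := root_dual H.
have omk j : root H j (om k) = (j == k)%:R by rewrite omP eq_sym.
move=> gx; apply: (degree1_eigen K omk); move: x gx.
apply: (span_ind (Q := fun x => lie (km_h (om k)) x = x)) => [|a z y [c [ck cz]] hy].
  by rewrite linear0.
rewrite linearP /= hy; congr (_ *: _ + _); rewrite cz sum_lfunE (bigD1 k) //= big1 => [|j jk].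
  by rewrite scale_lfunE omk eqxx ck addr0 -[X in X *: z]/(1 * 1 : F) mulr1 scale1r.
by rewrite scale_lfunE omk (negbTE jk) scaler0.
Qed.

Fact grade1_der_mem (i : I) (v : V) : lie (g i) (submod_val v) \in km_grade H k 1.
Proof. by apply/mem_km_grade1/degree1_lie_gen; [exact: valP i|exact/mem_km_grade1/valP]. Qed.

Definition grade1_der_fun i v : V := SubmodType (grade1_der_mem i v).

Fact grade1_der_linear i : linear (grade1_der_fun i).
Proof. by move=> c u v; apply: val_inj; rewrite /= !linearP. Qed.
HB.instance Definition _ i := GRing.isLinear.Build F V V *:%R (grade1_der_fun i) (grade1_der_linear i).
Definition grade1_der i : {linear V -> V} := grade1_der_fun i.

Fact grade1_gen_mem : e k \in km_grade H k 1.
Proof. exact/mem_km_grade1/degree1_gen. Qed.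
Definition grade1_gen : V := SubmodType grade1_gen_mem.

Lemma grade1_bracket_wedge u v :
  grade1_bracket H k (wedge2 u v) = lie (submod_val u) (submod_val v).
Proof. exact: pm_lift_class. Qed.

(** Equivariance of the bracket, which makes its kernel stable under the derivations. *)
Lemma grade1_bracket_der i om :
  grade1_bracket H k (ext2_der (grade1_der i) om) = lie (g i) (grade1_bracket H k om).
Proof.
elim/(@pres_mod_ind _ _ (@ext2_rel F V)): om => [|c x y IHx IHy|[u v]].
- by rewrite !linear0.
- by rewrite !linearP /= IHx IHy.
- rewrite -/(wedge2 u v) ext2_der_wedge2 linearD /= !grade1_bracket_wedge.
  by rewrite [RHS]lie_derivation.
Qed.

Lemma mem_ker_grade1 om :
  om \in ker_mod (grade1_bracket H k) <-> grade1_bracket H k om = 0.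
Proof. by split=> [/eqP|om0]; [|apply/eqP]. Qed.

Lemma grade1_word w :
  submod_val (foldr (fun i v => grade1_der i v) grade1_gen w) = adw g w (e k).
Proof. by elim: w => //= i w <-. Qed.

Lemma koszul_nilpotent_of_simple_arrows : gen_cartan A -> admissible F A k ->
  (forall i, i != k -> A k i = 0 \/ A k i = -1) ->
  koszul_nilpotent (ker_mod (grade1_bracket H k)).
Proof.
move=> gcmA adm simple; have [N NP] := degree1_bounded H gcmA adm.
apply: (@koszul_nilpotent_criterion _ _ _ _ grade1_der grade1_gen N).
- move=> i om /mem_ker_grade1 om0; apply/mem_ker_grade1.
  by rewrite grade1_bracket_der om0 linear0.
- move=> [i ik]; apply/mem_ker_grade1; rewrite grade1_bracket_wedge /= /other_gens /=.
  have Akk := gen_cartan_diag gcmA k; have ki : k != i by rewrite eq_sym.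
  (* The bracket sends [x /\ [e i, x]] to [- [e k, [e k, e i]]], which a Serre relation kills
     because [A k i] is 0 or -1. *)
  have eki : iter 2 (lie (e k)) (e i) = 0.
    case: (simple i ik) => Aki.
      apply: (iter_lie_le (m := 1)) => //.
      by apply: (serre K (m := 0) ki Akk) => [|_]; [|exact: gen_cartan_sym gcmA _ _ Aki].
    by apply: (serre K (m := 1) ki Akk) => //; rewrite Aki.
  by rewrite [lie (e i) _]lieC linearN /= -[lie _ _]/(iter 2 (lie (e k)) (e i)) eki oppr0.
- move=> v; have /mem_km_grade1 := valP v.
  suff spanV y : y \in degree1 (e := e) k -> exists2 v', submod_val v' = y &
      v' \in Defs.span (fun u => exists w, u = foldr (fun i v => grade1_der i v) grade1_gen w).
    by case/spanV => v' /val_inj <-.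
  apply: (span_ind (Q := fun y => exists2 v', submod_val v' = y & v' \in Defs.span _)) => [|c _ {}y [w ->] [v' <- v'P]].
    by exists 0; [rewrite linear0|exact: submod0].
  exists (c *: foldr (fun i v => grade1_der i v) grade1_gen w + v').
    by rewrite linearP /= grade1_word.
  by apply: submodDZ => //; apply: mem_span; exists w.
- by move=> w Nw; apply: val_inj; rewrite /= grade1_word NP.
Qed.

End GradeOne.

(** * Multiple arrows towards the node *)

Section DoubleArrow.
Context {F : numFieldType} {n : nat} {A : 'M[int]_n} {H : lmodType F} {L : lieAlgType F}.
Context {hh : {linear H -> L}} {e f : 'I_n -> L} {cor : 'I_n -> H} {rt : 'I_n -> H -> F}.
Context (K : km_algebra A hh e f cor rt) (k i : 'I_n) (ik : i != k).
Context (Akk : A k k = 2) (Aki1 : A k i != -1).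
Context (m : {linear L -> F^o}) (m_cor : m (hh (cor k)) = 1).
Context (m_h : forall h x, m (lie (hh h) x) = 0).
Let C := km_chevalley K.
Local Notation g := (other_gens (e := e) (k := k)).

(** The three coefficients lower a vector to the Cartan subalgebra and apply [m], which kills all
    nonzero weights. Up to scalars the first two are the coordinates [phi] and [psi], and
    [coef_ekik] detects [[x, [e i, x]]] in degree two. *)
Definition coef_ek x : F := m (lie (f k) x).
Definition coef_eik x : F := m (lie (f k) (lie (f i) x)).
Definition coef_ekik x : F := coef_eik (lie (f k) x).

Lemma functional_eigen h c x : c != 0 -> lie (hh h) x = c *: x -> m x = 0.
Proof.
move=> c0 hx; have := m_h h x; rewrite hx linearZ => /eqP.
by rewrite scaler_eq0 (negbTE c0) => /eqP.
Qed.

Lemma lie_h_f h c j x : lie (hh h) x = c *: x ->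
  lie (hh h) (lie (f j) x) = (c - rt j h) *: lie (f j) x.
Proof.
move=> hx; rewrite lie_derivation hx (chevalley_hf C) lieZl linearZ /=.
by rewrite -scalerDl addrC.
Qed.

Lemma lie_h_lie h c d x y : lie (hh h) x = c *: x -> lie (hh h) y = d *: y ->
  lie (hh h) (lie x y) = (c + d) *: lie x y.
Proof. by move=> hx hy; rewrite lie_derivation hx hy lieZl linearZ /= -scalerDl. Qed.

Lemma lie_h_word h w :
  lie (hh h) (adw g w (e k)) = (weight (rt := rt) (map val w) h + rt k h) *: adw g w (e k).
Proof. by rewrite adw_other_gens (lie_h_adw C _ (chevalley_he C h k)). Qed.

Lemma coef_ek_word h w : weight (rt := rt) (map val w) h != 0 -> coef_ek (adw g w (e k)) = 0.
Proof.
move=> wh; apply: (functional_eigen (h := h) wh).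
by rewrite (lie_h_f _ (lie_h_word h w)) addrK.
Qed.

Lemma coef_eik_word h w : weight (rt := rt) (map val w) h != rt i h ->
  coef_eik (adw g w (e k)) = 0.
Proof.
rewrite -subr_eq0 => wh; apply: (functional_eigen (h := h) wh).
rewrite (lie_h_f _ (lie_h_f _ (lie_h_word h w))).
by congr (_ *: _); ring.
Qed.

Lemma coef_ekik_words h w w' :
  weight (rt := rt) (map val w) h + weight (rt := rt) (map val w') h != rt i h ->
  coef_ekik (lie (adw g w (e k)) (adw g w' (e k))) = 0.
Proof.
rewrite -subr_eq0 => wh; apply: (functional_eigen (h := h) wh).
rewrite (lie_h_f _ (lie_h_f _ (lie_h_f _ (lie_h_lie (lie_h_word h w) (lie_h_word h w'))))).
by congr (_ *: _); ring.
Qed.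

Lemma coef_ek_ek : coef_ek (e k) = -1.
Proof. by rewrite /coef_ek (lie_f_gen C) eqxx linearN /= m_cor. Qed.

Lemma coef_eik_ek : coef_eik (e k) = 0.
Proof. by rewrite /coef_eik (lie_f_gen C) eq_sym (negbTE ik) !linear0. Qed.

Lemma lie_fi_eik : lie (f i) (lie (e i) (e k)) = - (A i k)%:~R *: e k.
Proof.
rewrite (lie_f_lie_e C) eqxx (lie_f_gen C) eq_sym (negbTE ik) linear0 sub0r.
by rewrite (chevalley_he C) (km_cartan K) scaleNr.
Qed.

Lemma coef_eik_eik : coef_eik (lie (e i) (e k)) = (A i k)%:~R.
Proof.
rewrite /coef_eik lie_fi_eik linearZ /= linearZ /= (lie_f_gen C) eqxx linearN /= m_cor.
by rewrite scalerN scaleNr opprK [LHS]mulr1.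
Qed.

Lemma coef_ekik_ekik :
  coef_ekik (lie (e k) (lie (e i) (e k))) = - (2 * (1 + (A k i)%:~R)) * (A i k)%:~R.
Proof.
have ki : k != i by rewrite eq_sym.
rewrite /coef_ekik [lie (e i) _]lieC linearN /= -[lie _ (lie _ _)]/(iter 2 (lie (e k)) (e i)).
rewrite linearN /= (lie_f_iter_same K 1 ki Akk) /= scaleNr opprK.
have eikZ c x : coef_eik (c *: x) = c * coef_eik x by rewrite /coef_eik !linearZ.
by rewrite lieC scalerN -scaleNr eikZ coef_eik_eik; ring.
Qed.

(** The element [rho] counts letters, and [rt i] takes the value one on it. *)
Lemma exists_coweight (w w' : seq {j : 'I_n | j != k}) : (1 < size w + size w')%N ->
  exists h, weight (rt := rt) (map val w) h + weight (rt := rt) (map val w') h != rt i h.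
Proof.
move=> ww; have [rho rho1] := km_rho K; exists rho.
have wrho (s : seq 'I_n) : weight (rt := rt) s rho = (size s)%:R.
  by rewrite /weight (eq_bigr (fun=> 1)) // big_const_seq count_predT iter_addr_0.
by rewrite !wrho rho1 -natrD -[1]/(1%:R) eqr_nat !size_map gtn_eqF.
Qed.

(** The ratio that makes [coef_ekik] of [[e k, [e i, e k]]] equal to minus [coef_eik] of
    [[e i, e k]]; the inverse is genuine because [A k i != -1]. *)
Let t : F := (2 * (1 + (A k i)%:~R))^-1.

(** Only the word [[:: i]] contributes. For any other nonempty word an element of the Cartan
    subalgebra shows that the weights do not match, and both sides vanish for the empty one. *)
Lemma area_words_nil w :
  t * coef_ekik (lie (e k) (adw g w (e k))) =
    coef_ek (e k) * coef_eik (adw g w (e k)) - coef_ek (adw g w (e k)) * coef_eik (e k).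
Proof.
rewrite coef_eik_ek mulr0 subr0 coef_ek_ek mulN1r.
have [rho rho1] := km_rho K; have [om omP] := km_coweight K.
case: w => [|[j jk] [|l w]].
- by rewrite /= lievv /coef_ekik /coef_eik !linear0 mulr0 -/(coef_eik (e k)) coef_eik_ek oppr0.
- have [ji|ji] := eqVneq j i.
    rewrite /= /other_gens /= ji coef_eik_eik coef_ekik_ekik /t mulrA mulrN mulVf ?mulN1r //.
    rewrite mulf_neq0 ?pnatr_eq0 // addrC -[1]/(1%:~R) -intrD intr_eq0.
    by rewrite addr_eq0.
  have wh : weight (rt := rt) [:: j] (om i) != rt i (om i).
    by rewrite /weight big_seq1 !omP eqxx [i == j]eq_sym (negbTE ji) eq_sym oner_eq0.
  rewrite (coef_eik_word (h := om i)) // oppr0.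
  by rewrite (coef_ekik_words (h := om i) (w := [::])) ?mulr0 // /weight big_nil add0r.
- set w' := _ :: _; have [h wh] := @exists_coweight [::] w' isT.
  rewrite (coef_ekik_words (w := [::]) wh) mulr0 (coef_eik_word (h := h)) ?oppr0 //.
  by move: wh; rewrite /weight big_nil add0r.
Qed.

Lemma area_words w w' :
  t * coef_ekik (lie (adw g w (e k)) (adw g w' (e k))) =
    coef_ek (adw g w (e k)) * coef_eik (adw g w' (e k)) -
    coef_ek (adw g w' (e k)) * coef_eik (adw g w (e k)).
Proof.
have ek_word j s : coef_ek (adw g (j :: s) (e k)) = 0.
  have [rho rho1] := km_rho K; apply: (coef_ek_word (h := rho)).
  rewrite /weight (eq_bigr (fun=> 1)) // big_const_seq count_predT iter_addr_0.
  by rewrite size_map pnatr_eq0.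
case: w => [|j w]; first exact: area_words_nil.
case: w' => [|j' w'].
  rewrite [lie _ _]lieC /coef_ekik /coef_eik !linearN mulrN.
  by rewrite -/(coef_eik _) -/(coef_ekik _) area_words_nil opprB.
rewrite !ek_word !mul0r subr0.
have [|h wh] := @exists_coweight (j :: w) (j' :: w'); first by rewrite /= addnS.
by rewrite (coef_ekik_words wh) mulr0.
Qed.

(** This is the factorization of [phi /\ psi] through the bracket, extended bilinearly from
    words. *)
Lemma area_degree1 x y : x \in degree1 (e := e) k -> y \in degree1 (e := e) k ->
  t * coef_ekik (lie x y) = coef_ek x * coef_eik y - coef_ek y * coef_eik x.
Proof.
have ekP c u v : coef_ek (c *: u + v) = c * coef_ek u + coef_ek v.
  by rewrite /coef_ek !linearP.
have eikP c u v : coef_eik (c *: u + v) = c * coef_eik u + coef_eik v.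
  by rewrite /coef_eik !linearP.
have ekikP c u v : coef_ekik (c *: u + v) = c * coef_ekik u + coef_ekik v.
  by rewrite /coef_ekik linearP eikP.
have ek0 : coef_ek 0 = 0 by rewrite /coef_ek !linear0.
have eik0 : coef_eik 0 = 0 by rewrite /coef_eik !linear0.
have ekik0 : coef_ekik 0 = 0 by rewrite /coef_ekik linear0.
move=> dx dy; move: x dx; apply: (span_ind (Q := fun x => t * coef_ekik (lie x y) =
   coef_ek x * coef_eik y - coef_ek y * coef_eik x)) => [|c _ x [w ->] IHx].
  by rewrite lie0l ekik0 ek0 eik0 !mulr0 mul0r subr0.
rewrite lie_linearl ekikP ekP eikP.
suff hw : t * coef_ekik (lie (adw g w (e k)) y) =
    coef_ek (adw g w (e k)) * coef_eik y - coef_ek y * coef_eik (adw g w (e k)).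
  by rewrite mulrDr mulrCA hw IHx; ring.
move: y dy {x IHx}; apply: (span_ind (Q := fun y => t * coef_ekik (lie (adw g w (e k)) y) =
    coef_ek (adw g w (e k)) * coef_eik y - coef_ek y * coef_eik (adw g w (e k)))) => [|d _ y [w' ->] IHy].
  by rewrite linear0 ekik0 ek0 eik0 !mulr0 mul0r subr0.
by rewrite lie_linearr ekikP ekP eikP mulrDr mulrCA area_words IHy; ring.
Qed.

End DoubleArrow.

Lemma koszul_not_nilpotent_of_double_arrow (F : numFieldType) (n : nat) (A : 'M[int]_n)
    (H : realization F A) (k i : 'I_n) :
  gen_cartan A -> i != k -> A k i != 0 -> A k i != -1 ->
  ~ koszul_nilpotent (ker_mod (grade1_bracket H k)).
Proof.
move=> gcmA ik Aki0 Aki1; pose K := kac_moody_km H.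
have Akk := gen_cartan_diag gcmA k.
have Aik0 : A i k != 0 by apply: contraNneq Aki0 => /(gen_cartan_sym gcmA) ->.
have [m [m1 mh]] := km_functional K (km_coroot_neq0 K k).
pose V := submod_type (km_grade H k 1).
pose phi : {linear V -> F^o} := m \o lie (km_f H k) \o @submod_val _ _ _.
pose psi0 : {linear kac_moody H -> F^o} := m \o lie (km_f H k) \o lie (km_f H i).
pose psi : {linear V -> F^o} := psi0 \o @submod_val _ _ _.
pose t : F := (2 * (1 + (A k i)%:~R))^-1.
pose area : {linear ext2 V -> F^o} := t \*: (psi0 \o lie (km_f H k) \o grade1_bracket H k).
have ueik : lie (km_e H i) (km_e H k) \in km_grade H k 1.
  by apply/mem_km_grade1/degree1_lie_gen => //; exact: degree1_gen.
apply: (@koszul_not_nilpotent _ _ _ phi psi area (grade1_gen H k) (SubmodType ueik)).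
- move=> v w; rewrite /area /= grade1_bracket_wedge.
  apply: (area_degree1 K ik Akk _ m1 mh) => //; apply/mem_km_grade1; exact: valP.
- move=> om /mem_ker_grade1 om0.
  by rewrite /area [LHS]/= om0 !linear0.
- by rewrite [phi _](coef_ek_ek K m1) oppr_eq0 oner_eq0.
- exact: (coef_eik_ek K ik m).
- by rewrite [psi _](coef_eik_eik K ik m1) intr_eq0.
Qed.

Theorem theorem2 (R : realType) (n : nat) (A : 'M[int]_n) (k : 'I_n)
    (H : realization R[i] A) (m : nat)
    (gcmA : gen_cartan A)
    (adm : admissible R[i] A k)
    (max_m : max_mult_towards A k m) :
  koszul_nilpotent (ker_mod (grade1_bracket H k)) <-> m = 1%N.
Proof.
have [[i [i_pos im]] m_max] := max_m.
have ik : i != k by apply: contraTneq i_pos => ->; rewrite /arrow_mult eqxx.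
split=> [|m1].
  (* The arrow from [i] realizes the maximum: its existence excludes [A k i = 0], and [m <> 1]
     excludes [A k i = -1]. *)
  apply: contraPP => m1; apply: (@koszul_not_nilpotent_of_double_arrow _ _ _ _ _ i) => //.
    by move: i_pos; rewrite /arrow_mult (negbTE ik) absz_gt0.
  by apply/eqP => Aki; apply: m1; rewrite -im /arrow_mult (negbTE ik) Aki.
apply: koszul_nilpotent_of_simple_arrows => // j jk.
have kj : k != j by rewrite eq_sym.
have [a Akj] := gen_cartan_neg gcmA kj.
have := m_max j; rewrite /arrow_mult (negbTE jk) m1 Akj abszN absz_nat.
by case: a {Akj} => [|[|]] // _; [left|right].
Qed.
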